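(* There exist a real elliptic curve $(\mathcal{C},\sigma)$ with nonempty real part $\mathcal{C}_\sigma$ and a meromorphic function $f:\mathcal{C}\to\mathbb{CP}^1$ of degree $3$, with $3$ of its $6$ critical points lying on $\mathcal{C}_\sigma$, which cannot be made real by a M\''obius transformation of the image $\mathbb{CP}^1$; that is, there is no M\''obius transformation $\varphi:\mathbb{CP}^1\to\mathbb{CP}^1$ such that $\tau\circ(\varphi\circ f)\circ\sigma=\varphi\circ f$, where $\tau$ is the standard complex conjugation on $\mathbb{CP}^1$.
   Context: A real elliptic curve $(\mathcal{C},\sigma)$ is a compact Riemann surface $\mathcal{C}$ of genus $1$ together with an antiholomorphic involution $\sigma:\mathcal{C}\to\mathcal{C}$; its real part $\mathcal{C}_\sigma$ is the set of fixed points of $\sigma$. A meromorphic function of degree $3$ on $\mathcal{C}$ is a holomorphic map $\mathcal{C}\to\mathbb{CP}^1$ of degree $3$; by the Riemann--Hurwitz formula it has $6$ critical points counted with multiplicity. *)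

(* Defs.v *)
From HB Require Import structures.
From mathcomp Require Import all_boot all_order all_algebra.
From mathcomp Require Import all_classical all_reals all_analysis.
From mathcomp Require Import complex.

Set Implicit Arguments.
Unset Strict Implicit.
Unset Printing Implicit Defensive.

Import Order.TTheory GRing.Theory Num.Theory.
Import numFieldNormedType.Exports.

Local Open Scope classical_set_scope.
Local Open Scope ring_scope.

(** [R[i]] itself carries no canonical topology; presenting it as a
    [numClosedFieldType] gives it the one induced by the modulus, and makes
    [derivable] below mean complex differentiability. *)
Definition cplx (R : realType) : numClosedFieldType := R[i].

Section RiemannSurfaces.
Variable R : realType.
Local Notation C := (cplx R).

Definition holomorphic_at (g : C -> C) (a : C) : Prop :=
  \forall z \near a, derivable g z 1.

(** [chart_fun] and [chart_inv] are total functions, meaningful only on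
    [chart_dom] and on [chart_fun @` chart_dom] respectively. *)
Record chart (M : topologicalType) := Chart {
  chart_dom : set M;
  chart_fun : M -> C;
  chart_inv : C -> M;
  chart_dom_open : open chart_dom;
  chart_img_open : open (chart_fun @` chart_dom);
  chart_funK : {in chart_dom, cancel chart_fun chart_inv};
  chart_fun_continuous : {in chart_dom, continuous chart_fun};
  chart_inv_continuous : {in chart_fun @` chart_dom, continuous chart_inv}
}.

Record riemann_surface := RiemannSurface {
  surface_carrier :> topologicalType;
  surface_atlas : set (chart surface_carrier);
  surface_hausdorff : hausdorff_space surface_carrier;
  surface_connected : connected [set: surface_carrier];
  surface_covered : forall p : surface_carrier,
    exists2 c, surface_atlas c & chart_dom c p;
  surface_compatible : forall c d, surface_atlas c -> surface_atlas d ->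
    forall p, chart_dom c p -> chart_dom d p ->
      holomorphic_at (chart_fun d \o chart_inv c) (chart_fun c p)
}.

Definition chart_at (M : riemann_surface) (p : M) (c : chart M) : Prop :=
  surface_atlas c /\ chart_dom c p.

Definition local_expr (M N : riemann_surface) (f : M -> N)
    (c : chart M) (d : chart N) : C -> C :=
  chart_fun d \o f \o chart_inv c.

Definition holomorphic_map (M N : riemann_surface) (f : M -> N) : Prop :=
  continuous f /\
  forall p c d, chart_at p c -> chart_at (f p) d ->
    holomorphic_at (local_expr f c d) (chart_fun c p).

Definition antiholomorphic_map (M N : riemann_surface) (f : M -> N) : Prop :=
  continuous f /\
  forall p c d, chart_at p c -> chart_at (f p) d ->
    holomorphic_at (fun z => (local_expr f c d z)^*) (chart_fun c p).

Definition homeomorphic (X Y : topologicalType) : Prop :=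
  exists (f : X -> Y) (g : Y -> X),
    [/\ continuous f, continuous g, cancel f g & cancel g f].

Definition circle : topologicalType := set_type [set z : C | `|z| = 1].

(** A compact connected orientable surface has genus 1 when it is a torus. *)
Definition genus_one (M : riemann_surface) : Prop :=
  homeomorphic M (circle * circle)%type.

(** [g z - g a] vanishes at [a] to order exactly [k]:
    [g z - g a ~ l (z - a)^k] as [z] tends to [a], with [l] nonzero. *)
Definition takes_value_with_order (g : C -> C) (a : C) (k : nat) : Prop :=
  exists2 l : C, l != 0 & (g z - g a) / (z - a) ^+ k @[z --> a^'] --> l.

(** The multiplicity (ramification index) of [f] at [p]; for a nonconstant
    holomorphic [f] there is exactly one such [k], it is positive, and it does
    not depend on the charts. *)
Definition multiplicity (M N : riemann_surface) (f : M -> N) (p : M) : nat :=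
  get [set k | exists c d, [/\ chart_at p c, chart_at (f p) d &
                 takes_value_with_order (local_expr f c d) (chart_fun c p) k]].

(** [\sum_(p \in A) F p] is [0] when [F] has infinite support in [A]; hence for
    [0 < n] the equalities below entail the finiteness of the support. *)
Definition has_degree (M N : riemann_surface) (f : M -> N) (n : nat) : Prop :=
  forall q : N, \sum_(p \in f @^-1` [set q]) multiplicity f p = n.

(** The number of critical points of [f] in [A], where [p] is counted
    [multiplicity f p - 1] times (so noncritical points contribute [0]). *)
Definition critical_points_count (M N : riemann_surface) (f : M -> N)
    (A : set M) : nat :=
  \sum_(p \in A) (multiplicity f p).-1.

Record real_elliptic_curve := RealEllipticCurve {
  curve :> riemann_surface;
  curve_compact : compact [set: curve];
  curve_genus_one : genus_one curve;
  curve_conj : curve -> curve;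
  curve_conj_antiholomorphic : antiholomorphic_map curve_conj;
  curve_conj_involutive : involutive curve_conj
}.

Definition real_part (E : real_elliptic_curve) : set E :=
  [set p | curve_conj p = p].

(** The Riemann sphere: [C] together with the point [None] at infinity, with
    the coordinates [z] and [1/z]. *)

Local Notation sphere := (one_point_compactification C).

Definition sphere_coord0_dom : set sphere := [set p | p <> None].
Definition sphere_coord1_dom : set sphere := [set p | p <> Some 0].

Definition sphere_coord0 (p : sphere) : C := odflt 0 p.
Definition sphere_inv0 (z : C) : sphere := Some z.
Definition sphere_coord1 (p : sphere) : C :=
  if p is Some z then z^-1 else 0.
Definition sphere_inv1 (w : C) : sphere :=
  if w == 0 then None else Some w^-1.

Definition cplx_of_real (x : R) : C := (x%:C)%C.

Lemma cplx_of_real_continuous : continuous cplx_of_real.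
Proof.
move=> x; apply/(@cvgrPdist_lt _ C) => -[e e'].
rewrite ltcE /= => /andP[/eqP -> e0].
near=> y; rewrite /cplx_of_real -rmorphB /= normc_def /= expr0n addr0.
rewrite sqrtr_sqr ltcR.
near: y; exact: cvgr_dist_lt.
Unshelve. all: by end_near. Qed.

Definition cplx_of_pair (u : R * R) : C :=
  cplx_of_real u.1 + 'i%C * cplx_of_real u.2.

Lemma cplx_of_pair_continuous : continuous cplx_of_pair.
Proof.
move=> u; apply: (@cvgD _ C).
  apply: (@continuous_comp _ _ _ fst cplx_of_real); first exact: cvg_fst.
  exact: cplx_of_real_continuous.
apply: (@cvgM C); first exact: cvg_cst.
apply: (@continuous_comp _ _ _ snd cplx_of_real); first exact: cvg_snd.
exact: cplx_of_real_continuous.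
Qed.

Lemma cplx_of_pairE (z : C) : z = cplx_of_pair (complex.Re z, complex.Im z).
Proof. by rewrite {1}(complexE z). Qed.

Lemma cplx_Re_continuous : continuous (@complex.Re R : C -> R).
Proof.
move=> z; apply/(@cvgrPdist_lt _ R^o _ _ (nbhs_filter z)) => e e0.
apply/(@nbhs_ballP _ C); exists (cplx_of_real e); first by rewrite /= ltcR.
move=> w zw; rewrite /= -ltcR -raddfB.
exact: le_lt_trans (normc_ge_Re _) zw.
Qed.

Definition cplx_modulus (z : C) : R := complex.Re `|z|.

Lemma cplx_modulusE (z : C) : `|z| = cplx_of_real (cplx_modulus z).
Proof. by rewrite /cplx_modulus normc_def. Qed.

Lemma cplx_modulus_continuous : continuous cplx_modulus.
Proof.
move=> z; apply: (@continuous_comp _ _ _ (Num.norm : C -> C)).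
  exact: (@norm_continuous _ C).
exact: cplx_Re_continuous.
Qed.

Lemma cplx_disk_closed (e : R) : closed [set z : C | cplx_modulus z <= e].
Proof.
apply: (@preimage_closed _ _ cplx_modulus [set x | x <= e]).
  by move=> z _; exact: cplx_modulus_continuous.
exact: closed_le.
Qed.

Lemma cplx_disk_compact (e : R) : compact [set z : C | cplx_modulus z <= e].
Proof.
apply: (@subclosed_compact _ _ (cplx_of_pair @` (`[- e, e] `*` `[- e, e]))).
- exact: cplx_disk_closed.
- apply: continuous_compact.
    exact/continuous_subspaceT/cplx_of_pair_continuous.
  by apply: compact_setX; exact: segment_compact.
move=> z /= ze; exists (complex.Re z, complex.Im z);
  last by rewrite -cplx_of_pairE.
have ze' : `|z| <= cplx_of_real e by rewrite cplx_modulusE lecR.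
split; rewrite /= in_itv /= -ler_norml -lecR; apply: le_trans ze'.
  exact: normc_ge_Re.
rewrite -normrN -ReiNIm -[leRHS]mulr1 (_ : 1 = `|'i%C : C|) -?normrM.
  exact: normc_ge_Re.
by rewrite normc_def /= expr0n expr1n add0r sqrtr1.
Qed.

Lemma cplx_compact_in_disk (K : set C) :
  compact K -> exists2 e : R, 0 < e & forall z, K z -> cplx_modulus z < e.
Proof.
move=> cK; have : compact (cplx_modulus @` K).
  apply: continuous_compact => //.
  exact/continuous_subspaceT/cplx_modulus_continuous.
move=> /compact_bounded [M [_ MK]].
exists (`|M| + 1) => [|z Kz]; first by rewrite ltr_wpDl.
apply: le_lt_trans (ler_norm _) _.
apply: le_lt_trans (_ : _ <= `|M| + 2^-1) _; last first.
  by rewrite ltrD2l invf_lt1 // ltr1n.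
by apply: (MK (`|M| + 2^-1)) => //=; [
  rewrite (le_lt_trans (ler_norm _)) // ltrDl | exists z].
Qed.

Lemma cplx_connected : connected [set: C].
Proof.
have -> : [set: C] =
    \bigcup_(z in [set: C]) ((fun t : R => cplx_of_real t * z) @` `[0, 1]).
  apply/seteqP; split=> // z _; exists z => //; exists 1 => /=.
    by rewrite in_itv /= ler01 lexx.
  by rewrite /cplx_of_real rmorph1 mul1r.
apply: bigcup_connected.
  exists 0 => z _; exists 0 => /=; first by rewrite in_itv /= lexx ler01.
  by rewrite /cplx_of_real rmorph0 mul0r.
move=> z _; apply: connected_continuous_connected.
  exact: segment_connected.
apply: continuous_subspaceT => t; apply: (@cvgM C); last exact: cvg_cst.
exact: cplx_of_real_continuous.
Qed.

Lemma cplx_hausdorff : hausdorff_space C.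
Proof. exact: (@norm_hausdorff _ C). Qed.

Lemma cplx_locally_compact : locally_compact [set: C].
Proof.
move=> z _; rewrite withinET.
exists [set w | cplx_modulus w <= cplx_modulus z + 1].
  near=> w => /=; apply/ltW.
  rewrite -[ltLHS](subrK (cplx_modulus z)) addrC ltrD2l.
  apply: le_lt_trans (ler_norm _) _; rewrite distrC.
  by near: w; apply: cvgr_dist_lt => //; exact: cplx_modulus_continuous.
by split; [exact: cplx_disk_compact|exact: cplx_disk_closed].
Unshelve. all: by end_near. Qed.

Lemma sphere_nbhs_infty (e : R) :
  nbhs (None : sphere)
    [set p | if p is Some z then e < cplx_modulus z else True].
Proof.
exists [set z : C | cplx_modulus z <= e].
  by split; [exact: cplx_disk_compact|exact: cplx_disk_closed].
by move=> p /= [[z /negP]|->//]; rewrite -ltNge => ez <-.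
Qed.

Lemma sphere_nbhs_finite (z : C) (A : set sphere) :
  nbhs z (Some @^-1` A) -> nbhs (Some z : sphere) A.
Proof. by []. Qed.

Lemma sphere_hausdorff : hausdorff_space sphere.
Proof.
apply: one_point_compactification_hausdorff.
  exact: cplx_locally_compact.
exact: cplx_hausdorff.
Qed.

Lemma sphere_connected : connected [set: sphere].
Proof.
have -> : [set: sphere] = closure (Some @` [set: C] : set sphere).
  apply/seteqP; split=> // -[z|] _ B.
    by move=> /nbhs_singleton Bz; exists (Some z); split=> //; exists z.
  move=> [K [cK _]] KB; have [e e0 Ke] := cplx_compact_in_disk cK.
  exists (Some (cplx_of_real e)); split; first by exists (cplx_of_real e).
  apply: KB; left; exists (cplx_of_real e) => // /Ke.
  rewrite /cplx_modulus /cplx_of_real normc_def /= expr0n addr0 sqrtr_sqr.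
  by rewrite gtr0_norm // ltxx.
apply: connected_closure; apply: connected_continuous_connected.
  exact: cplx_connected.
apply: continuous_subspaceT; exact: one_point_compactification_some_continuous.
Qed.

Lemma sphere_coord0_dom_open : open sphere_coord0_dom.
Proof.
rewrite openE => -[z|] //= _; apply: sphere_nbhs_finite.
by apply: filterS filterT => w _.
Qed.

Lemma sphere_coord1_dom_open : open sphere_coord1_dom.
Proof.
rewrite openE => -[z|] /= z0.
  apply: sphere_nbhs_finite.
  have /eqP nz : z != 0 by apply/eqP => zE; apply: z0; rewrite zE.
  have /open_nbhs_nbhs : open_nbhs z (~` [set 0 : C]).
    split=> //; apply: closed_openC; apply: accessible_closed_set1.
    exact: hausdorff_accessible.
  by apply: filterS => w /= w0 [].
apply: filterS (sphere_nbhs_infty 0) => -[w|] //= w0 [wE]; move: w0.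
by rewrite wE /cplx_modulus normr0 ltxx.
Qed.

Lemma sphere_coord0_img : sphere_coord0 @` sphere_coord0_dom = [set: C].
Proof. by apply/seteqP; split=> // z _; exists (Some z). Qed.

Lemma sphere_coord1_img : sphere_coord1 @` sphere_coord1_dom = [set: C].
Proof.
apply/seteqP; split=> // z _.
have [->|z0] := eqVneq z 0; first by exists None.
exists (Some z^-1); rewrite /= ?invrK //.
by move=> [/eqP]; rewrite invr_eq0 (negbTE z0).
Qed.

Lemma sphere_coord0_img_open : open (sphere_coord0 @` sphere_coord0_dom).
Proof. by rewrite sphere_coord0_img; exact: openT. Qed.

Lemma sphere_coord1_img_open : open (sphere_coord1 @` sphere_coord1_dom).
Proof. by rewrite sphere_coord1_img; exact: openT. Qed.

Lemma sphere_coord0K : {in sphere_coord0_dom, cancel sphere_coord0 sphere_inv0}.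
Proof. by move=> [z|]; rewrite inE. Qed.

Lemma sphere_coord1K : {in sphere_coord1_dom, cancel sphere_coord1 sphere_inv1}.
Proof.
move=> [z|]; rewrite inE /sphere_inv1 /= => z0; last by rewrite eqxx.
rewrite invr_eq0 invrK; case: eqP => // zE; by case: z0; rewrite zE.
Qed.

Lemma sphere_coord0_continuous :
  {in sphere_coord0_dom, continuous sphere_coord0}.
Proof. by move=> [z|]; rewrite inE // => _ A Az; exact: sphere_nbhs_finite. Qed.

Lemma sphere_inv0_continuous :
  {in sphere_coord0 @` sphere_coord0_dom, continuous sphere_inv0}.
Proof. by move=> z _; exact: one_point_compactification_some_continuous. Qed.

Lemma sphere_coord1_continuous :
  {in sphere_coord1_dom, continuous sphere_coord1}.
Proof.
move=> [z|]; rewrite inE => z0 A /= Az.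
  apply: sphere_nbhs_finite.
  have nz : z != 0 by apply/eqP => zE; apply: z0; rewrite zE.
  exact: (@inv_continuous C z nz A Az).
have /(@nbhs_ballP _ C) [e e0 eA] := Az.
have eE : e = cplx_of_real (complex.Re e).
  by move: e0; rewrite /= ltcE; case: (e) => a b /= /andP[/eqP->].
have e0' : 0 < complex.Re e by rewrite -ltcR -[X in _ < X]/(cplx_of_real _) -eE.
apply: filterS (sphere_nbhs_infty (complex.Re e)^-1) => -[w|] /= we; last first.
  by apply: eA; exact: ballxx.
apply: eA; rewrite /ball /= sub0r normrN normfV cplx_modulusE.
rewrite eE -fmorphV /= ltcR.
by rewrite invf_plt // posrE // (lt_trans _ we) // invr_gt0.
Qed.

Lemma sphere_inv1_continuous :
  {in sphere_coord1 @` sphere_coord1_dom, continuous sphere_inv1}.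
Proof.
move=> w _ A; rewrite /sphere_inv1; have [->|w0] := eqVneq w 0; last first.
  move=> Aw; have wN0 : nbhs w [set v : C | v != 0].
    exact: (@cvgr_neq0 _ C _ _ (nbhs_filter w) id w _ w0).
  have wA : nbhs w [set v : C | A (Some v^-1)].
    exact: (@inv_continuous C w w0 _ Aw).
  apply: (filterS2 _ _ wN0 wA) => v /= v0.
  by rewrite (negbTE v0).
move=> [K [cK _]] KA; have [e e0 Ke] := cplx_compact_in_disk cK.
apply/(@nbhs_ballP _ C); exists (cplx_of_real e^-1).
  by rewrite /= ltcR invr_gt0.
move=> v; rewrite /ball /= sub0r normrN cplx_modulusE ltcR => ve.
apply: KA; have [v0|v0] := eqVneq v 0; [by right|left; exists v^-1 => // /Ke].
have nv0 : 0 < cplx_modulus v.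
  by rewrite -ltcR -[X in _ < X]/(cplx_of_real _) -cplx_modulusE normr_gt0.
rewrite -ltcR -[X in X < _]/(cplx_of_real _) -cplx_modulusE normfV.
rewrite cplx_modulusE -fmorphV ltcR.
by rewrite ltNge ltW // -[e]invrK ltf_pV2 // posrE invr_gt0.
Qed.

Definition sphere_chart0 : chart sphere :=
  Chart sphere_coord0_dom_open sphere_coord0_img_open sphere_coord0K
    sphere_coord0_continuous sphere_inv0_continuous.

Definition sphere_chart1 : chart sphere :=
  Chart sphere_coord1_dom_open sphere_coord1_img_open sphere_coord1K
    sphere_coord1_continuous sphere_inv1_continuous.

Definition sphere_atlas : set (chart sphere) :=
  [set sphere_chart0; sphere_chart1].

Lemma sphere_covered (p : sphere) : exists2 c, sphere_atlas c & chart_dom c p.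
Proof.
case: p => [z|]; first by exists sphere_chart0; [left|].
by exists sphere_chart1; [right|].
Qed.

Lemma holomorphic_at_inv (g : C -> C) (a : C) :
  a != 0 -> (forall z, z != 0 -> g z = z^-1) -> holomorphic_at g a.
Proof.
move=> a0 gE.
have nz (b : C) : b != 0 -> \forall z \near b, z != 0.
  by move=> b0; exact: (@cvgr_neq0 _ C _ _ (nbhs_filter b) id b _ b0).
apply: filterS (nz a a0) => z z0.
apply: (@near_eq_derivable _ C C (fun w : C => w^-1)).
  by apply: filterS (nz z z0) => w w0; rewrite gE.
exact: (@derivableV _ C id).
Qed.

Lemma holomorphic_at_id (g : C -> C) (a : C) :
  g =1 id -> holomorphic_at g a.
Proof.
move=> /funext ->; apply: filterS filterT => z _; exact: derivable_id.
Qed.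

Lemma sphere_compatible c d : sphere_atlas c -> sphere_atlas d ->
  forall p, chart_dom c p -> chart_dom d p ->
    holomorphic_at (chart_fun d \o chart_inv c) (chart_fun c p).
Proof.
move=> [] -> [] -> p /= pc pd.
- exact: holomorphic_at_id.
- by case: p pc pd => //= z _ z0; apply: holomorphic_at_inv => //;
    apply/eqP => zE; apply: z0; rewrite zE.
- case: p pc pd => //= z z0 _; apply: holomorphic_at_inv.
    by rewrite invr_eq0; apply/eqP => zE; apply: z0; rewrite zE.
  by move=> w w0; rewrite /= /sphere_inv1 (negbTE w0).
- apply: holomorphic_at_id => w; rewrite /= /sphere_inv1.
  by case: eqP => [->|_] //=; rewrite invrK.
Qed.

Definition riemann_sphere : riemann_surface :=
  RiemannSurface sphere_hausdorff sphere_connected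
    sphere_covered sphere_compatible.

Definition sphere_conj (p : riemann_sphere) : riemann_sphere :=
  if p is Some z then Some z^* else None.

(** [z |-> (a z + b) / (c z + d)], with the usual conventions at infinity. *)
Definition moebius (a b c d : C) (p : riemann_sphere) : riemann_sphere :=
  match p with
  | Some z => if c * z + d == 0 then None else Some ((a * z + b) / (c * z + d))
  | None => if c == 0 then None else Some (a / c)
  end.

Definition moebius_transformation
    (phi : riemann_sphere -> riemann_sphere) : Prop :=
  exists a b c d : C, a * d - b * c != 0 /\ phi = moebius a b c d.

Definition can_be_made_real (E : real_elliptic_curve)
    (f : E -> riemann_sphere) : Prop :=
  exists2 phi, moebius_transformation phi &
    sphere_conj \o (phi \o f) \o @curve_conj E = phi \o f.

End RiemannSurfaces.

Arguments real_part {R} E.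

(* Main.v *)
From HB Require Import structures.
Require Import Defs.
From mathcomp Require Import all_boot all_order all_algebra.
From mathcomp Require Import all_classical all_reals all_analysis.
From mathcomp Require Import complex ring lra.

(** On the plane cubic y^2 = 12 m^3 + m^2 - 60 m + 36 take f = 6 m + (6 + y) / m
    and the antiholomorphic involution (m, y) |-> (conj m, - conj y). The fibre of f over
    q is given by a cubic equation in m, so f has degree 3. Its critical points are
    the point A at infinity, the two points (1, +- i sqrt 11), the point (2, -4),
    and the point (-2, 8) counted twice; exactly the first three are fixed by the
    involution. The poles of f are A (double) and B = (0, 6), and the involution
    fixes A but sends B to (0, -6), where f = 5. If phi \o f were real, f would
    take equal values at the images of A and B, which it does not.

    The cubic is birational to the quartic y^2 = x^4 - 2 kap x^2 + 1, whose
    uniformisation by Jacobi elliptic functions becomes algebraic after replacing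
    the real and imaginary arguments by points of two circles. This bijection from
    the torus circle * circle provides the topology, and the complex structure
    is read off from x, 1/x and y + x^2 by means of complex square roots. *)

Set Implicit Arguments.
Unset Strict Implicit.
Unset Printing Implicit Defensive.

Import Order.TTheory GRing.Theory Num.Theory.
Import numFieldNormedType.Exports.

Local Open Scope classical_set_scope.
Local Open Scope ring_scope.

(** * Square roots and complex derivatives *)

(** The function f has real coefficients, so it is real for the other involution (m, y) |-> (conj m,
    conj y). That involution exchanges the two critical points (1, +- i sqrt 11), whereas the chosen
    one fixes each of them: this is how three critical points can be real without f being so. The
    quartic comes from the pencil of lines through the 2-torsion point (2/3, 0): with y = z (3 m -
    2) the cubic becomes 4 m^2 + (3 - 3 z^2) m + 2 z^2 - 18 = 0, whose discriminant is 9 z^4 - 50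
    z^2 + 297, and z is rescaled so that x |-> 1/x becomes a symmetry. Genus one means a
    homeomorphism with a product of circles; with the torus as carrier this is the identity, and the
    difficulty moves to the continuity of the inverse charts into the torus, which is obtained by
    compactness. Multiplicities are limits in charts while the degree is a global count. They meet
    in the fibre polynomial in m: its root multiplicities are shown to be the multiplicities of f
    wherever f is finite, including the points with y = 0, where m is not a local coordinate. *)

Lemma cvg_dnbhs (X Y : topologicalType) (f : X -> Y) (x : X) :
  {for x, continuous f} -> f w @[w --> x^'] --> f x.
Proof. by move=> cf; apply: cvg_trans cf; apply: cvg_app; exact: nbhs_dnbhs. Qed.

Section ComplexAnalysis.
Variable R : realType.
Local Notation C := (cplx R).
Local Notation Re := (@complex.Re R).
Local Notation Im := (@complex.Im R).

Section CvgC.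
Variables (T : Type) (F : set_system T) (FF : Filter F) (f g : T -> C).

Lemma cvgC_cst (a : C) : (fun=> a) @ F --> a.
Proof. exact: (@cvg_cst C). Qed.

Lemma cvgCD (a b : C) :
  f @ F --> a -> g @ F --> b -> f w + g w @[w --> F] --> a + b.
Proof. exact: (@cvgD C C). Qed.

Lemma cvgCN (a : C) : f @ F --> a -> - f w @[w --> F] --> - a.
Proof. exact: (@cvgN C C). Qed.

Lemma cvgCB (a b : C) :
  f @ F --> a -> g @ F --> b -> f w - g w @[w --> F] --> a - b.
Proof. exact: (@cvgB C C). Qed.

Lemma cvgCM (a b : C) :
  f @ F --> a -> g @ F --> b -> f w * g w @[w --> F] --> a * b.
Proof. exact: (@cvgM C). Qed.

Lemma cvgCV (a : C) :
  a != 0 -> f @ F --> a -> (f w)^-1 @[w --> F] --> a^-1.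
Proof. by move=> a0; apply: (@cvgV C). Qed.

End CvgC.

Lemma cvgCX (T : Type) (F : set_system T) (FF : Filter F) (f : T -> C) (a : C)
    n : f @ F --> a -> f w ^+ n @[w --> F] --> a ^+ n.
Proof.
move=> fa; elim: n => [|n IH]; first exact: cvgC_cst.
rewrite exprS; under eq_fun do rewrite exprS.
exact: cvgCM fa IH.
Qed.

Section ContinuousC.
Variables (X : topologicalType) (x : X) (f g : X -> C).
Hypotheses (cf : {for x, continuous f}) (cg : {for x, continuous g}).

Lemma contC_cst (a : C) : {for x, continuous (fun=> a)}.
Proof. exact: (@cvg_cst C). Qed.

Lemma contCD : {for x, continuous (fun w => f w + g w)}.
Proof. exact: (cvgCD (nbhs_filter x) cf cg). Qed.

Lemma contCN : {for x, continuous (fun w => - f w)}.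
Proof. exact: (cvgCN (nbhs_filter x) cf). Qed.

Lemma contCB : {for x, continuous (fun w => f w - g w)}.
Proof. exact: (cvgCB (nbhs_filter x) cf cg). Qed.

Lemma contCM : {for x, continuous (fun w => f w * g w)}.
Proof. exact: (cvgCM (nbhs_filter x) cf cg). Qed.

Lemma contCV : f x != 0 -> {for x, continuous (fun w => (f w)^-1)}.
Proof. by move=> fx; exact: (cvgCV (nbhs_filter x) fx cf). Qed.

Lemma contCX n : {for x, continuous (fun w => f w ^+ n)}.
Proof. exact: (@cvgCX X (nbhs x) (nbhs_filter x) f (f x) n cf). Qed.
End ContinuousC.

Lemma contC_id (z : C) : {for z, continuous id}.
Proof. exact: cvg_id. Qed.

(** The principal branch, with nonnegative real part. The real part of the root is 0 exactly on the
    cut, the negative real axis and 0, so [0 < Re (csqrt z)] is the domain of holomorphy. *)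
Definition csqrt (z : C) : C := sqrtc (z : R[i]).

Lemma csqrtK (z : C) : csqrt z ^+ 2 = z.
Proof. exact: sqr_sqrtc. Qed.

Lemma Re_csqrt_ge0 (z : C) : 0 <= Re (csqrt z).
Proof. by case: z => a b /=; exact: sqrtr_ge0. Qed.

Lemma csqrt_sqr (w : C) : 0 < Re w -> csqrt (w ^+ 2) = w.
Proof.
move=> w0; have /eqP := csqrtK (w ^+ 2).
rewrite eqf_sqr => /orP[/eqP //|/eqP sE].
have := Re_csqrt_ge0 (w ^+ 2); rewrite sE raddfN /= oppr_ge0 => w1.
by have := lt_le_trans w0 w1; rewrite ltxx.
Qed.

Lemma csqrt0 : csqrt 0 = 0.
Proof. exact: sqrtc0. Qed.

Lemma Re_ge_norm (z : C) : cplx_of_real (Re z) <= `|z|.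
Proof.
apply: (@le_trans _ C (cplx_of_real `|Re z|)); last exact: normc_ge_Re.
by rewrite lecR ler_norm.
Qed.

(** The roots s(z), s(w) satisfy z - w = (s(z) - s(w)) (s(z) + s(w)), and the last factor has
    modulus at least Re s(z) > 0 because Re s(w) is nonnegative. *)
Lemma csqrt_continuous (z : C) :
  0 < Re (csqrt z) -> {for z, continuous csqrt}.
Proof.
move=> z0; apply/(@cvgrPdist_lt _ C _ _ (nbhs_filter z)) => e e0.
pose r : C := cplx_of_real (Re (csqrt z)).
have r0 : 0 < r by rewrite ltcR.
near=> w.
have nz : r <= `|csqrt z + csqrt w|.
  apply: le_trans (Re_ge_norm _); rewrite lecR raddfD /= lerDl.
  exact: Re_csqrt_ge0.
rewrite -(ltr_pM2r r0); apply: le_lt_trans (_ : _ <= `|z - w|) _.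
  rewrite -[z in leRHS]csqrtK -[w in leRHS]csqrtK subr_sqr normrM.
  by rewrite ler_wpM2l.
near: w; apply: (@cvgr_dist_lt _ C) => //; exact: mulr_gt0.
Unshelve. all: by end_near. Qed.

Lemma dnbhs_shift (z : C) (A : set C) :
  z^' A <-> (0 : C)^' [set h | A (h + z)].
Proof.
split=> /(@nbhs_ballP _ C) [e e0 eA]; apply/(@nbhs_ballP _ C); exists e => //=.
  move=> h /= he h0; apply: eA; last by rewrite /= -subr_eq0 addrK.
  by move: he; rewrite /ball /= sub0r opprD addrCA subrr addr0.
move=> w we wz; rewrite -[w](subrK z); apply: eA; last by rewrite subr_eq0.
by move: we; rewrite /ball /= sub0r opprB.
Qed.

Lemma derivable_quotientP (f : C -> C) (z : C) : derivable f z 1 <->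
  exists l : C, (f w - f z) / (w - z) @[w --> z^'] --> l.
Proof.
have E (l : C) : (f w - f z) / (w - z) @[w --> z^'] --> l <->
    h^-1 *: ((f \o shift z) (h *: (1 : C)) - f z) @[h --> (0 : C)^'] --> l.
  have -> : (fun h : C => h^-1 *: ((f \o shift z) (h *: (1 : C)) - f z)) =
      (fun h : C => (f (h + z) - f z) / (h + z - z)).
    by apply/funext => h; rewrite /GRing.scale /= mulr1 addrK mulrC.
  split=> fl A Al; first by move: (fl A Al) => /dnbhs_shift.
  by apply/dnbhs_shift; exact: (fl A Al).
rewrite /derivable; split=> [/cvg_ex [l lP]|[l lP]].
  by exists l; apply: (E l).2.
by apply/cvg_ex; exists l; apply: (E l).1.
Qed.

Lemma derivable_csqrt (z : C) : 0 < Re (csqrt z) -> derivable csqrt z 1.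
Proof.
move=> z0; apply/derivable_quotientP; exists (csqrt z + csqrt z)^-1.
have s0 : csqrt z != 0.
  by apply/eqP => sE; move: z0; rewrite sE /= ltxx.
have : ((csqrt w + csqrt z)^-1 @[w --> z^'] --> (csqrt z + csqrt z)^-1).
  apply: cvgCV; first by rewrite -mulr2n mulrn_eq0.
  apply: cvgCD; last exact: cvgC_cst.
  exact/cvg_dnbhs/csqrt_continuous.
apply: cvg_trans; apply: near_eq_cvg; near=> w => /=.
have s1 : csqrt w + csqrt z != 0.
  apply/eqP => /(congr1 Re); rewrite raddfD /= => sE.
  by have := ltr_wpDl (Re_csqrt_ge0 w) z0; rewrite sE ltxx.
have wz : csqrt w - csqrt z != 0.
  rewrite subr_eq0; apply: contraTneq (_ : w != z) => [sE|].
    by rewrite negbK -[w]csqrtK sE csqrtK.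
  by near: w; exact: nbhs_dnbhs_neq.
have -> : w - z = (csqrt w - csqrt z) * (csqrt w + csqrt z).
  by rewrite -subr_sqr !csqrtK.
by rewrite invfM mulrA mulfV // mul1r.
Unshelve. all: by end_near. Qed.

(* Caratheodory's form of differentiability, stable under composition. *)
Lemma derivable_caratheodory (f : C -> C) (z : C) : derivable f z 1 <->
  exists2 phi : C -> C, {for z, continuous phi} &
    forall w, f w - f z = phi w * (w - z).
Proof.
split=> [/derivable_quotientP [l fl]|[phi cphi fE]].
  exists (fun w => if w == z then l else (f w - f z) / (w - z)).
    apply/continuous_withinNx; rewrite eqxx; apply: cvg_trans fl.
    apply: near_eq_cvg; near=> w; rewrite ifN //.
    by near: w; exact: nbhs_dnbhs_neq.
  move=> w; have [->|wz] := eqVneq w z; first by rewrite !subrr mulr0.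
  by rewrite divfK // subr_eq0.
apply/derivable_quotientP; exists (phi z).
apply: cvg_trans (cvg_dnbhs cphi); apply: near_eq_cvg; near=> w.
by rewrite fE mulfK // subr_eq0; near: w; exact: nbhs_dnbhs_neq.
Unshelve. all: by end_near. Qed.

Lemma derivable_continuousC (f : C -> C) (z : C) :
  derivable f z 1 -> {for z, continuous f}.
Proof.
move=> /derivable_caratheodory [phi cphi fE].
have : {for z, continuous (fun w => phi w * (w - z) + f z)}.
  apply: contCD; last exact: contC_cst.
  apply: contCM; first exact: cphi.
  apply: contCB.
    exact: contC_id.
  exact: contC_cst.
suff -> : (fun w => phi w * (w - z) + f z) = f by [].
by apply/funext => w; rewrite -fE subrK.
Qed.

Lemma derivable_compC (f g : C -> C) (z : C) :
  derivable f z 1 -> derivable g (f z) 1 -> derivable (g \o f) z 1.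
Proof.
move=> df; have cf := derivable_continuousC df.
move: df => /derivable_caratheodory [phi cphi fE].
move=> /derivable_caratheodory [psi cpsi gE].
apply/derivable_caratheodory; exists (fun w => psi (f w) * phi w).
  apply: contCM; last exact: cphi.
  by apply: (@continuous_comp C C C f psi z); [exact: cf|exact: cpsi].
by move=> w; rewrite /= gE fE mulrA.
Qed.

End ComplexAnalysis.

(** The image of the complement of an open neighbourhood of [p] is compact, hence closed, and misses
    [e p]. Only the fibre through [p] has to be a single point: the map [e] used for the torus
    identifies the two points at infinity. *)
Lemma compact_separated_cvg (T S : topologicalType) (X : Type)
    (F : set_system X) (FF : Filter F) (e : T -> S) (h : X -> T) (p : T) :
  compact [set: T] -> hausdorff_space S -> continuous e ->
  (forall p', e p' = e p -> p' = p) ->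
  e (h x) @[x --> F] --> e p -> h x @[x --> F] --> p.
Proof.
move=> cT hS ce einj ehp N; rewrite nbhsE => -[P [oP Pp] PN].
have cK : closed (e @` (~` P)).
  apply: compact_closed => //; apply: continuous_compact.
    exact: continuous_subspaceT.
  by apply: (@subclosed_compact _ _ setT) => //; exact: open_closedC.
have : nbhs (e p) (~` (e @` (~` P))).
  apply: open_nbhs_nbhs; split; first exact: closed_openC.
  by move=> [p' Pp'] /einj pE; apply: Pp'; rewrite pE.
move=> /ehp; apply: (@filterS _ F) => x /= Kx; apply: PN.
by apply: contrapT => nO; apply: Kx; exists (h x).
Qed.

Section ContinuousR.
Variables (R : realType) (X : topologicalType) (x : X) (f g : X -> R).
Hypotheses (cf : {for x, continuous f}) (cg : {for x, continuous g}).

Lemma contR_cst (a : R) : {for x, continuous (fun=> a)}.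
Proof. exact: (@cvg_cst R). Qed.

Lemma contRD : {for x, continuous (fun w => f w + g w)}.
Proof. exact: (@cvgD R R X (nbhs x) (nbhs_filter x) f g (f x) (g x) cf cg). Qed.

Lemma contRN : {for x, continuous (fun w => - f w)}.
Proof. exact: (@cvgN R R X (nbhs x) (nbhs_filter x) f (f x) cf). Qed.

Lemma contRB : {for x, continuous (fun w => f w - g w)}.
Proof. exact: (@cvgB R R X (nbhs x) (nbhs_filter x) f g (f x) (g x) cf cg). Qed.

Lemma contRM : {for x, continuous (fun w => f w * g w)}.
Proof. exact: (@cvgM R X (nbhs x) (nbhs_filter x) f g (f x) (g x) cf cg). Qed.

Lemma contR_sqrt : {for x, continuous (fun w => Num.sqrt (f w))}.
Proof.
apply: (@continuous_comp X R R f (@Num.sqrt R)); first exact: cf.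
exact: sqrt_continuous.
Qed.
End ContinuousR.

(** * Real and imaginary parts of complex numbers *)

Section RealComplex.
Variable R : realType.
Local Notation C := (cplx R).
Local Notation Re := (@complex.Re R).
Local Notation Im := (@complex.Im R).
Local Notation c := (@cplx_of_real R).

Definition imag_unit : C := 'i%C.
Local Notation ii := imag_unit.

Lemma imag_unitK : ii ^+ 2 = -1.
Proof. exact: sqr_i. Qed.

Lemma cR0 : c 0 = 0. Proof. exact: rmorph0. Qed.
Lemma cR1 : c 1 = 1. Proof. exact: rmorph1. Qed.
Lemma cRD x y : c (x + y) = c x + c y. Proof. exact: rmorphD. Qed.
Lemma cRN x : c (- x) = - c x. Proof. exact: rmorphN. Qed.
Lemma cRB x y : c (x - y) = c x - c y. Proof. exact: rmorphB. Qed.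
Lemma cRM x y : c (x * y) = c x * c y. Proof. exact: rmorphM. Qed.
Lemma cRX x n : c (x ^+ n) = c x ^+ n. Proof. exact: rmorphXn. Qed.
Lemma cRV x : c x^-1 = (c x)^-1. Proof. exact: fmorphV. Qed.
Lemma cRn n : c n%:R = n%:R. Proof. exact: rmorph_nat. Qed.
Definition cRE := (cR0, cR1, cRD, cRN, cRM, cRX, cRV, cRn).

Lemma cR_eq0 x : (c x == 0) = (x == 0). Proof. exact: fmorph_eq0. Qed.
Lemma cRI : injective c. Proof. exact: fmorph_inj. Qed.

Lemma cplxE (z : C) : z = c (Re z) + ii * c (Im z).
Proof. exact: cplx_of_pairE. Qed.

Lemma Re_cplx x y : Re (c x + ii * c y) = x.
Proof. by rewrite /ii /cplx_of_real; simpc. Qed.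
Lemma Im_cplx x y : Im (c x + ii * c y) = y.
Proof. by rewrite /ii /cplx_of_real; simpc. Qed.

Lemma conj_cR x : (c x)^* = c x.
Proof. by rewrite /cplx_of_real /= /Num.conj /= oppr0. Qed.
Lemma conj_ii : ii^* = - ii.
Proof. by rewrite /ii; apply/eqP; rewrite eq_complex /= oppr0 !eqxx. Qed.
Lemma conj_cplx x y : (c x + ii * c y)^* = c x - ii * c y.
Proof. by rewrite rmorphD rmorphM /= !conj_cR conj_ii mulNr. Qed.

Lemma sqr_norm_cplx x y : `|c x + ii * c y| ^+ 2 = c (x ^+ 2 + y ^+ 2).
Proof. by rewrite normCK conj_cplx !cRE; ring: imag_unitK. Qed.

Lemma Im_continuous : continuous (Im : C -> R).
Proof.
move=> z; have -> : (Im : C -> R) = (fun w : C => - Re (ii * w)).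
  apply/funext => w; rewrite [in RHS](cplxE w) mulrDr mulrA -expr2 imag_unitK.
  by rewrite mulN1r addrC -cRN Re_cplx opprK.
apply: (@continuous_comp C C R (fun w : C => ii * w) (fun w : C => - Re w)).
  by apply: contCM; [exact: contC_cst|exact: contC_id].
by apply: contRN; exact: cplx_Re_continuous.
Qed.

End RealComplex.

(** * The Jacobi parametrisation of the quartic curve *)

(* With [z = rho x] and [v = 3 rho^2 y] the quartic [y^2 = x^4 - 2 kap x^2 + 1]
   becomes [v^2 = 9 z^4 - 50 z^2 + 297], whence the values of [rho] and [kap];
   [modA] and [modB] are the squares of the Jacobi moduli k and k'. *)
HB.lock Definition rho2 (R : realType) : R := Num.sqrt 33.
HB.lock Definition rho (R : realType) : R := Num.sqrt (rho2 R).
HB.lock Definition kap (R : realType) : R := 25 / (9 * rho2 R).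
HB.lock Definition modA (R : realType) : R := (1 + kap R) / 2.
HB.lock Definition modB (R : realType) : R := (1 - kap R) / 2.

Section JacobiCoordinates.
Variable R : realType.
Local Notation rho2 := (rho2 R).
Local Notation rho := (rho R).
Local Notation kap := (kap R).
Local Notation modA := (modA R).
Local Notation modB := (modB R).
Local Notation C := (cplx R).
Local Notation Re := (@complex.Re R).
Local Notation Im := (@complex.Im R).
Local Notation c := (@cplx_of_real R).
Local Notation ii := (imag_unit R).

Lemma rho2_gt0 : 0 < rho2. Proof. by rewrite rho2.unlock sqrtr_gt0. Qed.
Lemma rho_gt0 : 0 < rho. Proof. by rewrite rho.unlock sqrtr_gt0 rho2_gt0. Qed.
Lemma rho2K : rho2 ^+ 2 = 33. Proof. by rewrite rho2.unlock sqr_sqrtr. Qed.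
Lemma rhoK : rho ^+ 2 = rho2. Proof. by rewrite rho.unlock sqr_sqrtr ?ltW // rho2_gt0. Qed.
Lemma kapK : 9 * rho2 * kap = 25.
Proof. by rewrite kap.unlock mulrC divfK // mulf_neq0 // gt_eqF ?rho2_gt0. Qed.

Lemma kap_gt0 : 0 < kap.
Proof. by rewrite kap.unlock divr_gt0 // mulr_gt0 // rho2_gt0. Qed.
(** This amounts to 25^2 < 81 * 33. Together with [kap_gt0] it makes both squared moduli positive
    with sum 1, as for genuine Jacobi functions. *)
Lemma kap_lt1 : kap < 1.
Proof.
have := rho2_gt0; have := rho2K; have := kapK; have := kap_gt0.
move: rho2 kap => s k k0 kE sE s0; nra.
Qed.

Lemma modA_gt0 : 0 < modA. Proof. by have := kap_gt0; rewrite modA.unlock; lra. Qed.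
Lemma modB_gt0 : 0 < modB. Proof. by have := kap_lt1; rewrite modB.unlock; lra. Qed.
Lemma modAB : modA + modB = 1. Proof. by rewrite modA.unlock modB.unlock; field. Qed.
Lemma kapE : modA - modB = kap. Proof. by rewrite modA.unlock modB.unlock; field. Qed.

Local Notation A := modA.
Local Notation B := modB.

Lemma modB_sqr_le1 (b be : R) : b ^+ 2 + be ^+ 2 = 1 -> 0 < 1 - B * b ^+ 2.
Proof. by move=> h; have := modA_gt0; have := modB_gt0; have := modAB; nra. Qed.
Lemma modA_sqr_le1 (a al : R) : a ^+ 2 + al ^+ 2 = 1 -> 0 < 1 - A * a ^+ 2.
Proof. by move=> h; have := modA_gt0; have := modB_gt0; have := modAB; nra. Qed.

Lemma sqr_eq_ge0 (x y : R) : 0 <= x -> 0 <= y -> x ^+ 2 = y ^+ 2 -> x = y.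
Proof. by move=> x0 y0 /eqP; rewrite eqrXn2 // => /eqP. Qed.

(* [t], [X] and [Y] determine [k^2 al^2 - k'^2 be^2] and [al^2 be^2], hence
   [al^2] and [be^2]. *)
Lemma jacobi_coords_exist (X Y t : R) : X ^+ 2 + Y ^+ 2 + t ^+ 2 = 1 ->
  exists al a be b : R, [/\ al ^+ 2 + a ^+ 2 = 1, be ^+ 2 + b ^+ 2 = 1,
    al * be = t, a * Num.sqrt (1 - B * b ^+ 2) = X &
    b * Num.sqrt (1 - A * a ^+ 2) = Y].
Proof.
move=> XYt.
have A0 := modA_gt0; have B0 := modB_gt0; have AB := modAB.
(* With U = al^2 and V = be^2 one needs X^2 = (1 - U)(A + B V) and Y^2 = (1 - V)(B + A U), so that
   X^2 - Y^2 = (A - B)(1 + U V) - 2 (A U - B V). Hence S is A U - B V, and D is A U + B V since D^2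
   - S^2 = 4 A B U V. *)
pose S := ((A - B) * (1 + t ^+ 2) - (X ^+ 2 - Y ^+ 2)) / 2.
pose D := Num.sqrt (S ^+ 2 + 4 * (A * B) * t ^+ 2).
have AB0 : 0 <= 4 * (A * B) by rewrite ltW // mulr_gt0 ?ltr0n // mulr_gt0.
have DK : D ^+ 2 = S ^+ 2 + 4 * (A * B) * t ^+ 2.
  by rewrite sqr_sqrtr // addr_ge0 ?sqr_ge0 // mulr_ge0 ?sqr_ge0.
have D0 : 0 <= D := sqrtr_ge0 _.
have SD : `|S| <= D.
  by rewrite -sqrtr_sqr ler_wsqrtr // lerDl mulr_ge0 ?sqr_ge0.
have /andP[S1 S2] : - D <= S <= D by rewrite -ler_norml.
pose U := (S + D) / (2 * A); pose V := (D - S) / (2 * B).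
have UE : 2 * A * U = S + D by rewrite /U mulrC divfK // mulf_neq0 // gt_eqF.
have VE : 2 * B * V = D - S by rewrite /V mulrC divfK // mulf_neq0 // gt_eqF.
have U0 : 0 <= U by nra.
have V0 : 0 <= V by nra.
have UV : U * V = t ^+ 2.
  apply: (@mulfI _ (4 * (A * B))); first by rewrite gt_eqF // mulr_gt0 ?ltr0n // mulr_gt0.
  transitivity ((2 * A * U) * (2 * B * V)); first ring.
  by rewrite UE VE; transitivity (D ^+ 2 - S ^+ 2); [ring|rewrite DK; ring].
have S_E : 2 * S = (A - B) * (1 + t ^+ 2) - (X ^+ 2 - Y ^+ 2).
  by rewrite /S mulrC divfK.
have XE : X ^+ 2 = (1 - U) * (A + B * V).
  have h : A * U - B * V = S by lra.
  have -> : (1 - U) * (A + B * V) = A - (A * U - B * V) - B * (U * V) by ring.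
  rewrite h UV; nra.
have YE : Y ^+ 2 = (1 - V) * (B + A * U).
  have h : A * U - B * V = S by lra.
  have -> : (1 - V) * (B + A * U) = B + (A * U - B * V) - A * (U * V) by ring.
  rewrite h UV; nra.
have P0 : 0 < A + B * V by nra.
have Q0 : 0 < B + A * U by nra.
have U1 : U <= 1.
  by rewrite -subr_ge0 -(pmulr_lge0 _ P0) -XE sqr_ge0.
have V1 : V <= 1.
  by rewrite -subr_ge0 -(pmulr_lge0 _ Q0) -YE sqr_ge0.
(* Only the product [al * be] is prescribed: [al] is taken nonnegative and [be] carries the sign of
   [t]. The opposite signs would serve as well. *)
pose al := Num.sqrt U; pose sg : R := if 0 <= t then 1 else -1.
have sgK : sg ^+ 2 = 1 by rewrite /sg; case: ifP => _; ring.
pose be := sg * Num.sqrt V.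
have alK : al ^+ 2 = U by rewrite sqr_sqrtr.
have beK : be ^+ 2 = V by rewrite exprMn sgK mul1r sqr_sqrtr.
pose p := Num.sqrt (A + B * V); pose q := Num.sqrt (B + A * U).
have p0 : 0 < p by rewrite sqrtr_gt0.
have q0 : 0 < q by rewrite sqrtr_gt0.
have pK : p ^+ 2 = A + B * V by rewrite sqr_sqrtr // ltW.
have qK : q ^+ 2 = B + A * U by rewrite sqr_sqrtr // ltW.
have aK : (X / p) ^+ 2 = 1 - U by rewrite expr_div_n XE pK mulfK // gt_eqF.
have bK : (Y / q) ^+ 2 = 1 - V by rewrite expr_div_n YE qK mulfK // gt_eqF.
exists al, (X / p), be, (Y / q); split.
- by rewrite alK aK; ring.
- by rewrite beK bK; ring.
- rewrite /be mulrCA -sqrtrM // UV sqrtr_sqr /sg.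
  case: (lerP 0 t) => t0; first by rewrite mul1r ger0_norm.
  by rewrite mulN1r ltr0_norm // opprK.
- have -> : 1 - B * (Y / q) ^+ 2 = A + B * V by rewrite bK; lra.
  by rewrite divfK // gt_eqF.
- have -> : 1 - A * (X / p) ^+ 2 = B + A * U by rewrite aK; lra.
  by rewrite divfK // gt_eqF.
Qed.

(** The squares of [al] and [be] are recovered from A al^2 - B be^2 and al^2 be^2; then [a] and [b]
    follow with their signs, because the square roots are positive. The signs of [al] and [be] stay
    open: changing both leaves the three data unchanged. *)
Lemma jacobi_coords_inj (al a be b al' a' be' b' : R) :
  al ^+ 2 + a ^+ 2 = 1 -> be ^+ 2 + b ^+ 2 = 1 ->
  al' ^+ 2 + a' ^+ 2 = 1 -> be' ^+ 2 + b' ^+ 2 = 1 ->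
  al * be = al' * be' ->
  a * Num.sqrt (1 - B * b ^+ 2) = a' * Num.sqrt (1 - B * b' ^+ 2) ->
  b * Num.sqrt (1 - A * a ^+ 2) = b' * Num.sqrt (1 - A * a' ^+ 2) ->
  [/\ al ^+ 2 = al' ^+ 2, be ^+ 2 = be' ^+ 2, a = a' & b = b'].
Proof.
move=> h1 h2 h3 h4 ht hX hY.
have A0 := modA_gt0; have B0 := modB_gt0; have AB := modAB.
have p0 : 0 < 1 - B * b ^+ 2 by apply: (modB_sqr_le1 (be := be)); rewrite addrC.
have p0' : 0 < 1 - B * b' ^+ 2 by apply: (modB_sqr_le1 (be := be')); rewrite addrC.
have q0 : 0 < 1 - A * a ^+ 2 by apply: (modA_sqr_le1 (al := al)); rewrite addrC.
have q0' : 0 < 1 - A * a' ^+ 2 by apply: (modA_sqr_le1 (al := al')); rewrite addrC.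
have XE : a ^+ 2 * (1 - B * b ^+ 2) = a' ^+ 2 * (1 - B * b' ^+ 2).
  rewrite -[X in _ * X]sqr_sqrtr ?ltW // -[X in _ = _ * X]sqr_sqrtr ?ltW //.
  by rewrite -!exprMn hX.
have YE : b ^+ 2 * (1 - A * a ^+ 2) = b' ^+ 2 * (1 - A * a' ^+ 2).
  rewrite -[X in _ * X]sqr_sqrtr ?ltW // -[X in _ = _ * X]sqr_sqrtr ?ltW //.
  by rewrite -!exprMn hY.
have tE : al ^+ 2 * be ^+ 2 = al' ^+ 2 * be' ^+ 2 by rewrite -!exprMn ht.
have SE : A * al ^+ 2 - B * be ^+ 2 = A * al' ^+ 2 - B * be' ^+ 2 by nra.
have DE : A * al ^+ 2 + B * be ^+ 2 = A * al' ^+ 2 + B * be' ^+ 2.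
  apply: sqr_eq_ge0.
  - by rewrite addr_ge0 // mulr_ge0 ?sqr_ge0 // ltW.
  - by rewrite addr_ge0 // mulr_ge0 ?sqr_ge0 // ltW.
  have F (u v : R) : (A * u + B * v) ^+ 2 = (A * u - B * v) ^+ 2 + 4 * A * B * (u * v).
    by ring.
  by rewrite !F SE tE.
have alE : al ^+ 2 = al' ^+ 2 by apply: (@mulfI _ A); [rewrite gt_eqF|lra].
have beE : be ^+ 2 = be' ^+ 2.
  by apply: (@mulfI _ B); [rewrite gt_eqF|lra].
have a2 : a ^+ 2 = a' ^+ 2 by lra.
have b2 : b ^+ 2 = b' ^+ 2 by lra.
split=> //.
- apply: (@mulIf _ (Num.sqrt (1 - B * b ^+ 2))); first by rewrite gt_eqF // sqrtr_gt0.
  by rewrite hX b2.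
- apply: (@mulIf _ (Num.sqrt (1 - A * a ^+ 2))); first by rewrite gt_eqF // sqrtr_gt0.
  by rewrite hY a2.
Qed.

End JacobiCoordinates.

(** * The product of two circles *)

Section TorusTopology.
Variable R : realType.
Local Notation C := (cplx R).
Local Notation Re := (@complex.Re R).
Local Notation Im := (@complex.Im R).
Local Notation c := (@cplx_of_real R).
Local Notation ii := (imag_unit R).
Local Notation A := (modA R).
Local Notation B := (modB R).
Local Notation S1 := (circle R).

Definition circ_re (z : S1) : R := Re (val z).
Definition circ_im (z : S1) : R := Im (val z).

Lemma circ_unit (z : S1) : circ_re z ^+ 2 + circ_im z ^+ 2 = 1.
Proof.
case: z => z /= zP; apply: cRI; rewrite /circ_re /circ_im /=.
move: (zP); rewrite inE /= => z1.
by rewrite -sqr_norm_cplx -cplxE z1 expr1n cR1.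
Qed.

Lemma circ_mem (x y : R) : x ^+ 2 + y ^+ 2 = 1 ->
  c x + ii * c y \in [set z : C | `|z| = 1].
Proof.
move=> xy; rewrite inE /=; apply/eqP.
by rewrite -(@eqrXn2 _ 2) // ?normr_ge0 // expr1n sqr_norm_cplx xy cR1.
Qed.

Definition circ_pt (x y : R) (xy : x ^+ 2 + y ^+ 2 = 1) : S1 :=
  exist _ (c x + ii * c y) (circ_mem xy).

Lemma circ_pt_re x y (xy : x ^+ 2 + y ^+ 2 = 1) : circ_re (circ_pt xy) = x.
Proof. exact: Re_cplx. Qed.
Lemma circ_pt_im x y (xy : x ^+ 2 + y ^+ 2 = 1) : circ_im (circ_pt xy) = y.
Proof. exact: Im_cplx. Qed.

Lemma circ_eq (z w : S1) :
  circ_re z = circ_re w -> circ_im z = circ_im w -> z = w.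
Proof.
move=> h1 h2; apply: val_inj; rewrite [val z]cplxE [val w]cplxE.
by move: h1 h2; rewrite /circ_re /circ_im => -> ->.
Qed.

Lemma circ_re_continuous : continuous circ_re.
Proof.
move=> z; apply: (@continuous_comp S1 C R val Re).
  exact: initial_continuous.
exact: cplx_Re_continuous.
Qed.

Lemma circ_im_continuous : continuous circ_im.
Proof.
move=> z; apply: (@continuous_comp S1 C R val Im).
  exact: initial_continuous.
exact: Im_continuous.
Qed.

Lemma circ_continuous (X : topologicalType) (f : X -> S1) :
  continuous (circ_re \o f) -> continuous (circ_im \o f) -> continuous f.
Proof.
move=> h1 h2; apply: (@continuous_comp_initial S1 X C val f) => x.
have -> : val \o f = (fun w => cplx_of_pair (circ_re (f w), circ_im (f w))).
  by apply/funext => w /=; rewrite [LHS]cplx_of_pairE.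
apply: (@continuous_comp X (R * R)%type C
  (fun w => (circ_re (f w), circ_im (f w))) (@cplx_of_pair R)).
  exact: cvg_pair (h1 x) (h2 x).
exact: cplx_of_pair_continuous.
Qed.

Lemma circ_flip_subproof (z : S1) : circ_re z ^+ 2 + (- circ_im z) ^+ 2 = 1.
Proof. by rewrite sqrrN circ_unit. Qed.
Definition circ_flip (z : S1) : S1 := circ_pt (circ_flip_subproof z).

Lemma circ_neg_subproof (z : S1) : (- circ_re z) ^+ 2 + circ_im z ^+ 2 = 1.
Proof. by rewrite sqrrN circ_unit. Qed.
Definition circ_neg (z : S1) : S1 := circ_pt (circ_neg_subproof z).

Lemma circ_flip_re z : circ_re (circ_flip z) = circ_re z.
Proof. exact: circ_pt_re. Qed.
Lemma circ_flip_im z : circ_im (circ_flip z) = - circ_im z.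
Proof. exact: circ_pt_im. Qed.
Lemma circ_neg_re z : circ_re (circ_neg z) = - circ_re z.
Proof. exact: circ_pt_re. Qed.
Lemma circ_neg_im z : circ_im (circ_neg z) = circ_im z.
Proof. exact: circ_pt_im. Qed.

Lemma circ_flipK : involutive circ_flip.
Proof. by move=> z; apply: circ_eq; rewrite ?circ_flip_re // !circ_flip_im opprK. Qed.
Lemma circ_negK : involutive circ_neg.
Proof. by move=> z; apply: circ_eq; rewrite ?circ_neg_im // !circ_neg_re opprK. Qed.

Lemma circ_flip_continuous : continuous circ_flip.
Proof.
apply: circ_continuous => z.
  have -> : circ_re \o circ_flip = circ_re by apply/funext => w; exact: circ_flip_re.
  exact: circ_re_continuous.
have -> : circ_im \o circ_flip = (fun w => - circ_im w).
  by apply/funext => w; exact: circ_flip_im.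
by apply: contRN; exact: circ_im_continuous.
Qed.

Lemma circ_neg_continuous : continuous circ_neg.
Proof.
apply: circ_continuous => z.
  have -> : circ_re \o circ_neg = (fun w => - circ_re w).
    by apply/funext => w; exact: circ_neg_re.
  by apply: contRN; exact: circ_re_continuous.
have -> : circ_im \o circ_neg = circ_im by apply/funext => w; exact: circ_neg_im.
exact: circ_im_continuous.
Qed.

Definition circ_exp (t : R) : S1 := circ_pt (cos2Dsin2 t).

Lemma circ_exp_continuous : continuous circ_exp.
Proof.
apply: circ_continuous => t.
  have -> : circ_re \o circ_exp = cos by apply/funext => w; exact: circ_pt_re.
  exact: continuous_cos.
have -> : circ_im \o circ_exp = sin by apply/funext => w; exact: circ_pt_im.
exact: continuous_sin.
Qed.

Lemma circ_exp_surj (z : S1) : exists2 t : R, - pi <= t <= pi & circ_exp t = z.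
Proof.
have zu := circ_unit z.
have re1 : -1 <= circ_re z <= 1 by apply/andP; nra.
have cE : cos (acos (circ_re z)) = circ_re z by rewrite acosK // in_itv.
have a0 := acos_ge0 re1; have api := acos_lepi re1.
have : sin (acos (circ_re z)) ^+ 2 = circ_im z ^+ 2.
  by have := cos2Dsin2 (acos (circ_re z)); rewrite cE -zu => /addrI.
move=> /eqP; rewrite eqf_sqr => /orP[] /eqP sE.
  exists (acos (circ_re z)); first by apply/andP; split=> //; lra.
  by apply: circ_eq; rewrite ?circ_pt_re ?circ_pt_im.
exists (- acos (circ_re z)).
  by apply/andP; split; lra.
by apply: circ_eq; rewrite ?circ_pt_re ?circ_pt_im ?cosN ?sinN ?sE ?opprK.
Qed.

Lemma circ_compact : compact [set: S1].
Proof.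
have -> : [set: S1] = circ_exp @` `[- pi, pi].
  apply/seteqP; split=> // z _; have [t tpi <-] := circ_exp_surj z.
  by exists t => //=; rewrite in_itv.
apply: continuous_compact; last exact: segment_compact.
by apply: continuous_subspaceT; exact: circ_exp_continuous.
Qed.

Definition torus : topologicalType := (S1 * S1)%type.

Lemma torus_compact : compact [set: torus].
Proof. by rewrite -setXTT; apply: compact_setX; exact: circ_compact. Qed.

Lemma torus_connected : connected [set: torus].
Proof.
have -> : [set: torus] =
    (fun z : C => (circ_exp (Re z), circ_exp (Im z))) @` [set: C].
  apply/seteqP; split=> // -[z w] _.
  have [t _ <-] := circ_exp_surj z; have [u _ <-] := circ_exp_surj w.
  by exists (c t + ii * c u) => //; rewrite Re_cplx Im_cplx.
apply: connected_continuous_connected; first exact: cplx_connected.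
have h1 : continuous (circ_exp \o Re : C -> S1).
  move=> z; apply: (@continuous_comp C R S1 Re circ_exp).
    exact: cplx_Re_continuous.
  exact: circ_exp_continuous.
have h2 : continuous (circ_exp \o Im : C -> S1).
  move=> z; apply: (@continuous_comp C R S1 Im circ_exp).
    exact: Im_continuous.
  exact: circ_exp_continuous.
by apply: continuous_subspaceT => z; exact: cvg_pair (h1 z) (h2 z).
Qed.

Lemma circ_hausdorff : hausdorff_space S1.
Proof.
move=> z w zw; apply: val_inj; apply: (@cplx_hausdorff R).
move=> U V Uz Vw.
have Uz' : nbhs z (val @^-1` U) by exact: (@initial_continuous _ _ val z U Uz).
have Vw' : nbhs w (val @^-1` V) by exact: (@initial_continuous _ _ val w V Vw).
by have [u [uU uV]] := zw _ _ Uz' Vw'; exists (val u).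
Qed.

Lemma torus_hausdorff : hausdorff_space torus.
Proof.
move=> [z1 z2] [w1 w2] zw; congr (_, _).
  apply: circ_hausdorff => U V Uz Vw.
  have Uz' : nbhs ((z1, z2) : torus) (fst @^-1` U) by exact: cvg_fst.
  have Vw' : nbhs ((w1, w2) : torus) (fst @^-1` V) by exact: cvg_fst.
  by have [u [uU uV]] := zw _ _ Uz' Vw'; exists u.1.
apply: circ_hausdorff => U V Uz Vw.
have Uz' : nbhs ((z1, z2) : torus) (snd @^-1` U) by exact: cvg_snd.
have Vw' : nbhs ((w1, w2) : torus) (snd @^-1` V) by exact: cvg_snd.
by have [u [uU uV]] := zw _ _ Uz' Vw'; exists u.2.
Qed.

End TorusTopology.

(** * The bijection between the affine part of the torus and the quartic *)

Section Curve.
Variable R : realType.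
Local Notation C := (cplx R).
Local Notation Re := (@complex.Re R).
Local Notation Im := (@complex.Im R).
Local Notation c := (@cplx_of_real R).
Local Notation ii := (imag_unit R).
Local Notation A := (modA R).
Local Notation B := (modB R).
Local Notation T := (torus R).

Definition quartic (x : C) : C := x ^+ 4 - 2 * c (kap R) * x ^+ 2 + 1.

(* The point [(al + i a, be + i b)] of the torus stands for the argument [s + i t]
   with [(al, a, q) = (cn, sn, dn) s] for the modulus k, and [(be, b, p)] similarly
   for [t] and k'; by the addition theorem [x] is an elliptic function of [s + i t],
   and [y] is proportional to its derivative. *)
Definition jal (P : T) : R := circ_re P.1.
Definition ja (P : T) : R := circ_im P.1.
Definition jbe (P : T) : R := circ_re P.2.
Definition jb (P : T) : R := circ_im P.2.
Definition jp (P : T) : R := Num.sqrt (1 - B * jb P ^+ 2).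
Definition jq (P : T) : R := Num.sqrt (1 - A * ja P ^+ 2).
Definition jt (P : T) : R := jal P * jbe P.
Definition jze (P : T) : C := c (ja P * jp P) + ii * c (jb P * jq P).
Definition jet (P : T) : C := c (jp P * jq P * (jal P + jbe P)) +
  ii * c (- (ja P * jb P * (A * jal P - B * jbe P))).

(* [jt] takes the value [-1] at the two points where [x] is infinite; there
   [xT] and [yT] are junk. *)
Definition affine (P : T) : bool := 1 + jt P != 0.
Definition xT (P : T) : C := jze P / c (1 + jt P).
Definition yT (P : T) : C := 2 * jet P / c (1 + jt P) ^+ 2.

Lemma jal_ja P : jal P ^+ 2 + ja P ^+ 2 = 1. Proof. exact: circ_unit. Qed.
Lemma jbe_jb P : jbe P ^+ 2 + jb P ^+ 2 = 1. Proof. exact: circ_unit. Qed.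

Lemma jp_arg P : 0 < 1 - B * jb P ^+ 2.
Proof. by apply: (@modB_sqr_le1 _ _ (jbe P)); rewrite addrC jbe_jb. Qed.
Lemma jq_arg P : 0 < 1 - A * ja P ^+ 2.
Proof. by apply: (@modA_sqr_le1 _ _ (jal P)); rewrite addrC jal_ja. Qed.

Lemma jp_gt0 P : 0 < jp P. Proof. by rewrite sqrtr_gt0 jp_arg. Qed.
Lemma jq_gt0 P : 0 < jq P. Proof. by rewrite sqrtr_gt0 jq_arg. Qed.
Lemma jpK P : jp P ^+ 2 = 1 - B * jb P ^+ 2.
Proof. by rewrite sqr_sqrtr // ltW // jp_arg. Qed.
Lemma jqK P : jq P ^+ 2 = 1 - A * ja P ^+ 2.
Proof. by rewrite sqr_sqrtr // ltW // jq_arg. Qed.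

(** The real and imaginary parts of [jze P] together with [jt P] form a point of the unit sphere,
    written in sphero-conal coordinates; [xT P] is its stereographic projection from the pole where
    [jt] is -1. *)
Lemma jze_sqr P : (ja P * jp P) ^+ 2 + (jb P * jq P) ^+ 2 = 1 - jt P ^+ 2.
Proof.
rewrite /jt !exprMn jpK jqK.
have -> : jal P ^+ 2 = 1 - ja P ^+ 2 by rewrite -(jal_ja P) addrK.
have -> : jbe P ^+ 2 = 1 - jb P ^+ 2 by rewrite -(jbe_jb P) addrK.
have -> : A = 1 - B by rewrite -(modAB R) addrK.
by ring.
Qed.

Lemma norm_jze P : `|jze P| ^+ 2 = c (1 - jt P ^+ 2).
Proof. by rewrite sqr_norm_cplx jze_sqr. Qed.

(** The equation of the quartic cleared of denominators, hence meaningful at the infinite points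
    too. It is a polynomial identity modulo the relations between cn, sn and dn, A + B = 1 and the
    square of the imaginary unit. *)
Lemma quartic_hom P :
  4 * jet P ^+ 2 = jze P ^+ 4 - 2 * c (kap R) * jze P ^+ 2 * c (1 + jt P) ^+ 2 +
    c (1 + jt P) ^+ 4.
Proof.
have h1 : c (jal P) ^+ 2 = 1 - c (ja P) ^+ 2.
  by rewrite -!cRX -cR1 -(jal_ja P) cRD addrK.
have h2 : c (jbe P) ^+ 2 = 1 - c (jb P) ^+ 2.
  by rewrite -!cRX -cR1 -(jbe_jb P) cRD addrK.
have h3 : c (jp P) ^+ 2 = 1 - c B * c (jb P) ^+ 2.
  by rewrite -!cRX jpK !cRE.
have h4 : c (jq P) ^+ 2 = 1 - c A * c (ja P) ^+ 2.
  by rewrite -!cRX jqK !cRE.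
have h5 : c A = 1 - c B by rewrite -cR1 -(modAB R) cRD addrK.
have h6 := imag_unitK R.
rewrite -(kapE R) /jet /jze /jt !cRE.
move: h1 h2 h3 h4 h5 h6.
move: (c (jal P)) (c (ja P)) (c (jbe P)) (c (jb P)) (c (jp P)) (c (jq P)) (c A) (c B) ii.
move=> al a be b p q kA kB i h1 h2 h3 h4 h5 h6.
rewrite {}h5 in h4 *.
ring: h1 h2 h3 h4 h6.
Qed.

Lemma cplx_pair_inj x y x' y' :
  c x + ii * c y = c x' + ii * c y' -> x = x' /\ y = y'.
Proof.
by move=> h; split; [rewrite -(Re_cplx x y) h Re_cplx|rewrite -(Im_cplx x y) h Im_cplx].
Qed.

Lemma affine_neq0 P : affine P -> c (1 + jt P) != 0.
Proof. by rewrite cR_eq0. Qed.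

Lemma curve_eq P : affine P -> yT P ^+ 2 = quartic (xT P).
Proof.
move=> /affine_neq0; have := quartic_hom P; rewrite /yT /xT /quartic.
move: (jet P) (jze P) (c (1 + jt P)) (c (kap R)) => e z u k h u0.
have -> : (2 * e / u ^+ 2) ^+ 2 = (4 * e ^+ 2) / u ^+ 4 by field.
by rewrite h; field.
Qed.

Lemma torus_eq P P' : jal P = jal P' -> ja P = ja P' -> jbe P = jbe P' ->
  jb P = jb P' -> P = P'.
Proof.
by case: P P' => [z w] [z' w'] h1 h2 h3 h4; congr (_, _); exact: circ_eq.
Qed.

(** [jze] and [jt] leave only the signs of [jal] and [jbe] open, and [jet] is odd under their common
    change. At the two infinite points [jze], [jt] and [jet] take the same values 0, -1 and 0,
    whence the hypothesis [affine P]. *)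
Lemma embed_inj P P' : affine P ->
  jze P' = jze P -> jt P' = jt P -> jet P' = jet P -> P' = P.
Proof.
move=> aP /cplx_pair_inj [hX hY] ht he.
have [al2 be2 aE bE] := jacobi_coords_inj (jal_ja P') (jbe_jb P') (jal_ja P)
  (jbe_jb P) ht hX hY.
move: he => /cplx_pair_inj [he1 he2].
have pE : jp P' = jp P by rewrite /jp bE.
have qE : jq P' = jq P by rewrite /jq aE.
move: he1; rewrite pE qE => /mulfI -/(_ _) sE.
have {}sE : jal P' + jbe P' = jal P + jbe P.
  by apply: sE; rewrite mulf_neq0 // gt_eqF ?jp_gt0 ?jq_gt0.
move: he2 => /oppr_inj; rewrite aE bE => dE.
suff alE : jal P' = jal P.
  by apply: torus_eq => //; move: sE; rewrite alE => /addrI.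
move: al2 => /eqP; rewrite eqf_sqr => /orP[/eqP//|/eqP alN].
move: be2 => /eqP; rewrite eqf_sqr => /orP[/eqP beE|/eqP beN].
  by move: sE; rewrite beE => /addIr.
(* Both signs change, so the real part of [jet] gives al + be = 0. Since P is affine, a b is
   nonzero, and the imaginary part of [jet] then forces al = 0. *)
have be_al : jbe P = - jal P by lra.
have a2 := jal_ja P; have b2 := jbe_jb P; rewrite be_al in b2.
have al1 : 1 - jal P ^+ 2 != 0.
  by move: aP; rewrite /affine /jt be_al mulrN -expr2.
have ab0 : ja P * jb P != 0.
  rewrite -sqrf_eq0 exprMn.
  have -> : jb P ^+ 2 = 1 - jal P ^+ 2 by lra.
  have -> : ja P ^+ 2 = 1 - jal P ^+ 2 by lra.
  by rewrite mulf_neq0.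
have {}dE : A * jal P' - B * jbe P' = A * jal P - B * jbe P by exact: (mulfI ab0).
have AB := modAB R.
have : (A + B) * jal P = 0 by rewrite alN beN be_al in dE; lra.
by rewrite AB mul1r alN => ->; rewrite oppr0.
Qed.

Lemma jt_ge1 P : -1 <= jt P.
Proof.
have := jze_sqr P => h.
have : jt P ^+ 2 <= 1 by rewrite -subr_ge0 -h addr_ge0 // sqr_ge0.
by move=> h2; nra.
Qed.

Lemma jt_gtN1 P : affine P -> 0 < 1 + jt P.
Proof. by move=> aP; rewrite lt_def -/(affine P) aP -lerBlDl sub0r jt_ge1. Qed.

(** Stereographic projection: |x|^2 = (1 - t) / (1 + t) with t = [jt P]. As a consequence [jze],
    [jt] and [jet] are continuous expressions in x and y, on which both injectivity and the
    continuity of the inverse rest. *)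
Lemma xT_norm P : affine P -> c (1 + jt P) * (1 + `|xT P| ^+ 2) = 2.
Proof.
move=> aP; have u0 := affine_neq0 aP; have u1 := jt_gtN1 aP.
rewrite /xT normrM exprMn norm_jze normfV.
have -> : `|c (1 + jt P)| = c (1 + jt P) by rewrite ger0_norm // lecR ltW.
rewrite !cRE in u0 *; move: (c (jt P)) u0 => u u0.
by field.
Qed.

Lemma jze_E P : affine P -> jze P = 2 * xT P / (1 + `|xT P| ^+ 2).
Proof.
move=> aP; have u0 := affine_neq0 aP; have h := xT_norm aP.
have n0 : 1 + `|xT P| ^+ 2 != 0.
  by apply/eqP => n0; move: h; rewrite n0 mulr0 => /esym/eqP; rewrite pnatr_eq0.
have -> : jze P = xT P * c (1 + jt P) by rewrite /xT divfK.
by rewrite -h; field.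
Qed.

Lemma jt_E P : affine P -> c (jt P) = 2 / (1 + `|xT P| ^+ 2) - 1.
Proof.
move=> aP; have u0 := affine_neq0 aP; have h := xT_norm aP.
have n0 : 1 + `|xT P| ^+ 2 != 0.
  by apply/eqP => n0; move: h; rewrite n0 mulr0 => /esym/eqP; rewrite pnatr_eq0.
by rewrite -h mulfK // cRD cR1 addrAC subrr add0r.
Qed.

Lemma jet_E P : affine P -> jet P = 2 * yT P / (1 + `|xT P| ^+ 2) ^+ 2.
Proof.
move=> aP; have u0 := affine_neq0 aP; have h := xT_norm aP.
have n0 : 1 + `|xT P| ^+ 2 != 0.
  by apply/eqP => n0; move: h; rewrite n0 mulr0 => /esym/eqP; rewrite pnatr_eq0.
have -> : jet P = yT P * c (1 + jt P) ^+ 2 / 2.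
  by rewrite /yT divfK ?expf_neq0 // mulrC mulKf // pnatr_eq0.
have -> : c (1 + jt P) = 2 / (1 + `|xT P| ^+ 2) by rewrite -h mulfK.
by field.
Qed.

Lemma xy_inj P P' : affine P -> affine P' -> xT P' = xT P -> yT P' = yT P ->
  P' = P.
Proof.
move=> aP aP' xE yE; apply: embed_inj => //.
- by rewrite !jze_E // xE.
- by apply: cRI; rewrite !jt_E // xE.
- by rewrite !jet_E // xE yE.
Qed.

(** Inverse stereographic projection of x gives a point of the sphere, and [jacobi_coords_exist] a
    point of the torus above it. Its second coordinate is y up to sign, and changing the signs of
    both [jal] and [jbe] corrects the sign. *)
Lemma xy_surj x y : y ^+ 2 = quartic x ->
  exists P, [/\ affine P, xT P = x & yT P = y].
Proof.
move=> xy; pose N := Re x ^+ 2 + Im x ^+ 2.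
have N0 : 0 < 1 + N by rewrite ltr_wpDr // addr_ge0 // sqr_ge0.
have Nn : 1 + N != 0 by rewrite gt_eqF.
have := @jacobi_coords_exist R (2 * Re x / (1 + N)) (2 * Im x / (1 + N))
  ((1 - N) / (1 + N)).
case.
  have : Re x ^+ 2 = N - Im x ^+ 2 by rewrite /N addrK.
  by move: (Re x) (Im x) N Nn {N0} => u v n n0 uE; field: uE.
move=> al [a [be [b [h1 h2 ht hX hY]]]].
pose P : T := (circ_pt h1, circ_pt h2).
have tE : 1 + jt P = 2 / (1 + N).
  by rewrite /jt /jal /jbe !circ_pt_re ht; field.
have aP : affine P by rewrite /affine tE mulf_neq0 ?invr_neq0 // pnatr_eq0.
have xE : xT P = x.
  rewrite /xT /jze /ja /jb /jp /jq /ja /jb !circ_pt_im hX hY tE [RHS]cplxE.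
  have : c (1 + N) != 0 by rewrite cR_eq0.
  rewrite !cRM !cRV !cRn => n0; move: (c (1 + N)) n0 => u n0.
  by field; rewrite n0 ?pnatr_eq0.
have := curve_eq aP; rewrite xE -xy => /eqP; rewrite eqf_sqr => /orP[] /eqP yE.
  by exists P.
pose P' : T := (circ_neg P.1, circ_neg P.2).
have tE' : jt P' = jt P by rewrite /jt /jal /jbe !circ_neg_re mulrNN.
exists P'; split; first by rewrite /affine tE'.
  by rewrite -xE /xT tE' /jze /jp /jq /ja /jb !circ_neg_im.
rewrite -[y]opprK -yE /yT tE' -mulNr -mulrN; congr (_ * _ / _).
rewrite /jet /jp /jq /ja /jb /jal /jbe !circ_neg_im !circ_neg_re.
by rewrite -opprD mulrN !mulrN -opprB !cRN /=; ring.
Qed.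

End Curve.

(** * The real structure, the symmetry x |-> 1/x, and continuity of the coordinates *)

Section CurveSymmetries.
Variable R : realType.
Local Notation C := (cplx R).
Local Notation Re := (@complex.Re R).
Local Notation Im := (@complex.Im R).
Local Notation c := (@cplx_of_real R).
Local Notation ii := (imag_unit R).
Local Notation A := (modA R).
Local Notation B := (modB R).
Local Notation T := (torus R).

(* On the quartic, [torus_conj] is [(x, y) |-> (- conj x, conj y)] and [torus_inv] is
   [(x, y) |-> (1/x, y/x^2)], which exchanges [0] and infinity. *)
Definition torus_conj (P : T) : T := (circ_flip P.1, P.2).
Definition torus_inv (P : T) : T := (circ_neg P.1, circ_flip P.2).

Lemma torus_conjK : involutive torus_conj.
Proof. by move=> [z w]; rewrite /torus_conj /= circ_flipK. Qed.
Lemma torus_invK : involutive torus_inv.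
Proof. by move=> [z w]; rewrite /torus_inv /= circ_flipK circ_negK. Qed.

Lemma torus_conj_continuous : continuous torus_conj.
Proof.
move=> P; have h : {for P, continuous (@circ_flip R \o fst : T -> circle R)}.
  apply: (@continuous_comp T (circle R) (circle R) fst (@circ_flip R)).
    exact: cvg_fst.
  exact: circ_flip_continuous.
have h2 : {for P, continuous (snd : T -> circle R)} by exact: cvg_snd.
exact: cvg_pair h h2.
Qed.

Lemma torus_inv_continuous : continuous torus_inv.
Proof.
move=> P; have h : {for P, continuous (@circ_neg R \o fst : T -> circle R)}.
  apply: (@continuous_comp T (circle R) (circle R) fst (@circ_neg R)).
    exact: cvg_fst.
  exact: circ_neg_continuous.
have h2 : {for P, continuous (@circ_flip R \o snd : T -> circle R)}.
  apply: (@continuous_comp T (circle R) (circle R) snd (@circ_flip R)).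
    exact: cvg_snd.
  exact: circ_flip_continuous.
exact: cvg_pair h h2.
Qed.

Lemma jt_sig P : jt (torus_conj P) = jt P.
Proof. by rewrite /jt /jal /jbe /= circ_flip_re. Qed.
Lemma affine_sig P : affine (torus_conj P) = affine P.
Proof. by rewrite /affine jt_sig. Qed.

Lemma xT_sig P : xT (torus_conj P) = - (xT P)^*.
Proof.
rewrite /xT rmorphM fmorphV /= conj_cR jt_sig -mulNr; congr (_ / _).
rewrite /jze /jp /jq /ja /jb /= circ_flip_im conj_cplx sqrrN.
by rewrite mulNr cRN opprB addrC.
Qed.

Lemma yT_sig P : yT (torus_conj P) = (yT P)^*.
Proof.
rewrite /yT !rmorphM fmorphV rmorphXn rmorph_nat /= conj_cR jt_sig.
congr (_ * _ / _); rewrite /jet /jp /jq /ja /jb /jal /jbe /= circ_flip_im circ_flip_re.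
by rewrite conj_cplx sqrrN !mulNr opprK cRN mulrN opprK.
Qed.

Lemma torus_inv_sig (P : T) : torus_inv (torus_conj P) = torus_conj (torus_inv P).
Proof.
rewrite /torus_inv /torus_conj /=; congr (_, _); apply: circ_eq;
by rewrite ?circ_flip_re ?circ_neg_re ?circ_flip_im ?circ_neg_im ?circ_flip_re ?circ_flip_im.
Qed.

Lemma jt_inv P : jt (torus_inv P) = - jt P.
Proof. by rewrite /jt /jal /jbe /= circ_flip_re circ_neg_re mulNr. Qed.

Lemma jze_inv P : jze (torus_inv P) = (jze P)^*.
Proof.
rewrite /jze /jp /jq /ja /jb /= circ_flip_im circ_neg_im conj_cplx sqrrN.
by rewrite mulNr cRN mulrN.
Qed.

Lemma jze_mul_inv P : jze P * jze (torus_inv P) = c (1 + jt P) * c (1 - jt P).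
Proof. by rewrite jze_inv -normCK norm_jze -cRM; congr c; ring. Qed.

Lemma xT_inv P : affine P -> affine (torus_inv P) -> xT P * xT (torus_inv P) = 1.
Proof.
move=> aP aP'; have := affine_neq0 aP; have := affine_neq0 aP'.
rewrite /xT jt_inv mulrACA jze_mul_inv -invfM.
move: (c _) (c _) => u v u0 v0.
by rewrite mulfV // mulf_neq0.
Qed.

Lemma jet_inv P : jet (torus_inv P) * jze P ^+ 2 = jet P * c (1 - jt P) ^+ 2.
Proof.
have h1 : c (jal P) ^+ 2 = 1 - c (ja P) ^+ 2.
  by rewrite -!cRX -cR1 -(jal_ja P) cRD addrK.
have h2 : c (jbe P) ^+ 2 = 1 - c (jb P) ^+ 2.
  by rewrite -!cRX -cR1 -(jbe_jb P) cRD addrK.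
have h3 : c (jp P) ^+ 2 = 1 - c B * c (jb P) ^+ 2.
  by rewrite -!cRX jpK !cRE.
have h4 : c (jq P) ^+ 2 = 1 - c A * c (ja P) ^+ 2.
  by rewrite -!cRX jqK !cRE.
have h5 : c A = 1 - c B by rewrite -cR1 -(modAB R) cRD addrK.
have h6 := imag_unitK R.
rewrite {1}/jet.
have -> : jp (torus_inv P) = jp P by rewrite /jp /jb /= circ_flip_im sqrrN.
have -> : jq (torus_inv P) = jq P by rewrite /jq /ja /= circ_neg_im.
have -> : jal (torus_inv P) = - jal P by rewrite /jal /= circ_neg_re.
have -> : ja (torus_inv P) = ja P by rewrite /ja /= circ_neg_im.
have -> : jbe (torus_inv P) = jbe P by rewrite /jbe /= circ_flip_re.
have -> : jb (torus_inv P) = - jb P by rewrite /jb /= circ_flip_im.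
rewrite /jet /jze /jt !cRE.
move: h1 h2 h3 h4 h5 h6.
move: (c (jal P)) (c (ja P)) (c (jbe P)) (c (jb P)) (c (jp P)) (c (jq P)) (c A) (c B) ii.
move=> al a be b p q kA kB i h1 h2 h3 h4 h5 h6.
rewrite {}h5 in h4 *.
ring: h1 h2 h3 h4 h6.
Qed.

Lemma yT_inv P : affine P -> affine (torus_inv P) ->
  yT (torus_inv P) * xT P ^+ 2 = yT P.
Proof.
move=> aP aP'; have := affine_neq0 aP; have := affine_neq0 aP'.
have := jet_inv P; rewrite /yT /xT jt_inv.
move: (jet (torus_inv P)) (jze P) (c (1 - jt P)) (jet P) (c (1 + jt P)) => e' z u e v h u0 v0.
have -> : 2 * e' / u ^+ 2 * (z / v) ^+ 2 = 2 * (e' * z ^+ 2) / (u ^+ 2 * v ^+ 2).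
  by field; rewrite u0 v0.
by rewrite h; field; rewrite u0 v0.
Qed.

Lemma not_affine P : ~~ affine P ->
  [/\ affine (torus_inv P), xT (torus_inv P) = 0 & yT (torus_inv P) ^+ 2 = 1].
Proof.
rewrite /affine negbK => /eqP t1.
have aP : affine (torus_inv P).
  have -> : affine (torus_inv P) = (2 != 0 :> R).
    by rewrite /affine jt_inv; congr (_ != _); lra.
  by rewrite pnatr_eq0.
have z0 : jze (torus_inv P) = 0.
  apply/eqP; rewrite jze_inv conjC_eq0 -normr_eq0 -sqrf_eq0 norm_jze cR_eq0.
  have -> : jt P = -1 by lra.
  by rewrite sqrrN expr1n subrr.
have xE : xT (torus_inv P) = 0 by rewrite /xT z0 mul0r.
by split=> //; rewrite curve_eq // xE /quartic; ring.
Qed.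

Lemma jal_continuous : continuous (@jal R).
Proof.
move=> P; apply: (@continuous_comp T (circle R) R fst (@circ_re R)).
  exact: cvg_fst.
exact: circ_re_continuous.
Qed.
Lemma ja_continuous : continuous (@ja R).
Proof.
move=> P; apply: (@continuous_comp T (circle R) R fst (@circ_im R)).
  exact: cvg_fst.
exact: circ_im_continuous.
Qed.
Lemma jbe_continuous : continuous (@jbe R).
Proof.
move=> P; apply: (@continuous_comp T (circle R) R snd (@circ_re R)).
  exact: cvg_snd.
exact: circ_re_continuous.
Qed.
Lemma jb_continuous : continuous (@jb R).
Proof.
move=> P; apply: (@continuous_comp T (circle R) R snd (@circ_im R)).
  exact: cvg_snd.
exact: circ_im_continuous.
Qed.

Lemma jp_continuous : continuous (@jp R).
Proof.
move=> P.
change {for P, continuous (fun P => Num.sqrt (1 - B * (jb P * jb P)))}.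
apply: contR_sqrt; apply: contRB; first exact: contR_cst.
apply: contRM; first exact: contR_cst.
by apply: contRM; exact: jb_continuous.
Qed.
Lemma jq_continuous : continuous (@jq R).
Proof.
move=> P.
change {for P, continuous (fun P => Num.sqrt (1 - A * (ja P * ja P)))}.
apply: contR_sqrt; apply: contRB; first exact: contR_cst.
apply: contRM; first exact: contR_cst.
by apply: contRM; exact: ja_continuous.
Qed.
Lemma jt_continuous : continuous (@jt R).
Proof.
move=> P; change {for P, continuous (fun P => jal P * jbe P)}.
by apply: contRM; [exact: jal_continuous|exact: jbe_continuous].
Qed.

Lemma contC_pair (X : topologicalType) (f g : X -> R) (x : X) :
  {for x, continuous f} -> {for x, continuous g} ->
  {for x, continuous (fun w => c (f w) + ii * c (g w))}.
Proof.
move=> cf cg; apply: contCD.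
  apply: (@continuous_comp X R C f c); first exact: cf.
  exact: cplx_of_real_continuous.
apply: contCM; first exact: contC_cst.
apply: (@continuous_comp X R C g c); first exact: cg.
exact: cplx_of_real_continuous.
Qed.

Lemma jze_continuous : continuous (@jze R).
Proof.
move=> P.
change {for P, continuous (fun P => c (ja P * jp P) + ii * c (jb P * jq P))}.
apply: contC_pair; apply: contRM.
- exact: ja_continuous.
- exact: jp_continuous.
- exact: jb_continuous.
- exact: jq_continuous.
Qed.

Lemma jet_continuous : continuous (@jet R).
Proof.
move=> P; change {for P, continuous (fun P =>
  c (jp P * jq P * (jal P + jbe P)) +
  ii * c (- (ja P * jb P * (A * jal P - B * jbe P))))}.
apply: contC_pair.
  apply: contRM.
    by apply: contRM; [exact: jp_continuous|exact: jq_continuous].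
  by apply: contRD; [exact: jal_continuous|exact: jbe_continuous].
apply: contRN; apply: contRM.
  by apply: contRM; [exact: ja_continuous|exact: jb_continuous].
by apply: contRB; apply: contRM; [exact: contR_cst|exact: jal_continuous|
  exact: contR_cst|exact: jbe_continuous].
Qed.

Lemma cjt_continuous : continuous (fun P => c (1 + jt P)).
Proof.
move=> P; apply: (@continuous_comp T R C (fun P => 1 + jt P) c).
  by apply: contRD; [exact: contR_cst|exact: jt_continuous].
exact: cplx_of_real_continuous.
Qed.

Lemma xT_continuous P : affine P -> {for P, continuous (@xT R)}.
Proof.
move=> /affine_neq0 aP.
change {for P, continuous (fun P => jze P / c (1 + jt P))}.
apply: contCM; first exact: jze_continuous.
by apply: contCV => //; exact: cjt_continuous.
Qed.

Lemma yT_continuous P : affine P -> {for P, continuous (@yT R)}.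
Proof.
move=> /affine_neq0 aP.
change {for P, continuous (fun P => 2 * jet P / c (1 + jt P) ^+ 2)}.
apply: contCM.
  by apply: contCM; [exact: contC_cst|exact: jet_continuous].
apply: contCV; last by rewrite expf_neq0.
by apply: contCX; exact: cjt_continuous.
Qed.

Lemma affine_near P : affine P -> nbhs P [set P' : T | affine P'].
Proof.
move=> aP; apply: (@cvgr_neq0 _ R _ _ (nbhs_filter P) (fun P => 1 + jt P) _ _ aP).
by apply: contRD; [exact: contR_cst|exact: jt_continuous].
Qed.

Lemma affine_open : open [set P : T | affine P].
Proof. by rewrite openE => P /= aP; exact: affine_near. Qed.

End CurveSymmetries.

(** * Charts and the Riemann surface *)

Section DerivableC.
Variable R : realType.
Local Notation C := (cplx R).
Local Notation Re := (@complex.Re R).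

Lemma derivC_cst (a z : C) : derivable (fun=> a : C) z 1.
Proof. exact: (@derivable_cst C C C a z 1). Qed.

Lemma derivC_id (z : C) : derivable (id : C -> C) z 1.
Proof. exact: (@derivable_id C C z 1). Qed.

Variables (f g : C -> C) (z : C).
Hypotheses (df : derivable f z 1) (dg : derivable g z 1).

Lemma derivCD : derivable (fun w => f w + g w) z 1.
Proof. exact: (@derivableD C C C f g z 1 df dg). Qed.

Lemma derivCN : derivable (fun w => - f w) z 1.
Proof. exact: (@derivableN C C C f z 1 df). Qed.

Lemma derivCB : derivable (fun w => f w - g w) z 1.
Proof. exact: (@derivableB C C C f g z 1 df dg). Qed.

Lemma derivCM : derivable (fun w => f w * g w) z 1.
Proof. exact: (@derivableM C C f g z 1 df dg). Qed.

Lemma derivCV : f z != 0 -> derivable (fun w => (f w)^-1) z 1.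
Proof. by move=> f0; exact: (@derivableV C C f z 1 f0 df). Qed.

Lemma derivCX n : derivable (fun w => f w ^+ n) z 1.
Proof.
have -> : (fun w => f w ^+ n) = f ^+ n.
  by apply/funext => w; rewrite exprfctE.
exact: (@derivableX C C f n z 1 df).
Qed.

End DerivableC.

Section Charts.
Variable R : realType.
Local Notation C := (cplx R).
Local Notation Re := (@complex.Re R).
Local Notation c := (@cplx_of_real R).
Local Notation T := (torus R).

(** A choice instead of a formula with signs of square roots; by [xy_inj] there is nothing to choose
    on the quartic, and the default point is returned only off it. *)
Definition curve_pt (x y : C) : T :=
  xget (circ_exp 0, circ_exp 0) [set P : T | [/\ affine P, xT P = x & yT P = y]].

Lemma curve_ptP x y : y ^+ 2 = quartic x ->
  [/\ affine (curve_pt x y), xT (curve_pt x y) = x & yT (curve_pt x y) = y].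
Proof.
move=> /xy_surj [P hP].
have : [set P : T | [/\ affine P, xT P = x & yT P = y]] (curve_pt x y).
  by apply: xgetPex; exists P.
by [].
Qed.

Lemma curve_ptK P : affine P -> curve_pt (xT P) (yT P) = P.
Proof.
move=> aP; have [h1 h2 h3] := curve_ptP (curve_eq aP).
exact: xy_inj.
Qed.

Lemma contC_norm (X : topologicalType) (f : X -> C) (x : X) :
  {for x, continuous f} -> {for x, continuous (fun w => `|f w|)}.
Proof.
move=> cf; apply: (@continuous_comp X C C f (fun w : C => `|w|)); first exact: cf.
exact: (@norm_continuous C C).
Qed.

(** The chosen point is given by no formula whose continuity could be read off. But ([jze], [jt],
    [jet]) is continuous on the whole compact torus and separates an affine point from all others,
    and along the given family it is a continuous expression in X and Y; so [compact_separated_cvg]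
    applies. *)
Lemma curve_pt_continuous (X Y : C -> C) (z0 : C) :
  {for z0, continuous X} -> {for z0, continuous Y} ->
  nbhs z0 [set z | Y z ^+ 2 = quartic (X z)] ->
  {for z0, continuous (fun z => curve_pt (X z) (Y z))}.
Proof.
move=> cX cY XY.
pose n z := 1 + `|X z| ^+ 2.
have n0 z : n z != 0 by rewrite gt_eqF // ltr_wpDr // exprn_ge0.
have cn : {for z0, continuous n}.
  apply: contCD; first exact: contC_cst.
  by apply: contCX; apply: contC_norm; exact: cX.
have cnV : {for z0, continuous (fun z => (n z)^-1)} by apply: contCV; [exact: cn|exact: n0].
pose F1 z := 2 * X z / n z.
pose F2 z := 2 / n z - 1.
pose F3 z := 2 * Y z / n z ^+ 2.
have c1 : {for z0, continuous F1}.
  apply: contCM; last exact: cnV.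
  by apply: contCM; [exact: contC_cst|exact: cX].
have c2 : {for z0, continuous F2}.
  apply: contCB; last exact: contC_cst.
  by apply: contCM; [exact: contC_cst|exact: cnV].
have c3 : {for z0, continuous F3}.
  apply: contCM; first by apply: contCM; [exact: contC_cst|exact: cY].
  apply: contCV; last by rewrite expf_neq0.
  by apply: contCX; exact: cn.
pose e (P : T) : C * C * C := (jze P, c (jt P), jet P).
have ce : continuous e.
  move=> P.
  have h1 : {for P, continuous (@jze R)} by exact: jze_continuous.
  have h2 : {for P, continuous (fun P => c (jt P))}.
    apply: (@continuous_comp T R C (@jt R) c); first exact: jt_continuous.
    exact: cplx_of_real_continuous.
  have h3 : {for P, continuous (@jet R)} by exact: jet_continuous.
  exact: cvg_pair (cvg_pair h1 h2) h3.
have eE z : Y z ^+ 2 = quartic (X z) -> e (curve_pt (X z) (Y z)) = (F1 z, F2 z, F3 z).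
  move=> /curve_ptP [a1 a2 a3].
  by rewrite /e jze_E // jt_E // jet_E // a2 a3.
have XY0 : Y z0 ^+ 2 = quartic (X z0) by exact: nbhs_singleton XY.
have aP : affine (curve_pt (X z0) (Y z0)) by have [] := curve_ptP XY0.
apply: (@compact_separated_cvg T (C * C * C)%type C (nbhs z0) (nbhs_filter z0) e
  (fun z => curve_pt (X z) (Y z)) (curve_pt (X z0) (Y z0))).
- exact: torus_compact.
- exact: (@norm_hausdorff C).
- exact: ce.
- move=> P' ePE; apply: embed_inj aP _ _ _.
  + exact: (congr1 (fun u => u.1.1) ePE).
  + by apply: cRI; exact: (congr1 (fun u => u.1.2) ePE).
  + exact: (congr1 (fun u => u.2) ePE).
- rewrite eE //; have : (F1 z, F2 z, F3 z) @[z --> z0] --> (F1 z0, F2 z0, F3 z0).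
    exact: cvg_pair (cvg_pair c1 c2) c3.
  apply: cvg_trans; apply: near_eq_cvg.
  by apply: filterS XY => z zE; rewrite eE.
Qed.

Lemma Re_gt0_near (X : topologicalType) (f : X -> C) (x : X) :
  {for x, continuous f} -> 0 < Re (f x) -> nbhs x [set w | 0 < Re (f w)].
Proof.
move=> cf fx.
have h : {for x, continuous (Re \o f)}.
  by apply: (@continuous_comp X C R f Re); [exact: cf|exact: cplx_Re_continuous].
apply: (h [set r | 0 < r]); by apply: open_nbhs_nbhs; split => //; exact: open_gt.
Qed.

Section MkChart.
Variables (D : set T) (U : set C) (g : T -> C) (h : C -> T).
Hypotheses (oD : open D) (oU : open U).
Hypotheses (gD : forall P, D P -> [/\ U (g P), h (g P) = P & {for P, continuous g}]).
Hypotheses (hU : forall z, U z -> [/\ D (h z), g (h z) = z & {for z, continuous h}]).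

Lemma mk_chart_img : g @` D = U.
Proof.
apply/seteqP; split=> [_ [P DP <-]|z Uz]; first by have [] := gD DP.
by have [Dz gz _] := hU Uz; exists (h z).
Qed.

Lemma mk_chart_img_open : open (g @` D). Proof. by rewrite mk_chart_img. Qed.

Lemma mk_chartK : {in D, cancel g h}.
Proof. by move=> P; rewrite inE => /gD []. Qed.

Lemma mk_chart_fun_continuous : {in D, continuous g}.
Proof. by move=> P; rewrite inE => /gD [_ _ h1]; exact: h1. Qed.

Lemma mk_chart_inv_continuous : {in g @` D, continuous h}.
Proof. by rewrite mk_chart_img => z; rewrite inE => /hU [_ _ h1]; exact: h1. Qed.

Definition mk_chart : chart R T := Chart oD mk_chart_img_open mk_chartK
  mk_chart_fun_continuous mk_chart_inv_continuous.
End MkChart.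

End Charts.

Section Atlas.
Variable R : realType.
Local Notation C := (cplx R).
Local Notation Re := (@complex.Re R).
Local Notation c := (@cplx_of_real R).
Local Notation T := (torus R).

Lemma open_Re_gt0 (X : topologicalType) (D : set X) (f : X -> C) :
  open D -> (forall x, D x -> {for x, continuous f}) ->
  open (D `&` [set x | 0 < Re (f x)]).
Proof.
move=> oD cf; rewrite openE => x [Dx fx]; apply: filterI.
  exact: open_nbhs_nbhs.
by apply: Re_gt0_near => //; exact: cf.
Qed.

Lemma Re_gt0_neq0 (z : C) : 0 < Re z -> z != 0.
Proof. by apply: contraTneq => ->; rewrite /= ltxx. Qed.

Lemma Re_conj_mul_gt0 (z : C) : z != 0 -> 0 < Re (z^* * z).
Proof.
move=> z0; rewrite mulrC -normCK.
have : 0 < `|z| ^+ 2 by rewrite exprn_gt0 // normr_gt0.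
by rewrite ltcE => /andP[].
Qed.

Lemma quartic_derivable (z : C) : derivable (@quartic R) z 1.
Proof.
change (derivable (fun x : C => x ^+ 4 - 2 * c (kap R) * x ^+ 2 + 1) z 1).
apply: derivCD; last exact: derivC_cst.
apply: derivCB; first by apply: derivCX; exact: derivC_id.
apply: derivCM; first exact: derivC_cst.
by apply: derivCX; exact: derivC_id.
Qed.

(* The parameter [u] selects the branch of the square root: the charts cover
   [Re (u y) > 0] or [Re (u x) > 0], where [u y] and [u x] are principal roots. *)
Section ChartX.
Variable u : C.

Definition chartx_dom : set T := [set P | affine P] `&` [set P | 0 < Re (u * yT P)].
Definition chartx_y (z : C) : C := csqrt (u ^+ 2 * quartic z) / u.
Definition chartx_inv (z : C) : T := curve_pt z (chartx_y z).
Definition chartx_img : set C := [set z | 0 < Re (csqrt (u ^+ 2 * quartic z))].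

Lemma chartx_arg_derivable z : derivable (fun z => u ^+ 2 * quartic z) z 1.
Proof. by apply: derivCM; [exact: derivC_cst|exact: quartic_derivable]. Qed.

Lemma chartx_sqrt_derivable z : chartx_img z ->
  derivable (fun z => csqrt (u ^+ 2 * quartic z)) z 1.
Proof.
move=> zU; apply: (@derivable_compC R (fun z => u ^+ 2 * quartic z) (@csqrt R)).
  exact: chartx_arg_derivable.
exact: derivable_csqrt.
Qed.

Lemma chartx_y_derivable z : chartx_img z -> derivable chartx_y z 1.
Proof.
move=> zU; apply: derivCM; last exact: derivC_cst.
exact: chartx_sqrt_derivable.
Qed.

Lemma chartx_dom_open : open chartx_dom.
Proof.
apply: open_Re_gt0; first exact: affine_open.
move=> P aP; apply: contCM; first exact: contC_cst.
exact: yT_continuous.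
Qed.

Lemma chartx_img_open : open chartx_img.
Proof.
rewrite openE => z zU; apply: Re_gt0_near => //.
by apply: derivable_continuousC; exact: chartx_sqrt_derivable.
Qed.

Lemma chartx_u_neq0 z : chartx_img z -> u != 0.
Proof.
by move=> zU; apply: contraTneq zU => ->; rewrite /chartx_img /= expr0n mul0r csqrt0 /= ltxx.
Qed.

Lemma chartx_y_eq z : chartx_img z -> chartx_y z ^+ 2 = quartic z.
Proof.
by move=> zU; rewrite /chartx_y expr_div_n csqrtK mulrC mulKf // expf_neq0 // (chartx_u_neq0 zU).
Qed.

Lemma chartx_gD P : chartx_dom P ->
  [/\ chartx_img (xT P), chartx_inv (xT P) = P & {for P, continuous (@xT R)}].
Proof.
move=> [aP yP].
have yE : csqrt (u ^+ 2 * quartic (xT P)) = u * yT P.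
  by rewrite -curve_eq // -exprMn csqrt_sqr.
split; [by rewrite /chartx_img /= yE| |exact: xT_continuous].
have u0 : u != 0 by move: (Re_gt0_neq0 yP); rewrite mulf_eq0 negb_or => /andP[].
by rewrite /chartx_inv /chartx_y yE mulrC mulKf // curve_ptK.
Qed.

Lemma chartx_hU z : chartx_img z ->
  [/\ chartx_dom (chartx_inv z), xT (chartx_inv z) = z & {for z, continuous chartx_inv}].
Proof.
move=> zU; have u0 := chartx_u_neq0 zU.
have [aP xP yP] := curve_ptP (chartx_y_eq zU).
split=> //.
  by split=> //=; rewrite yP /chartx_y mulrC divfK.
apply: curve_pt_continuous; first exact: contC_id.
  by apply: derivable_continuousC; exact: chartx_y_derivable.
have : nbhs z chartx_img by apply: open_nbhs_nbhs; split=> //; exact: chartx_img_open.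
by apply: filterS => w /chartx_y_eq.
Qed.

Definition chartx : chart R T :=
  mk_chart chartx_dom_open chartx_img_open chartx_gD chartx_hU.

Definition chartj_dom : set T := (@torus_inv R) @^-1` chartx_dom.

Lemma chartj_dom_open : open chartj_dom.
Proof.
apply: open_comp; last exact: chartx_dom_open.
by move=> P _; exact: torus_inv_continuous.
Qed.

Lemma chartj_gD P : chartj_dom P -> [/\ chartx_img (xT (torus_inv P)),
  torus_inv (chartx_inv (xT (torus_inv P))) = P & {for P, continuous (@xT R \o @torus_inv R)}].
Proof.
move=> /chartx_gD [h1 h2 h3]; split; [exact: h1|by rewrite h2 torus_invK|].
apply: (@continuous_comp T T C (@torus_inv R) (@xT R)); first exact: torus_inv_continuous.
exact: h3.
Qed.

Lemma chartj_hU z : chartx_img z -> [/\ chartj_dom (torus_inv (chartx_inv z)),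
  xT (torus_inv (torus_inv (chartx_inv z))) = z & {for z, continuous (@torus_inv R \o chartx_inv)}].
Proof.
move=> /chartx_hU [h1 h2 h3]; split.
- by rewrite /chartj_dom /= torus_invK.
- by rewrite torus_invK.
apply: (@continuous_comp C T T chartx_inv (@torus_inv R)); first exact: h3.
exact: torus_inv_continuous.
Qed.

Definition chartj : chart R T :=
  mk_chart chartj_dom_open chartx_img_open chartj_gD chartj_hU.

(* The function [mT = y + x^2] has degree 2: on the curve
   [mT^2 - 1 = 2 (mT - kap) x^2]. *)
Definition mT (P : T) : C := yT P + xT P ^+ 2.
Definition chartm_dom : set T := [set P | affine P] `&` [set P | 0 < Re (u * xT P)].
Definition chartm_arg (z : C) : C := u ^+ 2 * ((z ^+ 2 - 1) / (2 * (z - c (kap R)))).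
Definition chartm_x (z : C) : C := csqrt (chartm_arg z) / u.
Definition chartm_inv (z : C) : T := curve_pt (chartm_x z) (z - chartm_x z ^+ 2).
Definition chartm_img : set C := [set z | 0 < Re (csqrt (chartm_arg z))].

Lemma mT_continuous P : affine P -> {for P, continuous mT}.
Proof.
move=> aP; change {for P, continuous (fun P => yT P + xT P ^+ 2)}.
by apply: contCD; [exact: yT_continuous|apply: contCX; exact: xT_continuous].
Qed.

Lemma kap_sqr_neq1 : c (kap R) ^+ 2 - 1 != 0.
Proof.
rewrite -cR1 -cRX -cRB cR_eq0 subr_eq0 lt_eqF //.
by have := kap_gt0 R; have := kap_lt1 R; nra.
Qed.

Lemma mT_rel P : affine P ->
  mT P ^+ 2 - 1 = 2 * (mT P - c (kap R)) * xT P ^+ 2.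
Proof.
move=> aP; have := curve_eq aP; rewrite /mT /quartic.
by move: (xT P) (yT P) => x y h; ring: h.
Qed.

Lemma mT_neq_kap P : affine P -> mT P - c (kap R) != 0.
Proof.
move=> aP; apply/eqP => /eqP; rewrite subr_eq0 => /eqP mE.
have := mT_rel aP; rewrite mE subrr mulr0 mul0r => /eqP.
by rewrite (negbTE kap_sqr_neq1).
Qed.

(** At [kap] the inverse of 0 is 0 by convention, so [chartm_arg] and its root vanish and the strict
    inequality in [chartm_img] fails. *)
Lemma chartm_neq_kap z : chartm_img z -> z - c (kap R) != 0.
Proof.
move=> zU; apply: contraTneq zU => zE.
by rewrite /chartm_img /chartm_arg /= zE mulr0 invr0 !mulr0 csqrt0 /= ltxx.
Qed.

Lemma chartm_u_neq0 z : chartm_img z -> u != 0.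
Proof.
by move=> zU; apply: contraTneq zU => u0;
  rewrite /chartm_img /chartm_arg /= u0 expr0n mul0r csqrt0 /= ltxx.
Qed.

Lemma chartm_sqrt_derivable z : chartm_img z ->
  derivable (fun z => csqrt (chartm_arg z)) z 1.
Proof.
move=> zU; apply: (@derivable_compC R chartm_arg (@csqrt R)); last first.
  exact: derivable_csqrt.
change (derivable (fun z : C => u ^+ 2 * ((z ^+ 2 - 1) / (2 * (z - c (kap R))))) z 1).
apply: derivCM; first exact: derivC_cst.
apply: derivCM.
  by apply: derivCB; [apply: derivCX; exact: derivC_id|exact: derivC_cst].
apply: derivCV; last by rewrite mulf_neq0 ?pnatr_eq0 // chartm_neq_kap.
apply: derivCM; first exact: derivC_cst.
by apply: derivCB; [exact: derivC_id|exact: derivC_cst].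
Qed.

Lemma chartm_x_derivable z : chartm_img z -> derivable chartm_x z 1.
Proof.
move=> zU; apply: derivCM; last exact: derivC_cst.
exact: chartm_sqrt_derivable.
Qed.

Lemma chartm_y_derivable z : chartm_img z ->
  derivable (fun z => z - chartm_x z ^+ 2) z 1.
Proof.
move=> zU; apply: derivCB; first exact: derivC_id.
by apply: derivCX; exact: chartm_x_derivable.
Qed.

Lemma chartm_dom_open : open chartm_dom.
Proof.
apply: open_Re_gt0; first exact: affine_open.
move=> P aP; apply: contCM; first exact: contC_cst.
exact: xT_continuous.
Qed.

Lemma chartm_img_open : open chartm_img.
Proof.
rewrite openE => z zU; apply: Re_gt0_near => //.
by apply: derivable_continuousC; exact: chartm_sqrt_derivable.
Qed.

Lemma chartm_eq z : chartm_img z ->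
  (z - chartm_x z ^+ 2) ^+ 2 = quartic (chartm_x z).
Proof.
move=> zU; have u0 := chartm_u_neq0 zU; have z0 := chartm_neq_kap zU.
have : chartm_x z ^+ 2 * (2 * (z - c (kap R))) = z ^+ 2 - 1.
  rewrite /chartm_x expr_div_n csqrtK /chartm_arg.
  by field; rewrite u0 z0.
rewrite /quartic; move: (chartm_x z) (c (kap R)) => x k h.
apply/eqP; rewrite -subr_eq0; apply/eqP.
transitivity (z ^+ 2 - 1 - x ^+ 2 * (2 * (z - k))); first by ring.
by rewrite h subrr.
Qed.

Lemma chartm_gD P : chartm_dom P ->
  [/\ chartm_img (mT P), chartm_inv (mT P) = P & {for P, continuous mT}].
Proof.
move=> [aP xP].
have m0 := mT_neq_kap aP.
have xE : csqrt (chartm_arg (mT P)) = u * xT P.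
  rewrite -[RHS]csqrt_sqr //; congr csqrt; rewrite /chartm_arg mT_rel //.
  by field; rewrite m0.
split; [by rewrite /chartm_img /= xE| |exact: mT_continuous].
have u0 : u != 0 by move: (Re_gt0_neq0 xP); rewrite mulf_eq0 negb_or => /andP[].
by rewrite /chartm_inv /chartm_x xE mulrC mulKf // /mT addrK curve_ptK.
Qed.

Lemma chartm_hU z : chartm_img z ->
  [/\ chartm_dom (chartm_inv z), mT (chartm_inv z) = z & {for z, continuous chartm_inv}].
Proof.
move=> zU; have u0 := chartm_u_neq0 zU.
have [aP xP yP] := curve_ptP (chartm_eq zU).
split.
- by split=> //=; rewrite xP /chartm_x mulrC divfK.
- by rewrite /mT yP xP subrK.
apply: curve_pt_continuous.
- by apply: derivable_continuousC; exact: chartm_x_derivable.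
- by apply: derivable_continuousC; exact: chartm_y_derivable.
have : nbhs z chartm_img by apply: open_nbhs_nbhs; split=> //; exact: chartm_img_open.
by apply: filterS => w /chartm_eq.
Qed.

Definition chartm : chart R T :=
  mk_chart chartm_dom_open chartm_img_open chartm_gD chartm_hU.

End ChartX.

End Atlas.

Lemma nbhsS (X : topologicalType) (x : X) (U V : set X) :
  nbhs x U -> (forall w, U w -> V w) -> nbhs x V.
Proof. by move=> Ux UV; exact: filterS Ux. Qed.

Lemma nbhsI (X : topologicalType) (x : X) (U V : set X) :
  nbhs x U -> nbhs x V -> nbhs x (U `&` V).
Proof. exact: filterI. Qed.

(** * Complex differentiability of a function read in a chart *)

Section HolomorphicAt.
Variables (R : realType) (M : topologicalType) (ch : chart R M) (P : M).
Local Notation C := (cplx R).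
Hypothesis chP : chart_dom ch P.

(** Differentiability at the single point P, so that sums, products and inverses need no shrinking
    of neighbourhoods. [holomorphic_at_holc] recovers holomorphy from it on an open set. *)
Definition holc (f : M -> C) : Prop :=
  derivable (f \o chart_inv ch) (chart_fun ch P) 1.

Lemma chart_invK : chart_inv ch (chart_fun ch P) = P.
Proof. by apply: chart_funK; rewrite inE. Qed.

Lemma chart_inv_cont : {for chart_fun ch P, continuous (chart_inv ch)}.
Proof. by apply: chart_inv_continuous; rewrite inE; exists P. Qed.

Lemma chart_inv_near (N : set M) : nbhs P N ->
  nbhs (chart_fun ch P) (chart_inv ch @^-1` N).
Proof. by move=> NP; apply: chart_inv_cont; rewrite chart_invK. Qed.

Lemma holc_eq (f g : M -> C) :
  nbhs P [set Q | f Q = g Q] -> holc f -> holc g.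
Proof.
move=> /chart_inv_near fg; apply: (@near_eq_derivable C C C).
exact: fg.
Qed.

Lemma holc_cst (a : C) : holc (fun=> a).
Proof. exact: derivC_cst. Qed.

Variables (f g : M -> C).
Hypotheses (hf : holc f) (hg : holc g).

Lemma holcD : holc (fun Q => f Q + g Q).
Proof. exact: derivCD hf hg. Qed.
Lemma holcN : holc (fun Q => - f Q).
Proof. exact: derivCN hf. Qed.
Lemma holcB : holc (fun Q => f Q - g Q).
Proof. exact: derivCB hf hg. Qed.
Lemma holcM : holc (fun Q => f Q * g Q).
Proof. exact: derivCM hf hg. Qed.
Lemma holcX n : holc (fun Q => f Q ^+ n).
Proof. exact: (@derivCX R _ _ hf n). Qed.
Lemma holcV : f P != 0 -> holc (fun Q => (f Q)^-1).
Proof.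
move=> fP; apply: (derivCV hf); rewrite /= chart_invK; exact: fP.
Qed.
End HolomorphicAt.

(** * The atlas of the torus and the real elliptic curve *)

Section EllipticCurve.
Variable R : realType.
Local Notation C := (cplx R).
Local Notation Re := (@complex.Re R).
Local Notation c := (@cplx_of_real R).
Local Notation T := (torus R).

(* [chartx] misses the zeros of [y], where [chartm] applies since [x <> 0] there;
   [chartj] covers the two points at infinity. *)
Definition torus_atlas : set (chart R T) :=
  [set ch | exists u, [\/ ch = chartx u, ch = chartj u | ch = chartm u]].

Definition xj (P : T) : C := xT (torus_inv P).
Definition yj (P : T) : C := yT (torus_inv P).

Lemma near_chart_img (U : set C) z : open U -> U z -> nbhs z U.
Proof. by move=> oU Uz; apply: open_nbhs_nbhs. Qed.

Lemma derivable_eq_on (U : set C) (f g : C -> C) z : open U -> U z ->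
  (forall w, U w -> f w = g w) -> derivable f z 1 -> derivable g z 1.
Proof.
move=> oU Uz fg; apply: (@near_eq_derivable C C C).
by apply: (nbhsS (near_chart_img oU Uz)) => w /fg.
Qed.

Lemma chartx_holc u P : chartx_dom u P ->
  holc (chartx u) P (@xT R) /\ holc (chartx u) P (@yT R).
Proof.
move=> PD; have [PU _ _] := chartx_gD PD.
have oU := @chartx_img_open R u; split.
  apply: (derivable_eq_on oU PU (f := id)); last exact: derivC_id.
  by move=> w /chartx_hU [_ h _]; rewrite /= h.
apply: (derivable_eq_on oU PU (f := chartx_y u)); last exact: chartx_y_derivable.
by move=> w /chartx_y_eq /curve_ptP [_ _ h]; rewrite /= h.
Qed.

Lemma chartm_holc u P : chartm_dom u P ->
  holc (chartm u) P (@xT R) /\ holc (chartm u) P (@yT R).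
Proof.
move=> PD; have [PU _ _] := chartm_gD PD.
have oU := @chartm_img_open R u; split.
  apply: (derivable_eq_on oU PU (f := chartm_x u)); last exact: chartm_x_derivable.
  by move=> w /chartm_eq /curve_ptP [_ h _]; rewrite /= h.
apply: (derivable_eq_on oU PU (f := fun z => z - chartm_x u z ^+ 2)).
  by move=> w /chartm_eq /curve_ptP [_ _ h]; rewrite /= h.
exact: chartm_y_derivable.
Qed.

Lemma chartj_holc u P : chartj_dom u P ->
  holc (chartj u) P xj /\ holc (chartj u) P yj.
Proof.
move=> PD; have [h1 h2] := chartx_holc PD.
rewrite /holc; split.
  have -> : xj \o chart_inv (chartj u) = @xT R \o chart_inv (chartx u).
    by apply/funext => z; rewrite /= /xj torus_invK.
  exact: h1.
have -> : yj \o chart_inv (chartj u) = @yT R \o chart_inv (chartx u).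
  by apply/funext => z; rewrite /= /yj torus_invK.
exact: h2.
Qed.

Lemma affine_inv_near P : affine (torus_inv P) -> nbhs P [set Q : T | affine (torus_inv Q)].
Proof. by move=> /affine_near; exact: torus_inv_continuous. Qed.

Lemma xj_E P : affine P -> affine (torus_inv P) -> xT P != 0 /\ xj P = (xT P)^-1.
Proof.
move=> aP aP'; have h := xT_inv aP aP'.
have x0 : xT P != 0.
  by apply/eqP => x0; move: h; rewrite x0 mul0r => /esym/eqP; rewrite oner_eq0.
by split=> //; apply: (mulfI x0); rewrite h mulfV.
Qed.

Lemma yj_E P : affine P -> affine (torus_inv P) -> yj P = yT P / xT P ^+ 2.
Proof.
move=> aP aP'; have [x0 _] := xj_E aP aP'.
by rewrite -(yT_inv aP aP') mulfK // expf_neq0.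
Qed.

Lemma xT_E P : affine P -> affine (torus_inv P) -> xj P != 0 /\ xT P = (xj P)^-1.
Proof.
move=> aP aP'; have [x0 ->] := xj_E aP aP'.
by rewrite invrK invr_neq0.
Qed.

Lemma yT_E P : affine P -> affine (torus_inv P) -> yT P = yj P / xj P ^+ 2.
Proof.
move=> aP aP'; have [x0 ->] := xj_E aP aP'.
by rewrite -(yT_inv aP aP') exprVn invrK.
Qed.

(** In [chartx] and [chartm] the coordinates x and y are explicit holomorphic functions. In [chartj]
    these are [xj] and [yj]; at an affine point of its domain [xj] is nonzero, and x = 1 / xj, y =
    yj / xj^2 nearby. *)
Lemma holc_affine ch P : torus_atlas ch -> chart_dom ch P -> affine P ->
  holc ch P (@xT R) /\ holc ch P (@yT R).
Proof.
move=> [u [->|->|->]] PD aP; [exact: chartx_holc| |exact: chartm_holc].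
have aP' : affine (torus_inv P) by have [] := PD.
have [hx hy] := chartj_holc PD.
have near2 := nbhsI (affine_near aP) (affine_inv_near aP').
have [x0 _] := xT_E aP aP'.
have hxV : holc (chartj u) P (fun Q => (xj Q)^-1) by apply: holcV.
split.
  apply: (holc_eq PD _ hxV).
  by apply: (nbhsS near2) => Q [a a'] /=; have [_ ->] := xT_E a a'.
have hyV : holc (chartj u) P (fun Q => yj Q * (xj Q)^-1 ^+ 2).
  exact: holcM hy (@holcX _ _ _ _ _ hxV 2).
apply: (holc_eq PD _ hyV).
by apply: (nbhsS near2) => Q [a a'] /=; rewrite (yT_E a a') exprVn.
Qed.

Lemma holc_infinity ch P : torus_atlas ch -> chart_dom ch P -> affine (torus_inv P) ->
  holc ch P xj /\ holc ch P yj.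
Proof.
move=> ach PD aP'.
have [aP|naP] := boolP (affine P).
  have [hx hy] := holc_affine ach PD aP.
  have near2 := nbhsI (affine_near aP) (affine_inv_near aP').
  have [x0 _] := xj_E aP aP'.
  have hxV : holc ch P (fun Q => (xT Q)^-1) by apply: holcV.
  split.
    apply: (holc_eq PD _ hxV).
    by apply: (nbhsS near2) => Q [a a'] /=; have [_ ->] := xj_E a a'.
  have hyV : holc ch P (fun Q => yT Q * (xT Q)^-1 ^+ 2).
    exact: holcM hy (@holcX _ _ _ _ _ hxV 2).
  apply: (holc_eq PD _ hyV).
  by apply: (nbhsS near2) => Q [a a'] /=; rewrite (yj_E a a') exprVn.
(* A point at infinity lies in the domain of no [chartx] and no [chartm]. *)
move: ach PD => [u [->|->|->]] PD; last 2 first.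
- exact: chartj_holc.
- by case: PD => /= aP; rewrite aP in naP.
by case: PD => /= aP; rewrite aP in naP.
Qed.

Lemma holomorphic_at_holc (f : T -> C) (W : set T) ch P :
  open W -> W P -> torus_atlas ch -> chart_dom ch P ->
  (forall Q, W Q -> chart_dom ch Q -> holc ch Q f) ->
  holomorphic_at (f \o chart_inv ch) (chart_fun ch P).
Proof.
move=> oW WP ach PD hf; rewrite /holomorphic_at.
have N : nbhs P (W `&` chart_dom ch).
  by apply: filterI; apply: open_nbhs_nbhs; split=> //; exact: chart_dom_open.
have N1 := chart_inv_near PD N.
have N2 : nbhs (chart_fun ch P) (chart_fun ch @` chart_dom ch).
  by apply: open_nbhs_nbhs; split; [exact: chart_img_open|exists P].
apply: (nbhsS (nbhsI N1 N2)) => z [[Wz _]] [Q DQ zE].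
move: Wz; rewrite -zE chart_invK // => WQ.
exact: hf.
Qed.

Lemma open_affine_inv : open [set Q : T | affine (torus_inv Q)].
Proof. by rewrite openE => Q; exact: affine_inv_near. Qed.

Lemma torus_atlas_fun_holc ch d P : torus_atlas ch -> chart_dom ch P ->
  torus_atlas d -> chart_dom d P ->
  holomorphic_at (chart_fun d \o chart_inv ch) (chart_fun ch P).
Proof.
move=> ach PD [u [->|->|->]] Pd.
- have aP : affine P by case: Pd.
  apply: (holomorphic_at_holc (@affine_open R) aP ach PD) => Q aQ QD.
  exact: (holc_affine ach QD aQ).1.
- have aP : affine (torus_inv P) by case: Pd.
  apply: (holomorphic_at_holc open_affine_inv aP ach PD) => Q aQ QD.
  exact: (holc_infinity ach QD aQ).1.
- have aP : affine P by case: Pd.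
  apply: (holomorphic_at_holc (@affine_open R) aP ach PD) => Q aQ QD.
  have [hx hy] := holc_affine ach QD aQ.
  exact: holcD hy (@holcX _ _ _ _ _ hx 2).
Qed.

(** Taking for [u] the conjugate of the coordinate c makes u c = |c|^2 positive. If y = 0 then x is
    nonzero, by the constant term 1 of the quartic. *)
Lemma torus_atlas_covered (P : T) : exists2 ch, torus_atlas ch & chart_dom ch P.
Proof.
have [aP|/not_affine [aP xP yP]] := boolP (affine P); last first.
  exists (chartj (yT (torus_inv P))^*); first by exists (yT (torus_inv P))^*; apply: Or32.
  split; [exact: aP|apply: Re_conj_mul_gt0].
  by rewrite -sqrf_eq0 yP oner_eq0.
have [y0|y0] := eqVneq (yT P) 0; last first.
  by exists (chartx (yT P)^*); [exists (yT P)^*; apply: Or31|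
    split; [exact: aP|exact: Re_conj_mul_gt0]].
exists (chartm (xT P)^*); first by exists (xT P)^*; apply: Or33.
split; [exact: aP|apply: Re_conj_mul_gt0; apply/eqP => x0]; have := curve_eq aP.
rewrite y0 x0 /quartic !expr0n mulr0 subr0 add0r => /eqP.
by rewrite eq_sym oner_eq0.
Qed.

Definition torus_surface : riemann_surface R :=
  RiemannSurface (@torus_hausdorff R) (@torus_connected R) torus_atlas_covered
    (fun ch d ach ad P PD Pd => torus_atlas_fun_holc ach PD ad Pd).

Lemma torus_surface_genus_one : genus_one torus_surface.
Proof.
by exists id, id; split=> // z; exact: cvg_id.
Qed.

(** After conjugation the coordinate of the image point is [- xT], [- xj] or [mT], according to the
    target chart. All three are holomorphic in every source chart, so no case analysis on the source
    is required. *)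
Lemma torus_conj_antiholomorphic : @antiholomorphic_map R torus_surface torus_surface (@torus_conj R).
Proof.
split; first exact: torus_conj_continuous.
move=> P ch d [ach PD] [ad Pd].
have E (z : C) : (- z^*)^* = - z by rewrite rmorphN /= conjCK.
case: ad Pd => u [->|->|->] Pd.
- have aP : affine P by case: Pd; rewrite /= affine_sig.
  have -> : (fun z => (local_expr (@torus_conj R : torus_surface -> torus_surface) ch (chartx u : chart R torus_surface) z)^*) =
      (fun Q => - xT Q) \o chart_inv ch.
    by apply/funext => z; rewrite /local_expr /= xT_sig E.
  apply: (holomorphic_at_holc (@affine_open R) aP ach PD) => Q aQ QD.
  exact: holcN (holc_affine ach QD aQ).1.
- have aP : affine (torus_inv P) by case: Pd; rewrite /= torus_inv_sig affine_sig.
  have -> : (fun z => (local_expr (@torus_conj R : torus_surface -> torus_surface) ch (chartj u : chart R torus_surface) z)^*) =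
      (fun Q => - xj Q) \o chart_inv ch.
    by apply/funext => z; rewrite /local_expr /= torus_inv_sig xT_sig E.
  apply: (holomorphic_at_holc open_affine_inv aP ach PD) => Q aQ QD.
  exact: holcN (holc_infinity ach QD aQ).1.
- have aP : affine P by case: Pd; rewrite /= affine_sig.
  have -> : (fun z => (local_expr (@torus_conj R : torus_surface -> torus_surface) ch (chartm u : chart R torus_surface) z)^*) =
      (@mT R) \o chart_inv ch.
    apply/funext => z; rewrite /local_expr /= /mT xT_sig yT_sig.
    by rewrite rmorphD /= conjCK sqrrN rmorphXn /= conjCK.
  apply: (holomorphic_at_holc (@affine_open R) aP ach PD) => Q aQ QD.
  have [hx hy] := holc_affine ach QD aQ.
  exact: holcD hy (@holcX _ _ _ _ _ hx 2).
Qed.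

Definition torus_curve : real_elliptic_curve R :=
  @RealEllipticCurve R torus_surface (@torus_compact R) torus_surface_genus_one (@torus_conj R)
    torus_conj_antiholomorphic (@torus_conjK R).

End EllipticCurve.

(** * Multiplicities do not depend on the charts *)

Section OrderOfVanishing.
Variable R : realType.
Local Notation C := (cplx R).

Lemma dnbhs_comp (X Y : topologicalType) (phi : X -> Y) (a : X) :
  {for a, continuous phi} -> a^' [set z | phi z != phi a] ->
  phi z @[z --> a^'] --> (phi a)^'.
Proof.
move=> cphi phin A NA.
have NA' : nbhs a [set z | phi z != phi a -> A (phi z)] := cphi _ NA.
have phin' : nbhs a [set z | z != a -> phi z != phi a] := phin.
suff : nbhs a [set z | z != a -> A (phi z)] by [].
by apply: (nbhsS (nbhsI phin' NA')) => z [h1 h2] za; exact: h2 (h1 za).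
Qed.

Lemma cvgC_unique (T : Type) (F : set_system T) (FF : ProperFilter F)
    (f : T -> C) (x y : C) : f @ F --> x -> f @ F --> y -> x = y.
Proof.
exact: (@cvg_unique C (@cplx_hausdorff R) (f @ F) (fmap_proper_filter f FF)).
Qed.

Lemma cvgC_near_eq (T : Type) (F : set_system T) (FF : Filter F)
    (f g : T -> C) (x : C) :
  f @ F --> x -> F [set z | f z = g z] -> g @ F --> x.
Proof.
move=> fx fg; apply: cvg_trans fx; apply: near_eq_cvg.
by apply: filterS fg.
Qed.

Lemma dnbhsC_proper (z : C) : ProperFilter z^'.
Proof. exact: Proper_dnbhs_numFieldType. Qed.

(** If k < k', the quotient of order k is (z - a)^(k' - k) times the quotient of order k', so it
    tends to 0 instead of a nonzero limit. *)
Lemma takes_value_unique (g : C -> C) a k k' :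
  takes_value_with_order g a k -> takes_value_with_order g a k' -> k = k'.
Proof.
wlog kk' : k k' / (k < k')%N => [th h h'|].
  case: (ltngtP k k') => [kk'|kk'|//]; first exact: (th _ _ kk' h h').
  by apply/esym; exact: (th _ _ kk' h' h).
move=> [l l0 gl] [l' l'0 gl']; exfalso; move/eqP: l0; apply.
have pw : (z - a) ^+ (k' - k) @[z --> a^'] --> (a - a) ^+ (k' - k).
  apply: (@cvg_dnbhs C C (fun z => (z - a) ^+ (k' - k)) a).
  by apply: contCX; apply: contCB; [exact: contC_id|exact: contC_cst].
rewrite subrr expr0n subn_eq0 leqNgt kk' /= in pw.
have := cvgCM _ gl' pw; rewrite mulr0 => /(_ _) h0.
apply: (cvgC_unique (dnbhsC_proper a) gl).
apply: cvg_trans h0; apply: near_eq_cvg; near=> z.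
have za : z - a != 0 by rewrite subr_eq0; near: z; exact: nbhs_dnbhs_neq.
rewrite -[X in _ / _ ^+ X](subnK (ltnW kk')) exprD invfM.
by rewrite -!mulrA [_^-1 * (_^-1 * _)]mulrCA mulVf ?mulr1 // expf_neq0.
Unshelve. all: by end_near. Qed.

(** The difference quotient of a map with a differentiable local left inverse cannot vanish in the
    limit: the product of the two quotients is 1 off [a], hence also at [a]. It is applied to
    changes of charts. *)
Lemma caratheodory_neq0 (phi psi : C -> C) (a : C) :
  derivable phi a 1 -> derivable psi (phi a) 1 ->
  nbhs a [set z | psi (phi z) = z] ->
  exists2 Phi : C -> C, {for a, continuous Phi} /\ Phi a != 0 &
    forall z, phi z - phi a = Phi z * (z - a).
Proof.
move=> dphi dpsi pp; have cphi := derivable_continuousC dphi.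
have /derivable_caratheodory [Phi cPhi PhiE] := dphi.
have /derivable_caratheodory [Psi cPsi PsiE] := dpsi.
exists Phi => //; split=> //.
suff : Psi (phi a) * Phi a = 1.
  by move=> h; apply/eqP => h0; move: h; rewrite h0 mulr0 => /esym/eqP; rewrite oner_eq0.
have cP : {for a, continuous (fun z => Psi (phi z) * Phi z)}.
  apply: contCM; last exact: cPhi.
  by apply: (@continuous_comp C C C phi Psi a); [exact: cphi|exact: cPsi].
apply: (cvgC_unique (dnbhsC_proper a) (cvg_dnbhs cP)).
have ppa := nbhs_singleton pp; rewrite /= in ppa.
apply: cvg_trans (@cvgC_cst R _ (a^') _ 1); apply: near_eq_cvg; near=> z.
have za : z - a != 0 by rewrite subr_eq0; near: z; exact: nbhs_dnbhs_neq.
apply: (mulIf za); rewrite mul1r -mulrA -PhiE -PsiE ppa.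
congr (_ - _); apply/esym; near: z; exact: nbhs_dnbhs.
Unshelve. all: by end_near. Qed.

End OrderOfVanishing.

Section Multiplicity.
Variables (R : realType) (M N : riemann_surface R) (f : M -> N).
Local Notation C := (cplx R).

Lemma transition (X : riemann_surface R) (p : X) (c d : chart R X) :
  chart_at p c -> chart_at p d ->
  derivable (chart_fun d \o chart_inv c) (chart_fun c p) 1.
Proof.
move=> [ac cp] [ad dp].
by have := surface_compatible ac ad cp dp; exact: nbhs_singleton.
Qed.

Lemma transitionK (X : riemann_surface R) (p : X) (c d : chart R X) :
  chart_at p c -> chart_at p d ->
  nbhs (chart_fun c p) [set z | (chart_fun c \o chart_inv d)
    ((chart_fun d \o chart_inv c) z) = z].
Proof.
move=> [ac cp] [ad dp].
have N1 : nbhs (chart_fun c p) (chart_inv c @^-1` chart_dom d).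
  apply: (chart_inv_near cp); apply: open_nbhs_nbhs; split=> //.
  exact: chart_dom_open.
have N2 : nbhs (chart_fun c p) (chart_fun c @` chart_dom c).
  by apply: open_nbhs_nbhs; split; [exact: chart_img_open|exists p].
apply: (nbhsS (nbhsI N1 N2)) => z [Dz [q cq zE]] /=.
by move: Dz; rewrite /= -zE !(chart_invK cq) => Dq; rewrite (chart_invK Dq).
Qed.

(** Near a' one has g' = psi o g o phi with phi, psi changes of charts. Writing these with their
    difference quotients Phi, Psi, the quotient of order k for g' is Psi(g(phi z)) Phi(z)^k times
    the one for g at phi z, so the limit [l] is only multiplied by a nonzero constant. As Phi is
    nonzero at a', phi z stays away from a for z near a' distinct from it. *)
Lemma order_transfer (p : M) (c c' : chart R M) (d d' : chart R N) k :
  {for p, continuous f} -> chart_at p c -> chart_at p c' ->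
  chart_at (f p) d -> chart_at (f p) d' ->
  takes_value_with_order (local_expr f c d) (chart_fun c p) k ->
  takes_value_with_order (local_expr f c' d') (chart_fun c' p) k.
Proof.
move=> cf hc hc' hd hd' [l l0 gl].
have cp := hc.2; have cp' := hc'.2; have dp := hd.2; have dp' := hd'.2.
set a := chart_fun c p in gl; set a' := chart_fun c' p.
set g := local_expr f c d in gl; set g' := local_expr f c' d'.
pose phi := chart_fun c \o chart_inv c'.
have phia : phi a' = a by rewrite /phi /= (chart_invK cp').
have ga : g a = chart_fun d (f p) by rewrite /g /local_expr /= (chart_invK cp).
have ga' : g' a' = chart_fun d' (f p) by rewrite /g' /local_expr /= (chart_invK cp').
have dphi : derivable phi a' 1 by exact: transition hc' hc.
have dphi' : derivable (chart_fun c' \o chart_inv c) (phi a') 1.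
  by rewrite phia; exact: transition hc hc'.
have [Phi [cPhi Phi0] PhiE] := caratheodory_neq0 dphi dphi' (transitionK hc' hc).
pose psi := chart_fun d' \o chart_inv d.
have dpsi : derivable psi (g a) 1 by rewrite ga; exact: transition hd hd'.
have psia : psi (g a) = g' a' by rewrite ga ga' /psi /= (chart_invK dp).
have dpsi' : derivable (chart_fun d \o chart_inv d') (psi (g a)) 1.
  by rewrite psia ga'; exact: transition hd' hd.
have psiK := transitionK hd hd'; rewrite -ga in psiK.
have [Psi [cPsi Psi0] PsiE] := caratheodory_neq0 dpsi dpsi' psiK.
have near_eq : nbhs a' [set z | g' z = psi (g (phi z))].
  have NM : nbhs p (chart_dom c `&` f @^-1` chart_dom d).
    apply: nbhsI; first by apply: open_nbhs_nbhs; split; [exact: chart_dom_open|].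
    by apply: cf; apply: open_nbhs_nbhs; split; [exact: chart_dom_open|].
  apply: (nbhsS (chart_inv_near cp' NM)) => z [zc zd] /=.
  by rewrite /g' /psi /g /phi /local_expr /= (chart_invK zc) (chart_invK zd).
have cphi := derivable_continuousC dphi.
have cg : {for a, continuous g}.
  apply: (@continuous_comp C M C (chart_inv c) (chart_fun d \o f)).
    exact: (chart_inv_cont cp).
  rewrite (chart_invK cp).
  apply: (@continuous_comp M N C f (chart_fun d)); first exact: cf.
  by apply: chart_fun_continuous; rewrite inE.
have phin : a'^' [set z | phi z != phi a'].
  have NPhi : nbhs a' [set z | Phi z != 0].
    exact: (@cvgr_neq0 _ C _ _ (nbhs_filter a') Phi _ cPhi Phi0).
  apply: (nbhsS NPhi) => z Pz za.
  by rewrite /= -subr_eq0 PhiE mulf_neq0 // subr_eq0.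
have phicvg := dnbhs_comp cphi phin; rewrite phia in phicvg.
have gl' : (g (phi z) - g a) / (phi z - a) ^+ k @[z --> a'^'] --> l.
  exact: (@cvg_comp C C C phi (fun w => (g w - g a) / (w - a) ^+ k) _ _ _ phicvg gl).
have cgphi : {for a', continuous (Psi \o (g \o phi))}.
  apply: (@continuous_comp C C C (g \o phi) Psi).
    by apply: (@continuous_comp C C C phi g); [exact: cphi|rewrite phia; exact: cg].
  by rewrite /= phia; exact: cPsi.
exists (Psi (g a) * l * Phi a' ^+ k); first by rewrite !mulf_neq0 // expf_neq0.
have := cvg_dnbhs cgphi; rewrite /= phia => cvg1.
have FF : Filter a'^' by exact: dnbhs_filter.
have cvg2 := cvgCM FF (cvgCM FF cvg1 gl')
  (@cvgCX R C a'^' FF Phi (Phi a') k (cvg_dnbhs cPhi)).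
apply: (cvgC_near_eq FF cvg2).
have NPhi : nbhs a' [set z | Phi z != 0].
  exact: (@cvgr_neq0 _ C _ _ (nbhs_filter a') Phi _ cPhi Phi0).
apply: (nbhsS (nbhsI near_eq NPhi)) => z [zE Pz] za.
have {}zE : g' z = psi (g (phi z)) := zE; have {}Pz : Phi z != 0 := Pz.
have za0 : z - a' != 0 by rewrite subr_eq0.
change (Psi (g (phi z)) * ((g (phi z) - g a) / (phi z - a) ^+ k) * Phi z ^+ k =
  (g' z - g' a') / (z - a') ^+ k).
rewrite zE -psia PsiE -{2}phia PhiE.
by rewrite exprMn; field; rewrite !expf_neq0.
Qed.

(** [get] returns an order realised in some pair of charts, possibly other than [c] and [d];
    transfer to these and uniqueness identify it with [k]. *)
Lemma multiplicity_eq (p : M) (c : chart R M) (d : chart R N) k :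
  {for p, continuous f} -> chart_at p c -> chart_at (f p) d ->
  takes_value_with_order (local_expr f c d) (chart_fun c p) k ->
  multiplicity f p = k.
Proof.
move=> cf hc hd hk; rewrite /multiplicity.
set S := [set k | _].
have Sk : S k by exists c, d.
have [c' [d' [hc' hd' hk']]] : S (get S) by exact: (getI Sk).
apply: (takes_value_unique hk').
exact: order_transfer hk.
Qed.

End Multiplicity.

(** * The function of degree three *)

Section CubicCoordinates.
Variable R : realType.
Local Notation C := (cplx R).
Local Notation c := (@cplx_of_real R).
Local Notation T := (torus R).
Local Notation r := (c (rho R)).
Local Notation kp := (c (kap R)).

Lemma cr_neq0 : r != 0.
Proof. by rewrite cR_eq0 gt_eqF // rho_gt0. Qed.

Lemma cr4 : r ^+ 4 = 33.
Proof. by rewrite -cRX (exprM _ 2 2) rhoK rho2K cRn. Qed.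

Lemma cr_kap : r ^+ 2 * kp = 25 / 9.
Proof.
rewrite -cRX -cRM rhoK.
have -> : rho2 R * kap R = 25 / 9 by have := kapK R; lra.
by rewrite cRM cRV !cRn.
Qed.

Lemma natC_neq0 n : n.+1%:R != 0 :> C. Proof. by rewrite pnatr_eq0. Qed.

Definition cubic (m : C) : C := 12 * m ^+ 3 + m ^+ 2 - 60 * m + 36.
(* The curve is also the cubic [y^2 = 12 m^3 + m^2 - 60 m + 36], whose right-hand
   side is [(3 m - 2) (4 m^2 + 3 m - 18)], with [y = z (3 m - 2)]. One of the two
   infinite points of the quartic is the point [(2/3, 0)] of the cubic, the other
   one is its point at infinity. *)
Definition cubic_mA (P : T) : C := (3 * r ^+ 2 * mT P - 3) / 8.
Definition cubic_yA (P : T) : C := r * xT P * (3 * cubic_mA P - 2).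
Definition cubic_m (P : T) : C := if affine P then cubic_mA P else 2 / 3.
Definition cubic_y (P : T) : C := if affine P then cubic_yA P else 0.
(** Of the two infinite points of the quartic, the one with [yj] equal to 1 is the point A at
    infinity of the cubic; the one with -1 is (2/3, 0), which is finite there. *)
Definition finite_pt (P : T) : bool := affine P || (yj P != 1).

Lemma cubic_mA_sub P : 3 * cubic_mA P - 2 = 9 * r ^+ 2 * (mT P - kp) / 8.
Proof.
have -> : 9 * r ^+ 2 * (mT P - kp) / 8 = (9 * r ^+ 2 * mT P - 9 * (r ^+ 2 * kp)) / 8.
  by rewrite mulrBr mulrA.
rewrite cr_kap /cubic_mA; field.
by rewrite ?natC_neq0.
Qed.

Lemma cubic_mA_neq (P : T) : affine P -> 3 * cubic_mA P - 2 != 0.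
Proof.
move=> aP; rewrite cubic_mA_sub !mulf_neq0 ?invr_neq0 ?natC_neq0 ?expf_neq0 ?cr_neq0 //.
exact: mT_neq_kap.
Qed.

Lemma cubicA (P : T) : affine P -> cubic_yA P ^+ 2 = cubic (cubic_mA P).
Proof.
move=> aP; have h := mT_rel aP; have h4 := cr4; have hk := cr_kap.
rewrite /cubic /cubic_yA /cubic_mA; move: (mT P) (xT P) h => M x h.
have hx : 2 * (M - kp) * x ^+ 2 = M ^+ 2 - 1 by rewrite h.
have n8 : 8 != 0 :> C := natC_neq0 7.
have E : 3 * ((3 * r ^+ 2 * M - 3) / 8) - 2 = 9 * r ^+ 2 * (M - kp) / 8.
  have -> : 9 * r ^+ 2 * (M - kp) / 8 = (9 * r ^+ 2 * M - 9 * (r ^+ 2 * kp)) / 8.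
    by rewrite mulrBr mulrA.
  by rewrite hk; field.
have -> : (r * x * (3 * ((3 * r ^+ 2 * M - 3) / 8) - 2)) ^+ 2 =
  (3 * ((3 * r ^+ 2 * M - 3) / 8) - 2) * (r ^+ 4 * (9 / 16) * (2 * (M - kp) * x ^+ 2)).
  by rewrite {1}expr2 mulrACA -expr2 {2}E; field.
rewrite hx; move: r h4 => s h4.
by field: h4.
Qed.

Lemma cubic_eq P : finite_pt P -> cubic_y P ^+ 2 = cubic (cubic_m P).
Proof.
rewrite /cubic_y /cubic_m; case: ifP => aP _; first exact: cubicA.
by rewrite /cubic; field.
Qed.

Lemma not_affine_xj (P : T) : ~~ affine P -> [/\ affine (torus_inv P), xj P = 0 & yj P = 1 \/ yj P = -1].
Proof.
move=> /not_affine [h1 h2 h3]; split=> //.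
by move/eqP: h3; rewrite sqrf_eq1 => /orP[] /eqP; [left|right].
Qed.

Lemma inv_inj (P P' : T) : affine (torus_inv P) -> affine (torus_inv P') -> xj P = xj P' ->
  yj P = yj P' -> P = P'.
Proof.
move=> a a' hx hy; rewrite -[P]torus_invK -[P']torus_invK; congr torus_inv.
exact: xy_inj.
Qed.

Lemma cubic_m_inj P P' : finite_pt P -> finite_pt P' -> cubic_m P = cubic_m P' -> cubic_y P = cubic_y P' -> P = P'.
Proof.
have E : 3 * (2 / 3) - 2 = 0 :> C by field.
rewrite /cubic_m /cubic_y /finite_pt; case: ifP => aP; case: ifP => aP' //=.
- move=> _ _ hm hy; apply/esym; apply: xy_inj => //.
    move: hy; rewrite /cubic_yA hm => /(mulIf (cubic_mA_neq aP')).
    by move=> /(mulfI cr_neq0).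
  have xE : xT P = xT P'.
    by move: hy; rewrite /cubic_yA hm => /(mulIf (cubic_mA_neq aP')) /(mulfI cr_neq0).
  have mE : mT P = mT P'.
    move: hm; rewrite /cubic_mA => /(mulIf _) -/(_ _).
    have n8 : 8^-1 != 0 :> C by rewrite invr_neq0 // natC_neq0.
    move=> /(_ n8) /addIr /mulfI -> //.
    by rewrite mulf_neq0 ?natC_neq0 // expf_neq0 // cr_neq0.
  by move: mE; rewrite /mT xE => /addIr.
- by move=> _ _ hm; have := cubic_mA_neq aP; rewrite hm E eqxx.
- by move=> _ _ hm; have := cubic_mA_neq aP'; rewrite -hm E eqxx.
- move=> y1 y1' _ _.
  have [a x0 [y|y]] := not_affine_xj (negbT aP); first by rewrite y eqxx in y1.
  have [a' x0' [y'|y']] := not_affine_xj (negbT aP'); first by rewrite y' eqxx in y1'.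
  by apply: inv_inj; rewrite ?x0 ?x0' ?y ?y'.
Qed.

Lemma quartic0 (e : C) : e ^+ 2 = 1 -> e ^+ 2 = quartic (0 : C).
Proof. by move=> ->; rewrite /quartic; ring. Qed.

Definition infinity_pt (e : C) : T := torus_inv (curve_pt 0 e).

Lemma infinity_ptP (e : C) : e ^+ 2 = 1 ->
  [/\ ~~ affine (infinity_pt e), affine (torus_inv (infinity_pt e)), xj (infinity_pt e) = 0 & yj (infinity_pt e) = e].
Proof.
move=> e1; have [a x0 y0] := curve_ptP (quartic0 e1).
rewrite /xj /yj /infinity_pt torus_invK; split=> //.
apply/negP => a'; have := xT_inv a; rewrite -/(infinity_pt e) => /(_ a').
by rewrite x0 mul0r => /esym/eqP; rewrite oner_eq0.
Qed.

Lemma cubic_m_surj m y : y ^+ 2 = cubic m -> exists P, [/\ finite_pt P, cubic_m P = m & cubic_y P = y].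
Proof.
move=> ym; have n3 : 3 != 0 :> C := natC_neq0 2.
have [m0|m0] := eqVneq (3 * m - 2) 0.
  have mE : m = 2 / 3.
    have -> : m = (3 * m - 2) / 3 + 2 / 3 by field.
    by rewrite m0 mul0r add0r.
  have y0 : y = 0.
    by apply/eqP; rewrite -sqrf_eq0 ym mE; apply/eqP; rewrite /cubic; field.
  have [h1 h2 h3 h4] := @infinity_ptP (-1) ltac:(by rewrite sqrrN expr1n).
  exists (infinity_pt (-1)); rewrite /finite_pt /cubic_m /cubic_y (negbTE h1) h4 y0; split=> //=.
  by rewrite eq_sym -subr_eq0 opprK; exact: (natC_neq0 1).
(* The inverse of [cubic_mA] and [cubic_yA]: r x = z = y / (3 m - 2) and 3 r^2 M = 8 m + 3, where M
   = y + x^2 on the quartic. *)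
pose x := y / (3 * m - 2) / r; pose M := (8 * m + 3) / (3 * r ^+ 2).
have r0 := cr_neq0.
have hx : x ^+ 2 * (3 * m - 2) * r ^+ 2 = 4 * m ^+ 2 + 3 * m - 18.
  have -> : x ^+ 2 * (3 * m - 2) * r ^+ 2 = y ^+ 2 / (3 * m - 2).
    by rewrite /x; field; rewrite r0 m0.
  by rewrite ym; apply: (mulIf m0); rewrite divfK // /cubic; ring.
have hM : 3 * r ^+ 2 * M = 8 * m + 3.
  by rewrite /M mulrC divfK // mulf_neq0 ?natC_neq0 // expf_neq0.
have curve : (M - x ^+ 2) ^+ 2 = quartic x.
  have : 9 * r ^+ 4 * ((M - x ^+ 2) ^+ 2 - quartic x) = 0.
    have -> : 9 * r ^+ 4 * ((M - x ^+ 2) ^+ 2 - quartic x) =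
      (3 * r ^+ 2 * M) ^+ 2 - 6 * (r ^+ 2 * x ^+ 2) * (3 * r ^+ 2 * M)
      + 18 * (r ^+ 2 * kp) * (r ^+ 2 * x ^+ 2) - 9 * r ^+ 4.
      by rewrite /quartic; ring.
    rewrite hM cr_kap cr4.
    transitivity ((8 * m + 3) ^+ 2 - 297 - 16 * (x ^+ 2 * (3 * m - 2) * r ^+ 2)).
      by field.
    by rewrite hx; ring.
  move=> /eqP; rewrite mulf_eq0 mulf_eq0 expf_eq0 (negbTE r0) andbF orbF.
  by rewrite (negbTE (natC_neq0 8)) /= subr_eq0 => /eqP.
have [a xE yE] := curve_ptP curve; exists (curve_pt x (M - x ^+ 2)).
have mE : cubic_mA (curve_pt x (M - x ^+ 2)) = m.
  rewrite /cubic_mA /mT xE yE subrK hM.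
  by field.
split; rewrite /finite_pt /cubic_m /cubic_y ?a //.
by rewrite /cubic_yA mE xE /x; field; rewrite r0 m0.
Qed.

End CubicCoordinates.

(** * Maps to the sphere given by quotients of holomorphic functions *)

Section Ratio.
Variable R : realType.
Local Notation C := (cplx R).
Local Notation T := (torus R).
Local Notation sphere := (riemann_sphere R).

(** The point of the projective line with homogeneous coordinates [n : d], meaningful when they are
    not both 0. *)
Definition ratio (n d : C) : sphere := if d == 0 then None else Some (n / d).

Lemma ratio_coord0 n d : d != 0 -> sphere_coord0 (ratio n d) = n / d.
Proof. by rewrite /ratio => /negbTE ->. Qed.

Lemma ratio_coord1 n d : n != 0 -> sphere_coord1 (ratio n d) = d / n.
Proof.
move=> n0; rewrite /ratio; have [->|d0] := eqVneq d 0; first by rewrite mul0r.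
by rewrite /= invf_div.
Qed.

Lemma ratio_inv1 n d : n != 0 -> ratio n d = sphere_inv1 (d / n).
Proof.
move=> n0; rewrite /ratio /sphere_inv1 mulf_eq0 invr_eq0 (negbTE n0) orbF.
by case: eqP => // d0; rewrite invf_div.
Qed.

Lemma holc_continuous ch P (g : T -> C) : chart_dom ch P -> holc ch P g ->
  {for P, continuous g}.
Proof.
move=> PD /derivable_continuousC h A Ag.
have hA : nbhs (chart_fun ch P) ((g \o chart_inv ch) @^-1` A).
  by apply: h; rewrite /= (chart_invK PD).
have cf : {for P, continuous (chart_fun ch)}.
  by apply: chart_fun_continuous; rewrite inE.
have N : nbhs P (chart_dom ch).
  by apply: open_nbhs_nbhs; split=> //; exact: chart_dom_open.
have N2 : nbhs P (chart_fun ch @^-1` ((g \o chart_inv ch) @^-1` A)) := cf _ hA.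
suff : nbhs P [set Q | A (g Q)] by [].
apply: (nbhsS (nbhsI N N2)) => Q [QD].
by rewrite /= (chart_invK QD).
Qed.

Definition hol (P : T) (g : T -> C) : Prop :=
  forall ch, torus_atlas ch -> chart_dom ch P -> holc ch P g.

Lemma hol_continuous P g : hol P g -> {for P, continuous g}.
Proof.
move=> hg; have [ch ach PD] := torus_atlas_covered P.
exact: holc_continuous PD (hg _ ach PD).
Qed.

Lemma open_neq0 (W : set T) (g : T -> C) : open W ->
  (forall Q, W Q -> hol Q g) -> open (W `&` [set Q | g Q != 0]).
Proof.
move=> oW hg; rewrite openE => Q [WQ gQ]; apply: nbhsI.
  exact: open_nbhs_nbhs.
exact: (@cvgr_neq0 _ C _ _ (nbhs_filter Q) g _ (hol_continuous (hg _ WQ)) gQ).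
Qed.

Variables (f : T -> sphere) (W : set T) (n d : T -> C).
Hypotheses (oW : open W) (hn : forall Q, W Q -> hol Q n)
  (hd : forall Q, W Q -> hol Q d)
  (nd : forall Q, W Q -> (n Q != 0) || (d Q != 0))
  (fE : forall Q, W Q -> f Q = ratio (n Q) (d Q)).

Lemma ratio_continuous P : W P -> {for P, continuous f}.
Proof.
move=> WP; have NW : nbhs P W by exact: open_nbhs_nbhs.
have cn := hol_continuous (hn WP); have cd := hol_continuous (hd WP).
case/orP: (nd WP) => [n0|d0].
  have h : {for P, continuous (fun Q => sphere_inv1 (d Q / n Q) : sphere)}.
    apply: (@continuous_comp T C sphere (fun Q => d Q / n Q) (@sphere_inv1 R)).
      by apply: contCM; [exact: cd|apply: contCV; [exact: cn|exact: n0]].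
    by apply: sphere_inv1_continuous; rewrite sphere_coord1_img in_setT.
  move=> A; rewrite (fE WP) (ratio_inv1 _ n0) => /h hA.
  suff : nbhs P [set Q | A (f Q)] by [].
  have Nn : nbhs P [set Q | n Q != 0].
    exact: (@cvgr_neq0 _ C _ _ (nbhs_filter P) n _ cn n0).
  apply: (nbhsS (nbhsI NW (nbhsI Nn hA))) => Q [WQ [nQ]] /=.
  by rewrite (fE WQ) (ratio_inv1 _ nQ).
have h : {for P, continuous (fun Q => sphere_inv0 (n Q / d Q) : sphere)}.
  apply: (@continuous_comp T C sphere (fun Q => n Q / d Q) (@sphere_inv0 R)).
    by apply: contCM; [exact: cn|apply: contCV; [exact: cd|exact: d0]].
  by apply: sphere_inv0_continuous; rewrite sphere_coord0_img in_setT.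
move=> A; rewrite (fE WP) /ratio (negbTE d0) => /h hA.
suff : nbhs P [set Q | A (f Q)] by [].
have Nd : nbhs P [set Q | d Q != 0].
  exact: (@cvgr_neq0 _ C _ _ (nbhs_filter P) d _ cd d0).
apply: (nbhsS (nbhsI NW (nbhsI Nd hA))) => Q [WQ [dQ]] /=.
by rewrite (fE WQ) /ratio (negbTE dQ).
Qed.

Lemma ratio_holomorphic P ch (e : chart R sphere) : W P ->
  torus_atlas ch -> chart_dom ch P -> chart_at (f P) e ->
  holomorphic_at (chart_fun e \o f \o chart_inv ch) (chart_fun ch P).
Proof.
move=> WP ach PD [[->|->] /=].
  rewrite /sphere_coord0_dom /= (fE WP) /ratio; case: ifP => // d0 _.
  apply: (holomorphic_at_holc (open_neq0 oW hd) _ ach PD).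
    by split=> //=; rewrite d0.
  move=> Q [WQ dQ] QD.
  have h := holcM (hn WQ ach QD) (holcV QD (hd WQ ach QD) dQ).
  apply: (holc_eq QD _ h).
  have N : nbhs Q (W `&` [set Q | d Q != 0]).
    by apply: open_nbhs_nbhs; split=> //; exact: open_neq0.
  by apply: (nbhsS N) => S [WS dS] /=; rewrite (fE WS) ratio_coord0.
rewrite /sphere_coord1_dom /= => fP0.
have n0 : n P != 0.
  apply/eqP => n0; apply: fP0; rewrite (fE WP) /ratio n0 mul0r.
  by have := nd WP; rewrite n0 eqxx /= => /negbTE ->.
apply: (holomorphic_at_holc (open_neq0 oW hn) _ ach PD) => // Q [WQ nQ] QD.
have h := holcM (hd WQ ach QD) (holcV QD (hn WQ ach QD) nQ).
apply: (holc_eq QD _ h).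
have N : nbhs Q (W `&` [set Q | n Q != 0]).
  by apply: open_nbhs_nbhs; split=> //; exact: open_neq0.
by apply: (nbhsS N) => S [WS nS] /=; rewrite (fE WS) ratio_coord1.
Qed.

End Ratio.

Section HolAlgebra.
Variables (R : realType) (P : torus R).
Local Notation C := (cplx R).
Local Notation T := (torus R).

Lemma hol_cst (a : C) : hol P (fun=> a).
Proof. by move=> ch _ _; exact: holc_cst. Qed.

Variables (g h : T -> C).
Hypotheses (hg : hol P g) (hh : hol P h).

Lemma holD : hol P (fun Q => g Q + h Q).
Proof. by move=> ch ach PD; exact: holcD (hg ach PD) (hh ach PD). Qed.
Lemma holB : hol P (fun Q => g Q - h Q).
Proof. by move=> ch ach PD; exact: holcB (hg ach PD) (hh ach PD). Qed.
Lemma holM : hol P (fun Q => g Q * h Q).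
Proof. by move=> ch ach PD; exact: holcM (hg ach PD) (hh ach PD). Qed.
Lemma holX n : hol P (fun Q => g Q ^+ n).
Proof. by move=> ch ach PD; exact: (@holcX _ _ _ _ _ (hg ach PD) n). Qed.
End HolAlgebra.

Section TheFunction.
Variable R : realType.
Local Notation C := (cplx R).
Local Notation c := (@cplx_of_real R).
Local Notation T := (torus R).
Local Notation sphere := (riemann_sphere R).
Local Notation r := (c (rho R)).
Local Notation kp := (c (kap R)).

(* [f = 6 m + (6 + y) / m]; at [m = 0], [y = -6] the quotient is
   [(12 m^2 + m - 60) / (y - 6)], which gives [5]. *)
Definition trigonal (P : T) : sphere :=
  if finite_pt P then
    if cubic_m P != 0 then Some (6 * cubic_m P + (6 + cubic_y P) / cubic_m P)
    else if cubic_y P == -6 then Some 5 else None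
  else None.

(* Four expressions of [f] as a quotient of holomorphic functions, without common
   zero respectively at the finite points other than [(0, -6)], at [(0, -6)], at
   infinity and at [(2/3, 0)]. *)
Definition N1 (P : T) : C := 6 * cubic_mA P ^+ 2 + 6 + cubic_yA P.
Definition D1 (P : T) : C := cubic_mA P.
Definition N2 (P : T) : C :=
  6 * cubic_mA P * (cubic_yA P - 6) + 12 * cubic_mA P ^+ 2 + cubic_mA P - 60.
Definition D2 (P : T) : C := cubic_yA P - 6.
Definition N3 (P : T) : C := (3 * r + 11 * xj P) * (3 * r ^+ 2) * (yj P + 1) +
  27 * r * xj P ^+ 2 - 21 * xj P ^+ 3.
Definition D3 (P : T) : C := 4 * xj P ^+ 2 * (r + 3 * xj P).
Definition N4 (P : T) : C := (3 * r + 11 * xj P) * (3 * r ^+ 2) *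
  (xj P ^+ 2 - 2 * kp) + (27 * r - 21 * xj P) * (yj P - 1).
Definition D4 (P : T) : C := 4 * (r + 3 * xj P) * (yj P - 1).
(** This is xj^2 (z^2 - 9) with z = r / xj. Points with m = 0 have z^2 = 9, so where [E3] is nonzero
    one may divide by m. *)
Definition E3 (P : T) : C := r ^+ 2 - 9 * xj P ^+ 2.

Lemma hol_xT (P : T) : affine P -> hol P (@xT R).
Proof. by move=> aP ch ach PD; exact: (holc_affine ach PD aP).1. Qed.
Lemma hol_yT (P : T) : affine P -> hol P (@yT R).
Proof. by move=> aP ch ach PD; exact: (holc_affine ach PD aP).2. Qed.
Lemma hol_xj (P : T) : affine (torus_inv P) -> hol P (@xj R).
Proof. by move=> aP ch ach PD; exact: (holc_infinity ach PD aP).1. Qed.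
Lemma hol_yj (P : T) : affine (torus_inv P) -> hol P (@yj R).
Proof. by move=> aP ch ach PD; exact: (holc_infinity ach PD aP).2. Qed.

Lemma hol_cmA (P : T) : affine P -> hol P (@cubic_mA R).
Proof.
move=> aP; have hx := hol_xT aP; have hy := hol_yT aP.
change (hol P (fun P => (3 * r ^+ 2 * (yT P + xT P ^+ 2) - 3) * 8^-1)).
apply: holM; last exact: hol_cst.
apply: holB; last exact: hol_cst.
apply: holM; first exact: hol_cst.
by apply: holD; [exact: hy|apply: holX; exact: hx].
Qed.

Lemma hol_cyA (P : T) : affine P -> hol P (@cubic_yA R).
Proof.
move=> aP; have hx := hol_xT aP; have hm := hol_cmA aP.
change (hol P (fun P => r * xT P * (3 * cubic_mA P - 2))).
apply: holM; first by apply: holM; [exact: hol_cst|exact: hx].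
by apply: holB; [apply: holM; [exact: hol_cst|exact: hm]|exact: hol_cst].
Qed.

Lemma hol_N1 (P : T) : affine P -> hol P N1.
Proof.
move=> aP; have hm := hol_cmA aP; have hy := hol_cyA aP.
change (hol P (fun P => 6 * cubic_mA P ^+ 2 + 6 + cubic_yA P)).
apply: holD; last exact: hy.
apply: holD; last exact: hol_cst.
by apply: holM; [exact: hol_cst|apply: holX; exact: hm].
Qed.

Lemma hol_D2 (P : T) : affine P -> hol P D2.
Proof.
move=> aP; have hy := hol_cyA aP.
by change (hol P (fun P => cubic_yA P - 6)); apply: holB; [exact: hy|exact: hol_cst].
Qed.

Lemma hol_N2 (P : T) : affine P -> hol P N2.
Proof.
move=> aP; have hm := hol_cmA aP; have hd := hol_D2 aP.
change (hol P (fun P => 6 * cubic_mA P * D2 P + 12 * cubic_mA P ^+ 2 + cubic_mA P - 60)).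
apply: holB; last exact: hol_cst.
apply: holD; last exact: hm.
apply: holD.
  by apply: holM; [apply: holM; [exact: hol_cst|exact: hm]|exact: hd].
by apply: holM; [exact: hol_cst|apply: holX; exact: hm].
Qed.

Section AtInfinity.
Variable P : T.
Hypothesis aP : affine (torus_inv P).
Let hx := hol_xj aP.
Let hy := hol_yj aP.

Let hlin (a b : C) : hol P (fun P => a + b * xj P).
Proof.
by apply: holD; [exact: hol_cst|apply: holM; [exact: hol_cst|exact: hx]].
Qed.

Lemma hol_N3 : hol P N3.
Proof.
change (hol P (fun P => (3 * r + 11 * xj P) * (3 * r ^+ 2) * (yj P + 1) +
  27 * r * xj P ^+ 2 - 21 * xj P ^+ 3)).
apply: holB; last by apply: holM; [exact: hol_cst|apply: holX; exact: hx].
apply: holD; last by apply: holM; [exact: hol_cst|apply: holX; exact: hx].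
apply: holM; last by apply: holD; [exact: hy|exact: hol_cst].
by apply: holM; [exact: hlin|exact: hol_cst].
Qed.

Lemma hol_D3 : hol P D3.
Proof.
change (hol P (fun P => 4 * xj P ^+ 2 * (r + 3 * xj P))).
apply: holM; last exact: hlin.
by apply: holM; [exact: hol_cst|apply: holX; exact: hx].
Qed.

Lemma hol_N4 : hol P N4.
Proof.
change (hol P (fun P => (3 * r + 11 * xj P) * (3 * r ^+ 2) *
  (xj P ^+ 2 - 2 * kp) + (27 * r - 21 * xj P) * (yj P - 1))).
apply: holD.
  apply: holM.
    by apply: holM; [exact: hlin|exact: hol_cst].
  by apply: holB; [apply: holX; exact: hx|exact: hol_cst].
apply: holM; last by apply: holB; [exact: hy|exact: hol_cst].
by apply: holB; [exact: hol_cst|apply: holM; [exact: hol_cst|exact: hx]].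
Qed.

Lemma hol_D4 : hol P D4.
Proof.
change (hol P (fun P => 4 * (r + 3 * xj P) * (yj P - 1))).
apply: holM; last by apply: holB; [exact: hy|exact: hol_cst].
by apply: holM; [exact: hol_cst|exact: hlin].
Qed.

Lemma hol_E3 : hol P E3.
Proof.
change (hol P (fun P => r ^+ 2 - 9 * xj P ^+ 2)).
apply: holB; first exact: hol_cst.
by apply: holM; [exact: hol_cst|apply: holX; exact: hx].
Qed.
End AtInfinity.

End TheFunction.

(** * Holomorphy of the trigonal function *)

Section Holomorphy.
Variable R : realType.
Local Notation C := (cplx R).
Local Notation c := (@cplx_of_real R).
Local Notation T := (torus R).
Local Notation sphere := (riemann_sphere R).
Local Notation r := (c (rho R)).
Local Notation kp := (c (kap R)).

Lemma divC_eq (a b d e : C) : b != 0 -> e != 0 -> a * e = d * b -> a / b = d / e.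
Proof. by move=> b0 e0 h; apply/eqP; rewrite eqr_div // h. Qed.

Definition fval (P : T) : C := (6 * cubic_m P ^+ 2 + 6 + cubic_y P) / cubic_m P.

Lemma trigonal_some (P : T) : finite_pt P -> cubic_m P != 0 -> trigonal P = Some (fval P).
Proof.
move=> fP m0; rewrite /trigonal fP m0 /fval; congr Some.
by field; rewrite m0.
Qed.

Lemma N1_rep (P : T) : affine P -> (N1 P != 0) || (D1 P != 0) ->
  trigonal P = ratio (N1 P) (D1 P).
Proof.
move=> aP h; have fP : finite_pt P by rewrite /finite_pt aP.
have mE : cubic_m P = cubic_mA P by rewrite /cubic_m aP.
have yE : cubic_y P = cubic_yA P by rewrite /cubic_y aP.
rewrite /ratio /D1 -mE; have [m0|m0] := eqVneq (cubic_m P) 0; last first.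
  by rewrite trigonal_some // /fval /N1 mE yE.
rewrite /trigonal fP m0 eqxx /=; case: eqP => // y6.
by move: h; rewrite /D1 -mE m0 eqxx orbF /N1 -mE -yE m0 y6 expr0n mulr0 add0r addrN eqxx.
Qed.

Lemma N2_rep (P : T) : affine P -> D2 P != 0 -> trigonal P = ratio (N2 P) (D2 P).
Proof.
move=> aP h; have fP : finite_pt P by rewrite /finite_pt aP.
have mE : cubic_m P = cubic_mA P by rewrite /cubic_m aP.
have yE : cubic_y P = cubic_yA P by rewrite /cubic_y aP.
have hc := cubicA aP.
rewrite /ratio (negbTE h); have [m0|m0] := eqVneq (cubic_m P) 0; last first.
  rewrite trigonal_some //; congr Some; rewrite /fval mE yE.
  apply: divC_eq => //; first by rewrite -mE.
  rewrite /D2 /N2; move: hc; rewrite /cubic.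
  by move: (cubic_yA P) (cubic_mA P) => y m hc; ring: hc.
have : cubic_yA P ^+ 2 = 6 ^+ 2.
  by rewrite hc /cubic -mE m0; ring.
move=> /eqP; rewrite eqf_sqr => /orP[] /eqP y6.
  by move: h; rewrite /D2 y6 subrr eqxx.
rewrite /trigonal fP m0 yE y6 !eqxx /=; congr Some.
by rewrite /N2 /D2 -mE m0 y6; field.
Qed.

Lemma curve_inf (P : T) : affine (torus_inv P) ->
  yj P ^+ 2 = 1 - 2 * kp * xj P ^+ 2 + xj P ^+ 4.
Proof.
move=> /curve_eq; rewrite /quartic => ->.
by rewrite -/(xj P); ring.
Qed.

(** This trades the denominator m of f for 4 (z + 3). With z = r / xj and v = 3 r^2 yj / xj^2,
    clearing xj^3 turns the new fraction into [N3] over [D3]. The two sides differ by a multiple of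
    the quadratic equation satisfied by m over z, whose discriminant is v^2. *)
Lemma id_zv (z v m : C) : v ^+ 2 = 9 * z ^+ 4 - 50 * z ^+ 2 + 297 ->
  8 * m = v + 3 * z ^+ 2 - 3 ->
  (6 * m ^+ 2 + 6 + z * (3 * m - 2)) * (4 * (z + 3)) =
  m * ((3 * z + 11) * (v + 3 * z ^+ 2) + 27 * z - 21).
Proof.
move=> hv hm.
have vE : v = 8 * m - 3 * z ^+ 2 + 3 by rewrite hm; ring.
have : (8 * m - 3 * z ^+ 2 + 3) ^+ 2 = 9 * z ^+ 4 - 50 * z ^+ 2 + 297 by rewrite -vE.
move=> h; rewrite vE.
apply/eqP; rewrite -subr_eq0; apply/eqP.
apply: (mulfI (natC_neq0 R 3)).
transitivity (- ((8 * m - 3 * z ^+ 2 + 3) ^+ 2 - (9 * z ^+ 4 - 50 * z ^+ 2 + 297))).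
  by ring.
by rewrite h; ring.
Qed.

Section InfinityCoordinates.
Variable P : T.
Hypotheses (aP : affine P) (aP' : affine (torus_inv P)).

Let X0 : xj P != 0. Proof. exact: (xT_E aP aP').1. Qed.
Let z := r / xj P.
Let v := 3 * r ^+ 2 * yj P / xj P ^+ 2.

Lemma inf_m : 8 * cubic_mA P = v + 3 * z ^+ 2 - 3.
Proof.
rewrite /cubic_mA /mT (yT_E aP aP') (xT_E aP aP').2 /v /z.
by move: (xj P) (yj P) X0 => X Y X0'; field; rewrite X0'.
Qed.

Lemma inf_v : v ^+ 2 = 9 * z ^+ 4 - 50 * z ^+ 2 + 297.
Proof.
have hY := curve_inf aP'; have h4 := cr4 R; have hk := cr_kap R.
have -> : v ^+ 2 = 9 * r ^+ 4 * yj P ^+ 2 / xj P ^+ 4.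
  by rewrite /v; move: (xj P) X0 => X X0'; field.
rewrite hY /z.
have -> : 9 * r ^+ 4 * (1 - 2 * kp * xj P ^+ 2 + xj P ^+ 4) / xj P ^+ 4 =
  9 * r ^+ 4 / xj P ^+ 4 - 18 * (r ^+ 2 * kp) * r ^+ 2 / xj P ^+ 2 + 9 * r ^+ 4.
  by move: (xj P) X0 => X X0'; field.
rewrite hk.
have -> : 9 * r ^+ 4 / xj P ^+ 4 = 9 * (r / xj P) ^+ 4.
  by move: (xj P) X0 => X X0'; field.
rewrite h4; move: (xj P) X0 => X X0'.
by field.
Qed.

Lemma inf_y : cubic_yA P = z * (3 * cubic_mA P - 2).
Proof. by rewrite /cubic_yA (xT_E aP aP').2. Qed.

Lemma inf_N1 : N1 P * D3 P = cubic_mA P * N3 P.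
Proof.
have := id_zv inf_v inf_m; rewrite /N1 inf_y /N3 /D3 => h.
have -> : 4 * xj P ^+ 2 * (r + 3 * xj P) = xj P ^+ 3 * (4 * (z + 3)).
  by rewrite /z; move: (xj P) X0 => X X0'; field.
rewrite mulrCA h mulrCA; congr (_ * _).
by rewrite /v /z; move: (xj P) X0 => X X0'; field.
Qed.

Lemma inf_m_neq0 : E3 P != 0 -> cubic_mA P != 0.
Proof.
apply: contra_neq => m0; have h := inf_m; have h2 := inf_v.
have vE : v = 3 - 3 * z ^+ 2.
  rewrite m0 mulr0 in h; apply/eqP; rewrite -subr_eq0; apply/eqP.
  by rewrite [RHS]h; ring.
have zE : z ^+ 2 = 9.
  (* The two expressions of v^2 differ by 32 (z^2 - 9). *)
  apply: (mulfI (natC_neq0 R 31)); apply/eqP; rewrite -subr_eq0; apply/eqP.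
  transitivity ((3 - 3 * z ^+ 2) ^+ 2 - (9 * z ^+ 4 - 50 * z ^+ 2 + 297)).
    by ring.
  by rewrite -vE h2 subrr.
have -> : E3 P = xj P ^+ 2 * (z ^+ 2 - 9).
  by rewrite /E3 /z; move: (xj P) X0 => X X0'; field.
by rewrite zE subrr mulr0.
Qed.
End InfinityCoordinates.

(** [N3] and [D3] vanish together at (2/3, 0). Multiplying both by yj - 1 and using yj^2 - 1 = xj^2
    (xj^2 - 2 kap) exposes a common factor xj^2, and dividing it out leaves [N4] and [D4]. *)
Lemma inf_N34 (P : T) : affine (torus_inv P) ->
  N3 P * (yj P - 1) = xj P ^+ 2 * N4 P /\ D3 P * (yj P - 1) = xj P ^+ 2 * D4 P.
Proof.
move=> /curve_inf h; rewrite /N3 /N4 /D3 /D4; split; last by ring.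
by move: (xj P) (yj P) h => X Y h; ring: h.
Qed.

(** The point is (2/3, 0), and 13 = 6 * (2/3) + 6 / (2/3). *)
Lemma not_affine_val (P : T) : ~~ affine P -> yj P != 1 -> trigonal P = Some 13.
Proof.
move=> naP y1; rewrite trigonal_some; last 2 first.
- by rewrite /finite_pt y1 orbT.
- by rewrite /cubic_m (negbTE naP) mulf_neq0 ?invr_neq0 ?natC_neq0.
by rewrite /fval /cubic_m /cubic_y (negbTE naP); congr Some; field.
Qed.

Lemma N3_rep (P : T) : affine (torus_inv P) -> E3 P != 0 -> N3 P != 0 ->
  trigonal P = ratio (N3 P) (D3 P).
Proof.
move=> aP' e3 n3; have [aP|naP] := boolP (affine P).
  have m0 := inf_m_neq0 aP aP' e3; have h := inf_N1 aP aP'.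
  have d3 : D3 P != 0.
    apply/eqP => d0; move: h; rewrite d0 mulr0 => /esym/eqP.
    by rewrite mulf_eq0 (negbTE m0) (negbTE n3).
  have mE : cubic_m P = cubic_mA P by rewrite /cubic_m aP.
  rewrite trigonal_some ?mE //; last by rewrite /finite_pt aP.
  rewrite /ratio (negbTE d3) /fval mE; congr Some.
  apply: divC_eq => //; rewrite [RHS]mulrC -h.
  by rewrite /N1 /cubic_y aP.
have [_ x0 [y1|y1]] := not_affine_xj naP.
  by rewrite /trigonal /finite_pt (negbTE naP) y1 eqxx /= /ratio /D3 x0 expr0n /= mulr0 mul0r eqxx.
by move: n3; rewrite /N3 x0 y1 addNr !expr0n /= !mulr0 addr0 subr0 eqxx.
Qed.

Lemma N4_rep (P : T) : affine (torus_inv P) -> E3 P != 0 -> D4 P != 0 ->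
  trigonal P = ratio (N4 P) (D4 P).
Proof.
move=> aP' e3 d4; have [aP|naP] := boolP (affine P).
  have m0 := inf_m_neq0 aP aP' e3; have h := inf_N1 aP aP'.
  have X0 := (xT_E aP aP').1; have [h1 h2] := inf_N34 aP'.
  have mE : cubic_m P = cubic_mA P by rewrite /cubic_m aP.
  rewrite trigonal_some ?mE //; last by rewrite /finite_pt aP.
  rewrite /ratio (negbTE d4) /fval mE; congr Some.
  apply: divC_eq => //.
  have -> : 6 * cubic_mA P ^+ 2 + 6 + cubic_y P = N1 P by rewrite /N1 /cubic_y aP.
  apply: (mulfI (expf_neq0 2 X0)).
  move: h h1 h2.
  move: (N1 P) (D3 P) (N3 P) (N4 P) (D4 P) (cubic_mA P) (xj P) (yj P).
  move=> n1 d3 n3 n4 d4' m X Y h h1 h2.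
  transitivity (n1 * d3 * (Y - 1)); first by rewrite -mulrA h2; ring.
  by rewrite h -mulrA h1; ring.
have [_ x0 [y1|y1]] := not_affine_xj naP.
  by move: d4; rewrite /D4 y1 subrr mulr0 eqxx.
have y1' : yj P != 1.
  by rewrite y1 eq_sym -subr_eq0 opprK; exact: (natC_neq0 R 1).
rewrite not_affine_val // /ratio (negbTE d4); congr Some.
rewrite /N4 /D4 x0 y1; have hk := cr_kap R; have r0 := cr_neq0 R.
apply: (mulIf (_ : 4 * (r + 3 * 0) * (-1 - 1) != 0)).
  by move: d4; rewrite /D4 x0 y1.
rewrite divfK; last by move: d4; rewrite /D4 x0 y1.
transitivity (- (18 * (25 / 9)) * r - 54 * r); first by field.
by rewrite -hk; ring.
Qed.

Definition rep_at (P : T) (f : T -> sphere) : Prop := exists (W : set T) (n d : T -> C),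
  [/\ open W, W P, forall Q, W Q -> hol Q n /\ hol Q d,
      forall Q, W Q -> (n Q != 0) || (d Q != 0) &
      forall Q, W Q -> f Q = ratio (n Q) (d Q)].

Lemma rep_fT (P : T) : rep_at P (@trigonal R).
Proof.
have oI := @open_affine_inv R; have oA := @affine_open R.
have [aP|naP] := boolP (affine P).
  have [h|] := boolP ((N1 P != 0) || (D1 P != 0)).
    exists ((([set Q | affine Q] : set T) `&` [set Q | N1 Q != 0]) `|`
            (([set Q | affine Q] : set T) `&` [set Q | D1 Q != 0])), (@N1 R), (@D1 R).
    split.
    - apply: openU; apply: open_neq0 => // Q aQ; [exact: hol_N1|exact: hol_cmA].
    - by case/orP: h; [left|right].
    - by move=> Q [[aQ _]|[aQ _]]; split; [exact: hol_N1|exact: hol_cmA|exact: hol_N1|exact: hol_cmA].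
    - by move=> Q [[_ /= ->]|[_ /= ->]]; rewrite ?orbT.
    - by move=> Q [[aQ /= nQ]|[aQ /= nQ]]; apply: N1_rep => //; rewrite nQ ?orbT.
  rewrite negb_or !negbK => /andP[/eqP n0 /eqP d0].
  have y6 : cubic_yA P = -6.
    by move: n0; rewrite /N1 -/(D1 P) d0 expr0n mulr0 add0r => /eqP; rewrite addrC addr_eq0 => /eqP.
  have d2 : D2 P != 0 by rewrite /D2 y6 -opprD oppr_eq0 -natrD natC_neq0.
  exists (([set Q | affine Q] : set T) `&` [set Q | D2 Q != 0]), (@N2 R), (@D2 R).
  split=> //.
  - by apply: open_neq0 => // Q aQ; exact: hol_D2.
  - by move=> Q [aQ _]; split; [exact: hol_N2|exact: hol_D2].
  - by move=> Q [_ /= ->]; rewrite orbT.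
  - by move=> Q [aQ dQ]; exact: N2_rep.
have [aP' x0 yP] := not_affine_xj naP.
have r0 := cr_neq0 R.
have e3 : E3 P != 0 by rewrite /E3 x0 expr0n mulr0 subr0 expf_neq0.
have oE : open (([set Q | affine (torus_inv Q)] : set T) `&` [set Q | E3 Q != 0]).
  by apply: open_neq0 => // Q aQ; exact: hol_E3.
case: yP => y1.
  have n3 : N3 P != 0.
    rewrite /N3 x0 y1 !expr0n !mulr0 addr0 subr0 addr0 !mulf_neq0 ?natC_neq0 ?expf_neq0 //.
  exists ((([set Q | affine (torus_inv Q)] : set T) `&` [set Q | E3 Q != 0]) `&`
     [set Q | N3 Q != 0]), (@N3 R), (@D3 R).
  split=> //.
  - by apply: open_neq0 => // Q [aQ _]; exact: hol_N3.
  - by move=> Q [[aQ _] _]; split; [exact: hol_N3|exact: hol_D3].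
  - by move=> Q [_ /= ->].
  - by move=> Q [[aQ eQ] nQ]; exact: N3_rep.
have d4 : D4 P != 0.
  rewrite /D4 x0 y1 mulr0 addr0 !mulf_neq0 ?natC_neq0 //.
exists ((([set Q | affine (torus_inv Q)] : set T) `&` [set Q | E3 Q != 0]) `&`
   [set Q | D4 Q != 0]), (@N4 R), (@D4 R).
split=> //.
- by apply: open_neq0 => // Q [aQ _]; exact: hol_D4.
- by move=> Q [[aQ _] _]; split; [exact: hol_N4|exact: hol_D4].
- by move=> Q [_ /= ->]; rewrite orbT.
- by move=> Q [[aQ eQ] dQ]; exact: N4_rep.
Qed.

Lemma trigonal_continuous (P : T) : {for P, continuous (@trigonal R)}.
Proof.
have [W [n [d [oW WP hnd nd fE]]]] := rep_fT P.
apply: (@ratio_continuous R (@trigonal R) W n d) => // Q WQ; have [] := hnd Q WQ => h1 h2.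
  exact: h1.
exact: h2.
Qed.

Lemma trigonal_holomorphic : @holomorphic_map R (torus_surface R) (riemann_sphere R) (@trigonal R).
Proof.
split=> [P|]; first exact: trigonal_continuous.
move=> P ch e [ach PD] he.
have [W [n [d [oW WP hnd nd fE]]]] := rep_fT P.
apply: (@ratio_holomorphic R (@trigonal R) W n d) => //.
  by move=> Q WQ; exact: (hnd Q WQ).1.
by move=> Q WQ; exact: (hnd Q WQ).2.
Qed.

End Holomorphy.

(** * Multiplicities of the function *)

Section Multiplicities.
Variable R : realType.
Local Notation C := (cplx R).
Local Notation c := (@cplx_of_real R).
Local Notation Re := (@complex.Re R).
Local Notation T := (torus R).
Local Notation sphere := (riemann_sphere R).
Local Notation r := (c (rho R)).
Local Notation kp := (c (kap R)).

Definition trigonal_map : torus_surface R -> sphere := @trigonal R.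

(* The equation of the fibre over [q], obtained by eliminating [y]. *)
Definition fibpoly (q m : C) : C :=
  36 * m ^+ 3 - (12 * q + 12) * m ^+ 2 + (q ^+ 2 + 71) * m - 12 * q + 60.

Lemma finite_pt_affine (P : T) : affine P -> finite_pt P.
Proof. by rewrite /finite_pt => ->. Qed.

(** For nonzero m the equation f = q means y = q m - 6 m^2 - 6, and substitution into the cubic
    gives m times [fibpoly]. For m = 0, [fibpoly] is 60 - 12 q, whose only zero q = 5 is the value
    of f at (0, -6). *)
Lemma trigonal_someP (P : T) (q : C) : trigonal P = Some q <->
  [/\ finite_pt P, cubic_y P = q * cubic_m P - 6 * cubic_m P ^+ 2 - 6 & fibpoly q (cubic_m P) = 0].
Proof.
split.
  rewrite /trigonal; case: ifP => // fP; have hc := cubic_eq fP.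
  have [m0|m0] := eqVneq (cubic_m P) 0.
    case: eqP => // y6 [<-]; split=> //; first by rewrite m0 y6; ring.
    by rewrite /fibpoly m0; ring.
  move=> [qE]; have yE : cubic_y P = q * cubic_m P - 6 * cubic_m P ^+ 2 - 6.
    by rewrite -qE; field.
  split=> //; apply: (mulfI m0); rewrite mulr0.
  move: hc; rewrite yE /cubic /fibpoly; move: (cubic_m P) => m h.
  apply/eqP; rewrite -[0](subrr ((q * m - 6 * m ^+ 2 - 6) ^+ 2)) {2}h.
  by apply/eqP; ring.
move=> [fP yE q0]; rewrite /trigonal fP; have [m0|m0] := eqVneq (cubic_m P) 0.
  have qE : q = 5.
    move: q0; rewrite /fibpoly m0 => h.
    apply: (mulfI (natC_neq0 R 11)); apply/eqP; rewrite -subr_eq0 -oppr_eq0; apply/eqP.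
    by rewrite -[RHS]h; ring.
  have -> : cubic_y P = -6 by rewrite yE m0; ring.
  by rewrite eqxx qE.
by congr Some; rewrite yE; field.
Qed.

(** Up to a factor m the left side is (q m - 6 m^2 - 6)^2 - y^2, a difference of squares whose first
    factor is m (q - q'). *)
Lemma fib_id (P : T) (q' q : C) : trigonal P = Some q' ->
  fibpoly q (cubic_m P) = (q - q') * (q * cubic_m P - 6 * cubic_m P ^+ 2 - 6 + cubic_y P).
Proof.
move=> /trigonal_someP [fP yE h]; rewrite yE.
rewrite -[LHS]subr0 -[X in _ - X]h /fibpoly.
by ring.
Qed.

Definition splits (q : C) (rs : seq C) : Prop :=
  forall m, fibpoly q m = 36 * \prod_(z <- rs) (m - z).

Lemma splits_exists (q : C) : exists2 rs, splits q rs & size rs = 3%N.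
Proof.
pose p : {poly C} := 36 *: 'X^3 - (12 * q + 12) *: 'X^2 + (q ^+ 2 + 71) *: 'X +
  (60 - 12 * q)%:P.
have p36 : 36 != 0 :> C := natC_neq0 R 35.
pose p2 : {poly C} := - ((12 * q + 12) *: 'X^2) + (q ^+ 2 + 71) *: 'X + (60 - 12 * q)%:P.
have lt3 : (size p2 <= 3)%N.
  apply: leq_trans (size_polyD _ _) _; rewrite geq_max; apply/andP; split; last first.
    exact: leq_trans (size_polyC_leq1 _) _.
  apply: leq_trans (size_polyD _ _) _; rewrite geq_max size_polyN; apply/andP; split.
    by apply: leq_trans (size_scale_leq _ _) _; rewrite size_polyXn.
  by apply: leq_trans (size_scale_leq _ _) _; rewrite size_polyX.
have pE : p = 36 *: 'X^3 + p2.
  by rewrite /p /p2 !addrA.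
have szp : size p = 4.
  by rewrite pE size_polyDl size_scale ?size_polyXn.
have lcp : lead_coef p = 36.
  by rewrite pE lead_coefDl ?lead_coefZ ?lead_coefXn ?mulr1 // size_scale ?size_polyXn.
have [rs rsE] := closed_field_poly_normal p; rewrite lcp in rsE.
exists rs.
  move=> m; have := congr1 (fun p : {poly C} => p.[m]) rsE.
  rewrite /p hornerZ horner_prod !(hornerD, hornerN, hornerZ, hornerXn, hornerX, hornerC) => h.
  rewrite /fibpoly; transitivity (36 * m ^+ 3 - (12 * q + 12) * m ^+ 2 +
    (q ^+ 2 + 71) * m + (60 - 12 * q)); first by ring.
  rewrite h; congr (_ * _); apply: eq_bigr => z _.
  by rewrite hornerD hornerN hornerX hornerC.
have := congr1 (fun p : {poly C} => size p) rsE.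
by rewrite /= szp size_scale // size_prod_XsubC => -[].
Qed.

Definition cofactor_at (m0 : C) (rs : seq C) (m : C) : C :=
  \prod_(z <- rs | z != m0) (m - z).

Lemma prod_count (rs : seq C) (m0 m : C) :
  \prod_(z <- rs) (m - z) = (m - m0) ^+ (count_mem m0 rs) * cofactor_at m0 rs m.
Proof.
rewrite (bigID (fun z => z == m0)) /=; congr (_ * _).
elim: rs => [|z rs IH]; first by rewrite big_nil.
rewrite big_cons /=; case: eqP => [->|_]; last by rewrite add0n.
by rewrite IH add1n exprS.
Qed.

Lemma cofactor_neq0 m0 rs : cofactor_at m0 rs m0 != 0.
Proof.
rewrite /cofactor_at; elim: rs => [|z rs IH]; first by rewrite big_nil oner_neq0.
rewrite big_cons; have [//|zm] := eqVneq z m0.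
by rewrite mulf_neq0 // subr_eq0 eq_sym.
Qed.

Lemma contC_prod (X : topologicalType) (x : X) (P : pred C) (rs : seq C) (g : X -> C) :
  {for x, continuous g} -> {for x, continuous (fun w => \prod_(z <- rs | P z) (g w - z))}.
Proof.
move=> cg; elim: rs => [|z rs IH].
  have -> : (fun w => \prod_(z <- [::] | P z) (g w - z)) = (fun=> 1).
    by apply/funext => w; rewrite big_nil.
  exact: contC_cst.
case Pz : (P z); last first.
  have -> : (fun w => \prod_(z <- z :: rs | P z) (g w - z)) =
      (fun w => \prod_(z <- rs | P z) (g w - z)).
    by apply/funext => w; rewrite big_cons Pz.
  exact: IH.
have -> : (fun w => \prod_(z <- z :: rs | P z) (g w - z)) =
    (fun w => (g w - z) * \prod_(z <- rs | P z) (g w - z)).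
  by apply/funext => w; rewrite big_cons Pz.
apply: contCM; last exact: IH.
by apply: contCB; [exact: cg|exact: contC_cst].
Qed.

Lemma chart_at0 (P : T) (q : C) : trigonal P = Some q ->
  chart_at (trigonal_map P) (@sphere_chart0 R : chart R sphere).
Proof. by move=> fP; split; [left|rewrite /= /sphere_coord0_dom /= /trigonal_map fP]. Qed.

Lemma trigonal_near_some (P : T) (q : C) : trigonal P = Some q -> nbhs P [set Q | trigonal Q <> None].
Proof.
move=> fP.
have N : nbhs (trigonal P) (@sphere_coord0_dom R).
  apply: open_nbhs_nbhs; split; first exact: sphere_coord0_dom_open.
  by rewrite /sphere_coord0_dom /= fP.
exact: (@trigonal_continuous R P _ N).
Qed.

(** The hypothesis speaks only of finite values q', so users need not exclude poles: by continuity
    there are none near P. *)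
Lemma mult_of_quotient (P : T) (ch : chart R T) (q : C) (k : nat) (g : C -> C) :
  trigonal P = Some q -> torus_atlas ch -> chart_dom ch P ->
  {for chart_fun ch P, continuous g} -> g (chart_fun ch P) != 0 ->
  nbhs (chart_fun ch P) [set z | forall q', trigonal (chart_inv ch z) = Some q' ->
    q' - q = (z - chart_fun ch P) ^+ k * g z] ->
  multiplicity trigonal_map P = k.
Proof.
move=> fP ach PD cg g0 gE.
apply: (@multiplicity_eq R (torus_surface R) sphere trigonal_map P ch (@sphere_chart0 R)).
- exact: trigonal_continuous.
- by split.
- exact: chart_at0 fP.
exists (g (chart_fun ch P)) => //.
have FF : Filter (chart_fun ch P)^' by exact: dnbhs_filter.
apply: (cvgC_near_eq FF (cvg_dnbhs cg)).
have N := chart_inv_near PD (trigonal_near_some fP).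
apply: (nbhsS (nbhsI N gE)) => z [zN zE] za.
have zN' : trigonal (chart_inv ch z) <> None := zN.
have zE' : forall q', trigonal (chart_inv ch z) = Some q' ->
    q' - q = (z - chart_fun ch P) ^+ k * g z := zE.
change (g z = (sphere_coord0 (trigonal (chart_inv ch z)) -
  sphere_coord0 (trigonal (chart_inv ch (chart_fun ch P)))) / (z - chart_fun ch P) ^+ k).
rewrite (chart_invK PD) fP /=.
case: (trigonal (chart_inv ch z)) zN' zE' => // q' _ /(_ _ erefl) /= ->.
by rewrite mulrC mulKf // expf_neq0 // subr_eq0.
Qed.

Definition cubic_m_scale : C := 3 * r ^+ 2 / 8.

Lemma cubic_m_scale_neq0 : cubic_m_scale != 0.
Proof. by rewrite /cubic_m_scale !mulf_neq0 ?invr_neq0 ?expf_neq0 ?natC_neq0 ?cr_neq0. Qed.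

Lemma cubic_mA_E (P : T) : cubic_mA P = cubic_m_scale * mT P - 3 / 8.
Proof. by rewrite /cubic_mA /cubic_m_scale; field. Qed.

(* Near the point [P], [fibpoly q m = (q - f) (q m - 6 m^2 - 6 + y)] and the second
   factor is [2 y <> 0] at [P]. *)
Lemma mult_generic (P : T) (q : C) (rs : seq C) : affine P -> xT P != 0 ->
  trigonal P = Some q -> splits q rs -> multiplicity trigonal_map P = count_mem (cubic_m P) rs.
Proof.
move=> aP x0 fP hrs.
pose u := (xT P)^*.
have PD : chartm_dom u P by split; [exact: aP|exact: Re_conj_mul_gt0].
have ach : torus_atlas (chartm u) by exists u; apply: Or33.
pose a := mT P; pose mz (z : C) := cubic_m_scale * z - 3 / 8.
have mP : cubic_m P = mz a by rewrite /cubic_m aP cubic_mA_E.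
have [fP1 yE _] := (trigonal_someP P q).1 fP.
pose ez z := q * mz z - 6 * mz z ^+ 2 - 6 + cubic_yA (chartm_inv u z).
have cmz z : {for z, continuous mz}.
  apply: contCB; last exact: contC_cst.
  by apply: contCM; [exact: contC_cst|exact: contC_id].
have cez : {for a, continuous ez}.
  apply: contCD.
    apply: contCB; last exact: contC_cst.
    apply: contCB; apply: contCM; [exact: contC_cst|exact: cmz|exact: contC_cst|].
    by apply: contCX; exact: cmz.
  apply: derivable_continuousC.
  exact: (hol_cyA aP ach PD).
have ea : ez a = 2 * cubic_yA P.
  have [_ hi _] := chartm_gD PD.
  rewrite /ez hi; have yE' : cubic_yA P = q * mz a - 6 * mz a ^+ 2 - 6.
    by rewrite -mP -yE /cubic_y aP.
  by rewrite -yE'; ring.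
have ea0 : ez a != 0.
  rewrite ea; apply: mulf_neq0; first exact: natC_neq0.
  apply: mulf_neq0; last exact: cubic_mA_neq.
  by apply: mulf_neq0; [exact: cr_neq0|exact: x0].
pose k := count_mem (cubic_m P) rs.
pose g z := - (36 * cubic_m_scale ^+ k * cofactor_at (cubic_m P) rs (mz z)) / ez z.
apply: (@mult_of_quotient P (chartm u) q k g fP ach PD).
- apply: contCM; last by apply: contCV; [exact: cez|exact: ea0].
  apply: contCN; apply: contCM; first exact: contC_cst.
  by apply: contC_prod; exact: cmz.
- rewrite /g mulf_neq0 ?invr_neq0 // oppr_eq0 !mulf_neq0 ?natC_neq0 ?expf_neq0 ?cubic_m_scale_neq0 //.
  change (cofactor_at (cubic_m P) rs (mz a) != 0); rewrite -mP; exact: cofactor_neq0.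
have N1' : nbhs a [set z | ez z != 0].
  exact: (@cvgr_neq0 _ C _ _ (nbhs_filter a) ez _ cez ea0).
have N2' : nbhs a (chartm_img u).
  have [PU _ _] := chartm_gD PD.
  by apply: open_nbhs_nbhs; split=> //; exact: chartm_img_open.
apply: (nbhsS (nbhsI N1' N2')) => z [ez0 zU] q' zq'.
have {}ez0 : ez z != 0 := ez0.
have {}zq' : trigonal (chartm_inv u z) = Some q' := zq'.
change (q' - q = (z - a) ^+ k * g z).
have [[aQ _] mQ _] := chartm_hU zU.
have cmQ : cubic_m (chartm_inv u z) = mz z by rewrite /cubic_m aQ cubic_mA_E mQ.
have := fib_id q zq'; rewrite hrs cmQ (prod_count _ (cubic_m P)) mP.
have -> : mz z - mz a = cubic_m_scale * (z - a) by rewrite /mz; ring.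
have -> : cubic_y (chartm_inv u z) = cubic_yA (chartm_inv u z) by rewrite /cubic_y aQ.
rewrite -/(ez z) exprMn -mP -/k => h.
move: h ez0; rewrite /g; move: (ez z) (cofactor_at _ _ (mz z)) => e H h e0.
apply: (mulIf e0); rewrite -[RHS]mulrA divfK //.
transitivity (- ((q - q') * e)); first by ring.
rewrite -h; clear g; move: cubic_m_scale (z - a) (k) => s w n.
by ring.
Qed.

End Multiplicities.

(** * Poles in general, and the points where x = 0 *)

Section SpecialMultiplicities.
Variable R : realType.
Local Notation C := (cplx R).
Local Notation c := (@cplx_of_real R).
Local Notation T := (torus R).
Local Notation sphere := (riemann_sphere R).
Local Notation r := (c (rho R)).
Local Notation kp := (c (kap R)).
Local Notation trigonal_map := (@trigonal_map R).
Local Notation scl := (@cubic_m_scale R).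

Lemma nbhs_neq0 (g : C -> C) (a : C) : {for a, continuous g} -> g a != 0 ->
  nbhs a [set z | g z != 0].
Proof. exact: (@cvgr_neq0 _ C _ _ (nbhs_filter a) g). Qed.

Lemma nbhs_chartx_img u (z : C) : chartx_img u z -> nbhs z (chartx_img u).
Proof. by move=> zU; apply: open_nbhs_nbhs; split=> //; exact: chartx_img_open. Qed.

Lemma chartx_y_continuous u (z : C) : chartx_img u z ->
  {for z, continuous (chartx_y u)}.
Proof. by move=> zU; apply: derivable_continuousC; exact: chartx_y_derivable. Qed.

Lemma chartx_y_at u (P : T) : chartx_dom u P -> chartx_y u (xT P) = yT P.
Proof.
move=> PD; have [PU hi _] := chartx_gD PD.
by have [_ _ <-] := curve_ptP (chartx_y_eq PU); rewrite -/(chartx_inv u (xT P)) hi.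
Qed.

Lemma mult_of_pole (P : T) (ch : chart R T) (k : nat) (g : C -> C) :
  trigonal P = None -> torus_atlas ch -> chart_dom ch P ->
  {for chart_fun ch P, continuous g} -> g (chart_fun ch P) != 0 ->
  nbhs (chart_fun ch P) [set z |
    sphere_coord1 (trigonal (chart_inv ch z)) = (z - chart_fun ch P) ^+ k * g z] ->
  multiplicity trigonal_map P = k.
Proof.
move=> fP ach PD cg g0 gE.
apply: (@multiplicity_eq R (torus_surface R) sphere trigonal_map P ch (@sphere_chart1 R)).
- exact: trigonal_continuous.
- by split.
- by split; [right|rewrite /= /sphere_coord1_dom /= /trigonal_map fP].
exists (g (chart_fun ch P)) => //.
have FF : Filter (chart_fun ch P)^' by exact: dnbhs_filter.
apply: (cvgC_near_eq FF (cvg_dnbhs cg)).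
apply: (nbhsS gE) => z zE za.
have zE' : sphere_coord1 (trigonal (chart_inv ch z)) = (z - chart_fun ch P) ^+ k * g z := zE.
change (g z = (sphere_coord1 (trigonal (chart_inv ch z)) -
  sphere_coord1 (trigonal (chart_inv ch (chart_fun ch P)))) / (z - chart_fun ch P) ^+ k).
rewrite (chart_invK PD) fP /= subr0 zE'.
by rewrite mulrC mulKf // expf_neq0 // subr_eq0.
Qed.

Lemma sqr1_neq0 (e : C) : e ^+ 2 = 1 -> e != 0.
Proof.
by move=> e1; apply/eqP => e0; move: e1; rewrite e0 expr0n => /esym/eqP; rewrite oner_eq0.
Qed.

Section BranchPoint.
Variable P : T.
Hypotheses (aP : affine P) (x0 : xT P = 0).

Let Y0 := yT P.
Let Y0K : Y0 ^+ 2 = 1.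
Proof. by rewrite /Y0 curve_eq // x0 /quartic; ring. Qed.

Lemma branch_cm_neq0 : cubic_m P != 0.
Proof.
rewrite /cubic_m aP; apply/eqP => m0.
have h : r ^+ 2 * Y0 = 1.
  apply: (mulfI (natC_neq0 R 2)); apply/eqP; rewrite -subr_eq0; apply/eqP.
  transitivity (8 * cubic_mA P); last by rewrite m0 mulr0.
  by rewrite /cubic_mA /mT x0 -/Y0; field.
have : r ^+ 4 = 1.
  transitivity ((r ^+ 2 * Y0) ^+ 2); first by rewrite exprMn Y0K; ring.
  by rewrite h expr1n.
rewrite cr4 => /eqP; rewrite -subr_eq0; apply/negP.
have -> : 33 - 1 = 32 :> C by ring.
exact: natC_neq0.
Qed.

(** Here y = 0 on the cubic, so the second factor in [fib_id] vanishes and [mult_generic] does not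
    apply. In the local coordinate x, m - m0 has order at least 2 and y has order 1, so f - q begins
    with r (3 m0 - 2) x / m0, whose coefficient is nonzero. *)
Lemma mult_branch (q : C) : trigonal P = Some q -> multiplicity trigonal_map P = 1%N.
Proof.
move=> fP; pose u := (yT P)^*.
have PD : chartx_dom u P.
  by split; [exact: aP|apply: Re_conj_mul_gt0; exact: sqr1_neq0 Y0K].
have ach : torus_atlas (chartx u) by exists u; apply: Or31.
have [PU _ _] := chartx_gD PD; rewrite x0 in PU.
pose Y := chartx_y u; pose m0 := cubic_m P.
have m0n : m0 != 0 by exact: branch_cm_neq0.
have Y00 : Y 0 = Y0 by rewrite -x0 /Y (chartx_y_at PD).
have cY : {for (0 : C), continuous Y} by exact: chartx_y_continuous.
pose S z := Y z + Y0.
have cS : {for (0 : C), continuous S} by apply: contCD; [exact: cY|exact: contC_cst].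
have S0 : S 0 != 0.
  rewrite /S Y00 -mulr2n mulrn_eq0 /=; exact: sqr1_neq0.
(* From (Y - Y0)(Y + Y0) = z^4 - 2 kap z^2 one gets m - m0 = scl z^2 E. *)
pose E z := 1 + (z ^+ 2 - 2 * kp) / S z.
have cid : {for (0 : C), continuous (fun z : C => z)} by exact: contC_id.
have cE : {for (0 : C), continuous E}.
  apply: contCD; first exact: contC_cst.
  apply: contCM; last by apply: contCV; [exact: cS|exact: S0].
  by apply: contCB; [apply: contCX; exact: cid|exact: contC_cst].
pose mz z := scl * (Y z + z ^+ 2) - 3 / 8.
have cmz : {for (0 : C), continuous mz}.
  apply: contCB; last exact: contC_cst.
  apply: contCM; first exact: contC_cst.
  by apply: contCD; [exact: cY|apply: contCX; exact: cid].
have mz0 : mz 0 = m0.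
  by rewrite /mz /m0 /cubic_m aP cubic_mA_E /mT x0 Y00.
(* This is (f - q) / z, where f - q = 6 (m - m0) - 6 (m - m0) / (m m0) + y / m and y = r z (3 m -
   2). *)
pose g z := 6 * scl * z * E z +
  (r * (3 * mz z - 2) * m0 - 6 * scl * z * E z) / (mz z * m0).
have cz : {for (0 : C), continuous (fun z => 6 * scl * z * E z)}.
  by apply: contCM; [apply: contCM; [exact: contC_cst|exact: cid]|exact: cE].
have cg : {for (0 : C), continuous g}.
  apply: contCD; first exact: cz.
  apply: contCM.
    apply: contCB; last exact: cz.
    apply: contCM; last exact: contC_cst.
    apply: contCM; first exact: contC_cst.
    apply: contCB; last exact: contC_cst.
    by apply: contCM; [exact: contC_cst|exact: cmz].
  apply: contCV; last by rewrite mz0 mulf_neq0.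
  by apply: contCM; [exact: cmz|exact: contC_cst].
have g0 : g 0 != 0.
  rewrite /g mz0 mulr0 mul0r add0r subr0.
  apply: mulf_neq0; last by rewrite invr_neq0 // mulf_neq0.
  apply: mulf_neq0; last exact: m0n.
  apply: mulf_neq0; first exact: cr_neq0.
  by rewrite /m0 /cubic_m aP; exact: cubic_mA_neq.
have qE : q = 6 * m0 + 6 / m0.
  have := (trigonal_someP P q).1 fP => -[_ + _].
  rewrite /cubic_y aP /cubic_yA x0 mulr0 mul0r -/m0 => h.
  apply: (mulIf m0n); rewrite mulrDl divfK //.
  apply/eqP; rewrite -subr_eq0; apply/eqP; rewrite [RHS]h; ring.
have N1' := nbhs_neq0 cS S0.
have mz0n : mz 0 != 0 by rewrite mz0.
have N2' := nbhs_neq0 cmz mz0n.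
have N3' := nbhs_chartx_img PU.
apply: (@mult_of_quotient R P (chartx u) q 1 g fP ach PD).
- by change {for xT P, continuous g}; rewrite x0; exact: cg.
- by change (g (xT P) != 0); rewrite x0; exact: g0.
change (nbhs (xT P) [set z | forall q', trigonal (chartx_inv u z) = Some q' ->
    q' - q = (z - xT P) ^+ 1 * g z]); rewrite x0.
apply: (nbhsS (nbhsI N1' (nbhsI N2' N3'))) => z [Sz [mzn zU]] q' hq'.
have {}Sz : S z != 0 := Sz; have {}mzn : mz z != 0 := mzn.
have [[aQ _] xQ _] := chartx_hU zU.
have [_ _ yQ] := curve_ptP (chartx_y_eq zU); rewrite -/(chartx_inv u z) -/(Y z) in yQ.
have cmQ : cubic_m (chartx_inv u z) = mz z by rewrite /cubic_m aQ cubic_mA_E /mT xQ yQ.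
have cyQ : cubic_y (chartx_inv u z) = r * z * (3 * mz z - 2).
  by rewrite /cubic_y aQ /cubic_yA xQ -cmQ /cubic_m aQ.
have q'E : q' = (6 * mz z ^+ 2 + 6 + r * z * (3 * mz z - 2)) / mz z.
  move: hq'; rewrite trigonal_some ?finite_pt_affine ?cmQ // => -[<-].
  by rewrite /fval cmQ cyQ.
have YE : Y z - Y0 = z ^+ 2 * (z ^+ 2 - 2 * kp) / S z.
  apply: (mulIf Sz); rewrite divfK // -subr_sqr Y0K (chartx_y_eq zU) /quartic.
  by ring.
have mE : mz z = m0 + scl * z ^+ 2 * E z.
  rewrite -mz0 /mz Y00 /E expr0n /= addr0.
  have -> : Y z = Y0 + (Y z - Y0) by ring.
  by rewrite YE; ring.
have EE : scl * z ^+ 2 * E z = mz z - m0 by rewrite mE; ring.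
rewrite expr1 subr0 q'E qE /g.
have -> : z * (6 * scl * z * E z + (r * (3 * mz z - 2) * m0 - 6 * scl * z * E z) / (mz z * m0)) =
  6 * (scl * z ^+ 2 * E z) +
  (z * r * (3 * mz z - 2) * m0 - 6 * (scl * z ^+ 2 * E z)) / (mz z * m0).
  by move: (mz z) mzn (E z) => m mn e; field; rewrite mn m0n.
rewrite EE; move: (mz z) mzn => m mn.
by field; rewrite mn m0n.
Qed.

End BranchPoint.

End SpecialMultiplicities.

(** * The infinite points of the quartic and the finite pole *)

Section InfinityMultiplicities.
Variable R : realType.
Local Notation C := (cplx R).
Local Notation c := (@cplx_of_real R).
Local Notation T := (torus R).
Local Notation sphere := (riemann_sphere R).
Local Notation r := (c (rho R)).
Local Notation kp := (c (kap R)).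
Local Notation trigonal_map := (@trigonal_map R).
Local Notation scl := (@cubic_m_scale R).

Section PointAtInfinity.
Variable P : T.
Hypothesis naP : ~~ affine P.

Let aP' : affine (torus_inv P). Proof. by have [] := not_affine naP. Qed.
Let xP : xj P = 0. Proof. by have [] := not_affine naP. Qed.
Let yP : yj P ^+ 2 = 1. Proof. by have [] := not_affine naP. Qed.
Let u := (yj P)^*.
Let Y := chartx_y u.

Let PD : chartj_dom u P.
Proof. by split; [exact: aP'|apply: Re_conj_mul_gt0; exact: sqr1_neq0 yP]. Qed.

Let PU : chartx_img u 0.
Proof. by have [] := chartj_gD PD; rewrite -/(xj P) xP. Qed.

Let Y0 : Y 0 = yj P.
Proof. by rewrite -xP /Y (chartx_y_at PD). Qed.

Let cY : {for (0 : C), continuous Y}.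
Proof. exact: chartx_y_continuous. Qed.

Let near_inf : nbhs (0 : C) [set z |
  [/\ affine (torus_inv (torus_inv (chartx_inv u z))),
      xj (torus_inv (chartx_inv u z)) = z, yj (torus_inv (chartx_inv u z)) = Y z &
      Y z ^+ 2 = quartic z]].
Proof.
apply: (nbhsS (nbhs_chartx_img PU)) => z zU.
have [[aQ _] xQ _] := chartx_hU zU.
have [_ _ yQ] := curve_ptP (chartx_y_eq zU); rewrite -/(chartx_inv u z) in yQ.
by rewrite /= /xj /yj torus_invK; split=> //; exact: chartx_y_eq.
Qed.

Let cid : {for (0 : C), continuous (fun z : C => z)}. Proof. exact: contC_id. Qed.
Let clin (a b : C) : {for (0 : C), continuous (fun z => a + b * z)}.
Proof.
by apply: contCD; [exact: contC_cst|apply: contCM; [exact: contC_cst|exact: cid]].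
Qed.

Let near_E3 : nbhs (0 : C) [set z | r ^+ 2 - 9 * z ^+ 2 != 0].
Proof.
apply: (@nbhs_neq0 R (fun z => r ^+ 2 - 9 * z ^+ 2)).
  apply: contCB; first exact: contC_cst.
  by apply: contCM; [exact: contC_cst|apply: contCX; exact: cid].
by rewrite expr0n mulr0 subr0 expf_neq0 // cr_neq0.
Qed.

(** In the coordinate xj, 1/f is [D3] over [N3]: the numerator is 4 xj^2 (r + 3 xj), and the
    denominator takes the nonzero value 18 r^3 at P. *)
Lemma mult_pole_inf : yj P = 1 -> multiplicity trigonal_map P = 2%N.
Proof.
move=> y1.
have ach : torus_atlas (chartj u) by exists u; apply: Or32.
have fP : trigonal P = None by rewrite /trigonal /finite_pt (negbTE naP) y1 eqxx.
pose n3 z := (3 * r + 11 * z) * (3 * r ^+ 2) * (Y z + 1) + 27 * r * z ^+ 2 - 21 * z ^+ 3.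
have cn3 : {for (0 : C), continuous n3}.
  apply: contCB; last by apply: contCM; [exact: contC_cst|apply: contCX; exact: cid].
  apply: contCD; last by apply: contCM; [exact: contC_cst|apply: contCX; exact: cid].
  apply: contCM; first by apply: contCM; [exact: clin|exact: contC_cst].
  by apply: contCD; [exact: cY|exact: contC_cst].
have n30 : n3 0 != 0.
  have -> : n3 0 = 18 * r ^+ 3 by rewrite /n3 Y0 y1; ring.
  by rewrite mulf_neq0 ?natC_neq0 // expf_neq0 // cr_neq0.
pose g z := 4 * (r + 3 * z) / n3 z.
apply: (@mult_of_pole R P (chartj u) 2 g fP ach PD).
- change {for xj P, continuous g}; rewrite xP.
  apply: contCM; last by apply: contCV; [exact: cn3|exact: n30].
  by apply: contCM; [exact: contC_cst|exact: clin].
- change (g (xj P) != 0); rewrite xP /g.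
  apply: mulf_neq0; last by rewrite invr_neq0.
  by rewrite mulr0 addr0 mulf_neq0 ?natC_neq0 // cr_neq0.
change (nbhs (xj P) [set z | sphere_coord1 (trigonal (torus_inv (chartx_inv u z))) =
  (z - xj P) ^+ 2 * g z]); rewrite xP.
apply: (nbhsS (nbhsI near_inf (nbhsI near_E3 (nbhs_neq0 cn3 n30)))).
move=> z [[aQ xQ yQ _] [e3 nz]].
have n3E : N3 (torus_inv (chartx_inv u z)) = n3 z by rewrite /N3 xQ yQ.
have d3E : D3 (torus_inv (chartx_inv u z)) = 4 * z ^+ 2 * (r + 3 * z) by rewrite /D3 xQ.
rewrite /= N3_rep //; last 2 first.
- by rewrite /E3 xQ.
- by rewrite n3E.
rewrite ratio_coord1 n3E // d3E subr0 /g.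
by move: (n3 z)^-1 => w; ring.
Qed.

Lemma mult_e2 : yj P != 1 -> multiplicity trigonal_map P = 1%N.
Proof.
move=> y1.
have yN : yj P = -1 by have [_ _ []] := not_affine_xj naP => // h; rewrite h eqxx in y1.
have ach : torus_atlas (chartj u) by exists u; apply: Or32.
have fP : trigonal P = Some 13 by exact: not_affine_val.
pose d4 z := 4 * (r + 3 * z) * (Y z - 1).
have cY1 : {for (0 : C), continuous (fun z => Y z - 1)}.
  by apply: contCB; [exact: cY|exact: contC_cst].
have cd4 : {for (0 : C), continuous d4}.
  by apply: contCM; [apply: contCM; [exact: contC_cst|exact: clin]|exact: cY1].
have r0 := cr_neq0 R.
have d40 : d4 0 != 0.
  have -> : d4 0 = - (8 * r) by rewrite /d4 Y0 yN; ring.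
  by rewrite oppr_eq0 mulf_neq0 ?natC_neq0.
have Y10 : Y 0 - 1 != 0.
  have -> : Y 0 - 1 = - 2 by rewrite Y0 yN; ring.
  by rewrite oppr_eq0 natC_neq0.
pose e z := (z ^+ 2 - 2 * kp) / (Y z - 1).
have ce : {for (0 : C), continuous e}.
  apply: contCM; last by apply: contCV; [exact: cY1|exact: Y10].
  by apply: contCB; [apply: contCX; exact: cid|exact: contC_cst].
(* This is (N4 - 13 D4) / (z D4) after the substitution Y = -1 + z^2 e. The constant terms -50 r and
   50 r of the numerator cancel, and its linear coefficient is 354 - 550/3 = 512/3. *)
pose g z := (3 * r ^+ 2 * z * (3 * r + 11 * z) + 512 / 3 - z * e z * (25 * r + 177 * z)) / d4 z.
apply: (@mult_of_quotient R P (chartj u) 13 1 g fP ach PD).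
- change {for xj P, continuous g}; rewrite xP.
  apply: contCM; last by apply: contCV; [exact: cd4|exact: d40].
  apply: contCB; last first.
    by apply: contCM; [apply: contCM; [exact: cid|exact: ce]|exact: clin].
  apply: contCD; last exact: contC_cst.
  by apply: contCM; [apply: contCM; [exact: contC_cst|exact: cid]|exact: clin].
- change (g (xj P) != 0); rewrite xP /g.
  apply: mulf_neq0; last by rewrite invr_neq0.
  rewrite !mulr0 !mul0r add0r subr0 mulf_neq0 ?invr_neq0 ?natC_neq0 //.
change (nbhs (xj P) [set z | forall q', trigonal (torus_inv (chartx_inv u z)) = Some q' ->
  q' - 13 = (z - xj P) ^+ 1 * g z]); rewrite xP.
apply: (nbhsS (nbhsI near_inf (nbhsI near_E3 (nbhsI (nbhs_neq0 cd4 d40) (nbhs_neq0 cY1 Y10))))).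
move=> z [[aQ xQ yQ hY] [e3 [dz yz]]] q'.
have {}yz : Y z - 1 != 0 := yz.
have {}dz : d4 z != 0 := dz.
have d4E : D4 (torus_inv (chartx_inv u z)) = d4 z by rewrite /D4 xQ yQ.
rewrite N4_rep //; last 2 first.
- by rewrite /E3 xQ.
- by rewrite d4E.
rewrite /ratio d4E (negbTE dz) => -[<-].
rewrite /N4 xQ yQ expr1 subr0 /g.
apply: (mulIf dz); rewrite mulrBl divfK // -[RHS]mulrA divfK //.
have YE : Y z = -1 + z ^+ 2 * e z.
  rewrite /e; apply: (mulIf yz).
  rewrite mulrDl -[z ^+ 2 * _ * _]mulrA divfK //.
  transitivity (Y z ^+ 2 - Y z); first by ring.
  by rewrite hY /quartic; ring.
have hk : r ^+ 2 * kp = 25 / 9 := cr_kap R.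
have -> : (3 * r + 11 * z) * (3 * r ^+ 2) * (z ^+ 2 - 2 * kp) =
  (3 * r + 11 * z) * (3 * r ^+ 2 * z ^+ 2 - 6 * (r ^+ 2 * kp)) by ring.
rewrite hk /d4 YE; move: (e z) r => e0 s.
by field.
Qed.

End PointAtInfinity.

(** 1/f is [D1] over [N1]; [D1] is m, an affine function of the chart coordinate [mT], and [N1] is
    12 at P. *)
Lemma mult_pole_fin (P : T) : affine P -> cubic_m P = 0 -> cubic_y P = 6 -> multiplicity trigonal_map P = 1%N.
Proof.
move=> aP m0 y6.
have cmE : cubic_mA P = 0 by move: m0; rewrite /cubic_m aP.
have cyE : cubic_yA P = 6 by move: y6; rewrite /cubic_y aP.
have x0 : xT P != 0.
  apply/eqP => x0; have := cyE; rewrite /cubic_yA x0 mulr0 mul0r => /esym/eqP.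
  by rewrite (negbTE (natC_neq0 R 5)).
have fP : trigonal P = None.
  rewrite /trigonal finite_pt_affine // m0 eqxx /= y6; case: eqP => // /eqP.
  by rewrite -subr_eq0 opprK -natrD (negbTE (natC_neq0 R 11)).
pose u := (xT P)^*.
have PD : chartm_dom u P by split; [exact: aP|exact: Re_conj_mul_gt0].
have ach : torus_atlas (chartm u) by exists u; apply: Or33.
have [PU hi _] := chartm_gD PD.
pose a := mT P.
have hn := derivable_continuousC (hol_N1 aP ach PD).
pose n1 : C -> C := @N1 R \o chartm_inv u.
have cn1 : {for a, continuous n1} by exact: hn.
have n1a : n1 a = 12.
  by rewrite /n1 /= hi /N1 cmE cyE; ring.
have n1a0 : n1 a != 0 by rewrite n1a natC_neq0.
pose g z := scl / n1 z.
apply: (@mult_of_pole R P (chartm u) 1 g fP ach PD).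
- by apply: contCM; [exact: contC_cst|apply: contCV; [exact: cn1|exact: n1a0]].
- by change (g a != 0); rewrite /g mulf_neq0 ?invr_neq0 // cubic_m_scale_neq0.
have N2' : nbhs a (chartm_img u).
  by apply: open_nbhs_nbhs; split=> //; exact: chartm_img_open.
apply: (nbhsS (nbhsI (nbhs_neq0 cn1 n1a0) N2')) => z [nz zU].
have {}nz : n1 z != 0 := nz.
change (sphere_coord1 (trigonal (chartm_inv u z)) = (z - a) ^+ 1 * g z).
have [[aQ _] mQ _] := chartm_hU zU.
rewrite N1_rep //; last by rewrite -/(n1 z) nz.
rewrite ratio_coord1 // -/(n1 z) /D1 cubic_mA_E mQ expr1 /g.
have -> : scl * z - 3 / 8 = (z - a) * scl.
  have : scl * a - 3 / 8 = 0 by rewrite -cubic_mA_E.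
  by move=> h; rewrite -[LHS]subr0 -{1}h; ring.
by rewrite mulrA.
Qed.

End InfinityMultiplicities.

(** * Fibres and critical points *)

Section Counting.
Variable R : realType.
Local Notation C := (cplx R).
Local Notation c := (@cplx_of_real R).
Local Notation T := (torus R).
Local Notation ii := (imag_unit R).
Local Notation trigonal_map := (@trigonal_map R).

Definition fibpoly_deriv (q m : C) : C :=
  108 * m ^+ 2 - 2 * (12 * q + 12) * m + q ^+ 2 + 71.

Lemma double_root (q m0 x : C) :
  (forall m, fibpoly q m = 36 * ((m - m0) ^+ 2 * (m - x))) ->
  fibpoly_deriv q m0 = 0.
Proof.
move=> h; have h0 := h 0; have h1 := h 1; have h2 := h (-1).
apply: (mulfI (natC_neq0 R 1)); rewrite mulr0.
(* The difference p of the two sides of [h] has degree at most 2, its cubic terms cancelling, so 2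
   p'(m0) = (1 + 2 m0) p(1) + (2 m0 - 1) p(-1) - 4 m0 p(0). The product with a square has zero
   derivative at m0, so p'(m0) is [fibpoly_deriv q m0]. *)
transitivity ((fibpoly q 1 - 36 * ((1 - m0) ^+ 2 * (1 - x))) * (1 + 2 * m0) +
  (fibpoly q (-1) - 36 * ((-1 - m0) ^+ 2 * (-1 - x))) * (2 * m0 - 1)
  - 4 * m0 * (fibpoly q 0 - 36 * ((0 - m0) ^+ 2 * (0 - x)))).
  by rewrite /fibpoly_deriv /fibpoly; ring.
by rewrite h0 h1 h2 !subrr; ring.
Qed.

Lemma count_gt1_deriv (q m0 : C) (rs : seq C) : splits q rs -> size rs = 3%N ->
  (1 < count_mem m0 rs)%N -> fibpoly_deriv q m0 = 0.
Proof.
case: rs => [|x1 [|x2 [|x3 [|]]]] // hrs _ /=.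
have hE m : fibpoly q m = 36 * ((m - x1) * ((m - x2) * (m - x3))).
  by rewrite hrs !big_cons big_nil mulr1.
have [e1|n1] := eqVneq x1 m0; have [e2|n2] := eqVneq x2 m0;
  have [e3|n3] := eqVneq x3 m0 => //= _.
- by apply: (@double_root q m0 m0) => m; rewrite hE e1 e2 e3; ring.
- by apply: (@double_root q m0 x3) => m; rewrite hE e1 e2; ring.
- by apply: (@double_root q m0 x2) => m; rewrite hE e1 e3; ring.
- by apply: (@double_root q m0 x1) => m; rewrite hE e2 e3; ring.
Qed.

Lemma count_gt0_root (q m0 : C) (rs : seq C) : splits q rs ->
  (0 < count_mem m0 rs)%N = (fibpoly q m0 == 0).
Proof.
move=> hrs; rewrite -has_count has_pred1 hrs mulf_eq0 (negbTE (natC_neq0 R 35)) /=.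
rewrite prodf_seq_eq0; apply/idP/hasP => [mr|[x xr /=]].
  by exists m0 => //=; rewrite subrr.
by rewrite subr_eq0 => /eqP ->.
Qed.

(** Two factors m allow every q to be replaced through q m = y + 6 m^2 + 6; reducing y^2 by the
    cubic then leaves an expression linear in y, which splits off m - 1. *)
Lemma fibpoly_derivE (P : T) (q : C) : trigonal P = Some q ->
  cubic_m P * (cubic_m P * fibpoly_deriv q (cubic_m P)) =
  - 12 * (cubic_m P - 1) * (cubic_y P * (cubic_m P + 1) + cubic_m P ^+ 2 + cubic_m P + 6).
Proof.
move=> fP; have [fP1 yE q0] := (trigonal_someP P q).1 fP.
have hc := cubic_eq fP1.
have qm : q * cubic_m P = cubic_y P + 6 * cubic_m P ^+ 2 + 6 by rewrite yE; ring.
move: hc qm; rewrite /cubic /fibpoly_deriv; move: (cubic_m P) (cubic_y P) => m y hc qm.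
have -> : m * (m * (108 * m ^+ 2 - 2 * (12 * q + 12) * m + q ^+ 2 + 71)) =
  108 * m ^+ 4 - 24 * m ^+ 2 * (q * m) - 24 * m ^+ 3 + (q * m) ^+ 2 + 71 * m ^+ 2 by ring.
by rewrite qm; ring: hc.
Qed.

(** Points with nonzero y are covered by [mult_generic]. At the points with y = 0, namely (2/3, 0)
    and those with x = 0, f is unramified, and it remains to see that m is a simple root: otherwise
    (m - 1)(m^2 + m + 6) = 0, which contradicts [cubic m] = 0. *)
Lemma mult_fin (P : T) (q : C) (rs : seq C) : trigonal P = Some q -> splits q rs ->
  size rs = 3%N -> multiplicity trigonal_map P = count_mem (cubic_m P) rs.
Proof.
move=> fP hrs szrs; have [fP1 yE q0] := (trigonal_someP P q).1 fP.
have c0 : (0 < count_mem (cubic_m P) rs)%N by rewrite (count_gt0_root _ hrs) q0.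
have ramified : cubic_y P = 0 -> multiplicity trigonal_map P = 1%N -> multiplicity trigonal_map P = count_mem (cubic_m P) rs.
  move=> y0 ->; apply/eqP; rewrite eq_sym eqn_leq c0 andbT leqNgt; apply/negP => c1.
  have d0 := count_gt1_deriv hrs szrs c1.
  have := fibpoly_derivE fP; rewrite d0 !mulr0 y0 mul0r add0r => /esym d1.
  have := cubic_eq fP1; rewrite y0 expr0n /= /cubic => /esym h.
  move: d1 h; move: (cubic_m P) => m d1 h.
  move/eqP: d1; rewrite -mulrA mulf_eq0 oppr_eq0 (negbTE (natC_neq0 R 11)) /=.
  rewrite mulf_eq0 subr_eq0 => /orP[/eqP m1|/eqP m2].
    have : (11 : C) == 0 by rewrite -oppr_eq0 -[X in _ == X]h m1; apply/eqP; ring.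
    by rewrite (negbTE (natC_neq0 R 10)).
  (* Division of the cubic by m^2 + m + 6 leaves the remainder 102 - 121 m, and m^2 + m + 6 is
     positive at 102/121. *)
  have e3 : 121 * m = 102.
    apply/eqP; rewrite -subr_eq0 -oppr_eq0; apply/eqP.
    transitivity (12 * m ^+ 3 + m ^+ 2 - 60 * m + 36 + (11 - 12 * m) * (m ^+ 2 + m + 6)).
      by ring.
    by rewrite h m2 mulr0 addr0.
  have : 121 ^+ 2 * (m ^+ 2 + m + 6) = 0 by rewrite m2 mulr0.
  have -> : 121 ^+ 2 * (m ^+ 2 + m + 6) = (121 * m) ^+ 2 + 121 * (121 * m) + 121 ^+ 2 * 6.
    by ring.
  rewrite e3 => /eqP; rewrite gt_eqF //.
have [aP|naP] := boolP (affine P).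
  have [x0|x0] := eqVneq (xT P) 0; last exact: (mult_generic aP x0 fP hrs).
  apply: ramified; last exact: mult_branch aP x0 _ fP.
  by rewrite /cubic_y aP /cubic_yA x0 mulr0 mul0r.
apply: ramified; first by rewrite /cubic_y (negbTE naP).
by apply: mult_e2 => //; move: fP1; rewrite /finite_pt (negbTE naP).
Qed.

Definition cubic_pt (m y : C) : T :=
  xget (circ_exp 0, circ_exp 0) [set P : T | [/\ finite_pt P, cubic_m P = m & cubic_y P = y]].

Lemma cubic_ptP m y : y ^+ 2 = cubic m ->
  [/\ finite_pt (cubic_pt m y), cubic_m (cubic_pt m y) = m & cubic_y (cubic_pt m y) = y].
Proof.
move=> /cubic_m_surj [P hP].
have : [set P : T | [/\ finite_pt P, cubic_m P = m & cubic_y P = y]] (cubic_pt m y).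
  by apply: xgetPex; exists P.
by [].
Qed.

Lemma cubic_ptK P : finite_pt P -> cubic_pt (cubic_m P) (cubic_y P) = P.
Proof.
move=> fP; have [h1 h2 h3] := cubic_ptP (cubic_eq fP).
exact: cubic_m_inj.
Qed.

Definition ptA : T := @infinity_pt R 1.

Lemma ptA_nfin : ~~ finite_pt ptA.
Proof.
have [h1 _ _ h4] := @infinity_ptP R 1 (expr1n _ _).
by rewrite /finite_pt negb_or h1 h4 eqxx.
Qed.

Lemma nfin_ptA P : ~~ finite_pt P -> P = ptA.
Proof.
rewrite /finite_pt negb_or negbK => /andP[naP /eqP y1].
have [aP' x0 _] := not_affine_xj naP.
have [_ h2 h3 h4] := @infinity_ptP R 1 (expr1n _ _).
by apply: inv_inj => //; rewrite ?x0 ?y1 ?h3 ?h4.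
Qed.

Lemma trigonal_ptA : trigonal ptA = None. Proof. by rewrite /trigonal (negbTE ptA_nfin). Qed.

Lemma mult_ptA : multiplicity trigonal_map ptA = 2%N.
Proof.
have [h1 _ _ h4] := @infinity_ptP R 1 (expr1n _ _).
exact: mult_pole_inf.
Qed.

Lemma finite_pt_neq_ptA P : finite_pt P -> P != ptA.
Proof. by apply: contraTneq => ->; exact: ptA_nfin. Qed.

Lemma cubic0 : (6 : C) ^+ 2 = cubic (0 : C).
Proof. by rewrite /cubic; ring. Qed.
Definition ptB : T := cubic_pt 0 6.

Lemma trigonal_ptB : trigonal ptB = None.
Proof.
have [h1 h2 h3] := cubic_ptP cubic0; rewrite /trigonal h1 h2 h3 eqxx /=.
by rewrite -subr_eq0 opprK -natrD (negbTE (natC_neq0 R 11)).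
Qed.

Lemma trigonal_none P : trigonal P = None -> P = ptA \/ P = ptB.
Proof.
rewrite /trigonal; case: ifP => [fP|/negbT /nfin_ptA ->]; last by left.
have [m0|//] := eqVneq (cubic_m P) 0; case: eqP => // y6 _; right.
have := cubic_eq fP; rewrite m0 -cubic0 => /eqP; rewrite eqf_sqr => /orP[/eqP y|/eqP //].
by rewrite -(cubic_ptK fP) m0 y.
Qed.

Lemma mult_ptB : multiplicity trigonal_map ptB = 1%N.
Proof.
have [h1 h2 h3] := cubic_ptP cubic0; apply: mult_pole_fin => //.
have [//|naP] := boolP (affine ptB); have := h3; rewrite /cubic_y (negbTE naP) => /esym/eqP.
by rewrite (negbTE (natC_neq0 R 5)).
Qed.

Lemma sum_count_undup (s : seq C) : (\sum_(x <- undup s) count_mem x s)%N = size s.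
Proof.
rewrite -sum1_size -[RHS]big_undup_iterop_count; apply: eq_bigr => x _.
by rewrite Monoid.iteropE iter_addn_0 mul1n.
Qed.

(** The distinct roots m of [fibpoly q] parametrise the fibre by (m, q m - 6 m^2 - 6), and their
    multiplicities add up to 3. Over infinity the sum is 2 at A plus 1 at B. *)
Lemma trigonal_has_degree : @has_degree R (torus_surface R) (riemann_sphere R) trigonal_map 3.
Proof.
move=> [q|].
  have [rs hrs szrs] := splits_exists q.
  pose g m := cubic_pt m (q * m - 6 * m ^+ 2 - 6).
  have gP m : m \in undup rs -> trigonal (g m) = Some q /\ cubic_m (g m) = m.
    rewrite mem_undup => mr.
    have q0 : fibpoly q m = 0.
      by apply/eqP; rewrite -(count_gt0_root _ hrs) -has_count has_pred1.
    have hc : (q * m - 6 * m ^+ 2 - 6) ^+ 2 = cubic m.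
      apply/eqP; rewrite -subr_eq0; apply/eqP.
      by transitivity (m * fibpoly q m); [rewrite /cubic /fibpoly; ring|rewrite q0 mulr0].
    have [h1 h2 h3] := cubic_ptP hc; split=> //.
    by apply/trigonal_someP; rewrite -/(g m) in h1 h2 h3; rewrite h1 h2 h3; split.
  have gu : uniq [seq g m | m <- undup rs].
    rewrite map_inj_in_uniq ?undup_uniq // => m m' hm hm' gE.
    by rewrite -(gP m hm).2 -(gP m' hm').2 gE.
  rewrite (fsbigE [seq g m | m <- undup rs]) //.
  - rewrite big_map -szrs -sum_count_undup [LHS]big_seq_cond [RHS]big_seq.
    apply: eq_big => [m|m /andP[hm _]].
      apply: andb_idr => hm; rewrite in_setE /=; exact: (gP m hm).1.
    by rewrite (mult_fin (gP m hm).1 hrs szrs) (gP m hm).2.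
  - by move=> _ /mapP[m hm ->]; exact: (gP m hm).1.
  - move=> P fP /negP nP; exfalso; apply: nP.
    have [fP1 yE q0] := (trigonal_someP P q).1 fP.
    apply/mapP; exists (cubic_m P); last by rewrite /g -yE cubic_ptK.
    by rewrite mem_undup -has_pred1 has_count (count_gt0_root _ hrs) q0.
rewrite (fsbigE [:: ptA; ptB]) //.
- have hA : ptA \in trigonal_map @^-1` [set None] by apply: mem_set; exact: trigonal_ptA.
  have hB : ptB \in trigonal_map @^-1` [set None] by apply: mem_set; exact: trigonal_ptB.
  by rewrite !big_cons big_nil hA hB mult_ptA mult_ptB.
- rewrite /= andbT inE eq_sym; apply: finite_pt_neq_ptA.
  by have [] := cubic_ptP cubic0.
- move=> P /=; rewrite !inE => /orP[] /eqP ->; [exact: trigonal_ptA|exact: trigonal_ptB].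
- by move=> P /trigonal_none [] ->; rewrite !inE eqxx ?orbT.
Qed.

End Counting.

(** * The critical points of the trigonal function *)

Section CriticalPoints.
Variable R : realType.
Local Notation C := (cplx R).
Local Notation c := (@cplx_of_real R).
Local Notation T := (torus R).
Local Notation ii := (imag_unit R).
Local Notation trigonal_map := (@trigonal_map R).

Definition sqrtN11 : C := ii * c (Num.sqrt 11).

Lemma sqrtN11K : sqrtN11 ^+ 2 = - 11.
Proof.
by rewrite exprMn imag_unitK -cRX sqr_sqrtr // cRn mulN1r.
Qed.

Lemma curveQ (y : C) : y ^+ 2 = - 11 -> y ^+ 2 = cubic (1 : C).
Proof. by move=> ->; rewrite /cubic; ring. Qed.

Definition ptQ (y : C) : T := cubic_pt 1 y.
Definition ptC : T := @cubic_pt R (-2) 8.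
Definition ptL : T := @cubic_pt R 2 (-4).

Lemma curveC : (8 : C) ^+ 2 = cubic (- 2 : C).
Proof. by rewrite /cubic; ring. Qed.
Lemma curveL : (- 4 : C) ^+ 2 = cubic (2 : C).
Proof. by rewrite /cubic; ring. Qed.

Lemma trigonal_fin (P : T) : finite_pt P -> cubic_m P != 0 -> trigonal P = Some (6 * cubic_m P + (6 + cubic_y P) / cubic_m P).
Proof. by move=> fP m0; rewrite /trigonal fP m0. Qed.

Lemma neqC (a b : C) n : a - b = n.+1%:R \/ b - a = n.+1%:R -> a != b.
Proof.
move=> h; apply/eqP => ab; move: h; rewrite ab subrr.
by case=> /esym/eqP; rewrite (negbTE (natC_neq0 R n)).
Qed.

Lemma mult_ptQ (y : C) : y ^+ 2 = - 11 -> multiplicity trigonal_map (ptQ y) = 2%N.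
Proof.
move=> y2; have [h1 h2 h3] := cubic_ptP (curveQ y2).
have fP : trigonal (ptQ y) = Some (12 + y).
  rewrite trigonal_fin // h2 ?oner_neq0 // h3; congr Some; by field.
(* The roots of [fibpoly q] have sum (q + 1) / 3, which determines the third root from the double
   root 1. *)
have hs : splits (12 + y) [:: 1; 1; (7 + y) / 3].
  move=> m; rewrite !big_cons big_nil mulr1 /fibpoly.
  by field: y2.
rewrite (mult_fin fP hs) // h2 /= eqxx.
suff /negbTE -> : (7 + y) / 3 != 1 by [].
apply/eqP => y4; have : y = -4.
  have -> : y = 3 * ((7 + y) / 3) - 7 by field.
  by rewrite y4; ring.
move=> yE; move: y2; rewrite yE => /eqP; apply/negP.
by apply: (@neqC _ _ 26); left; ring.
Qed.

Lemma mult_ptC : multiplicity trigonal_map ptC = 3%N.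
Proof.
have [h1 h2 h3] := cubic_ptP curveC.
have m0 : cubic_m ptC != 0 by rewrite h2 oppr_eq0 natC_neq0.
have fP : trigonal ptC = Some (-19).
  rewrite trigonal_fin // h2 h3; congr Some; by field.
have hs : splits (-19 : C) [:: -2; -2; -2].
  by move=> m; rewrite !big_cons big_nil mulr1 /fibpoly; ring.
by rewrite (mult_fin fP hs) // h2 /= eqxx.
Qed.

Lemma mult_ptL : multiplicity trigonal_map ptL = 2%N.
Proof.
have [h1 h2 h3] := cubic_ptP curveL.
have m0 : cubic_m ptL != 0 by rewrite h2 natC_neq0.
have fP : trigonal ptL = Some 13.
  rewrite trigonal_fin // h2 h3; congr Some; by field.
have hs : splits (13 : C) [:: 2; 2; 2 / 3].
  by move=> m; rewrite !big_cons big_nil mulr1 /fibpoly; field.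
rewrite (mult_fin fP hs) // h2 /= eqxx.
suff /negbTE -> : 2 / 3 != 2 :> C by [].
apply/eqP => h; have h6 : (2 : C) = 2 * 3 by rewrite -[in RHS]h divfK ?natC_neq0.
have /eqP : (4 : C) = 0 by transitivity (2 * 3 - 2 : C); [ring|rewrite -h6 subrr].
by rewrite (negbTE (natC_neq0 R 3)).
Qed.

(* The critical points are the roots of the factorisation in [fibpoly_derivE]:
   [m = 1] gives [y^2 = -11], and squaring [y (m + 1) = - (m^2 + m + 6)] gives
   [m^2 (m + 2)^2 (m - 2) = 0]. *)
Definition critical_points : seq T :=
  [:: ptA R; ptQ sqrtN11; ptQ (- sqrtN11); ptC; ptL].

Lemma mult_fin_ptP (P : T) : P \notin critical_points -> (multiplicity trigonal_map P).-1 = 0%N.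
Proof.
rewrite !inE !negb_or => /and5P[nA nQ nQ' nC nL].
have [fP|/nfin_ptA PA] := boolP (finite_pt P); last by rewrite PA eqxx in nA.
case fE : (trigonal P) => [q|]; last first.
  have [PA|->] := trigonal_none fE; last by rewrite mult_ptB.
  by rewrite PA eqxx in nA.
have [rs hrs szrs] := splits_exists q.
rewrite (mult_fin fE hrs szrs).
suff : ~~ (1 < count_mem (cubic_m P) rs)%N by case: (count_mem _ _) => [|[|]].
apply/negP => /(count_gt1_deriv hrs szrs) d0.
have [_ yE q0] := (trigonal_someP P q).1 fE.
have hc := cubic_eq fP.
(* The factor m^2 in [fibpoly_derivE] hides this case, so it is excluded directly: m = 0 gives q = 5
   and the derivative 25 + 71 = 96. *)
have m0 : cubic_m P != 0.
  apply/eqP => m0; have qE : q = 5.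
    move: q0; rewrite /fibpoly m0 => h.
    apply: (mulfI (natC_neq0 R 11)); apply/eqP; rewrite -subr_eq0 -oppr_eq0; apply/eqP.
    by rewrite -[RHS]h; ring.
  move: d0; rewrite /fibpoly_deriv m0 qE => /eqP; apply/negP.
  by apply: (@neqC _ _ 95); left; ring.
have := fibpoly_derivE fE; rewrite d0 !mulr0 => /esym/eqP.
rewrite -mulrA mulf_eq0 oppr_eq0 (negbTE (natC_neq0 R 11)) /= mulf_eq0 subr_eq0.
move=> /orP[/eqP m1|/eqP hy].
  have : cubic_y P ^+ 2 = sqrtN11 ^+ 2 by rewrite hc m1 sqrtN11K /cubic; ring.
  move=> /eqP; rewrite eqf_sqr => /orP[] /eqP y.
    by move: nQ; rewrite -(cubic_ptK fP) m1 y eqxx.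
  by move: nQ'; rewrite -(cubic_ptK fP) m1 y eqxx.
have hE : cubic_m P ^+ 2 * ((cubic_m P + 2) ^+ 2 * (cubic_m P - 2)) = 0.
  apply: (mulfI (natC_neq0 R 11)); rewrite mulr0.
  transitivity ((cubic_m P + 1) ^+ 2 * cubic (cubic_m P) - (cubic_m P ^+ 2 + cubic_m P + 6) ^+ 2).
    by rewrite /cubic; ring.
  rewrite -hc.
  transitivity ((cubic_y P * (cubic_m P + 1) + cubic_m P ^+ 2 + cubic_m P + 6) *
     (cubic_y P * (cubic_m P + 1) - (cubic_m P ^+ 2 + cubic_m P + 6))); first by ring.
  by rewrite hy mul0r.
move/eqP: hE; rewrite mulf_eq0 expf_eq0 (negbTE m0) andbF /= mulf_eq0 expf_eq0 /=.
rewrite addr_eq0 subr_eq0 => /orP[] /eqP m2.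
  have y8 : cubic_y P = 8.
    move: hy; rewrite m2; move: (cubic_y P) => y h.
    by apply/eqP; rewrite -subr_eq0 -oppr_eq0; apply/eqP; rewrite -[RHS]h; ring.
  by move: nC; rewrite -(cubic_ptK fP) m2 y8 eqxx.
have y4 : cubic_y P = -4.
  move: hy; rewrite m2; move: (cubic_y P) => y h.
  apply: (mulfI (natC_neq0 R 2)); apply/eqP; rewrite -subr_eq0; apply/eqP.
  by rewrite -[RHS]h; ring.
by move: nL; rewrite -(cubic_ptK fP) m2 y4 eqxx.
Qed.

Lemma sqrtN11_neq0 : sqrtN11 != 0.
Proof. by rewrite -sqrf_eq0 sqrtN11K oppr_eq0 natC_neq0. Qed.

Lemma finQ (y : C) : y ^+ 2 = - 11 -> [/\ finite_pt (ptQ y), cubic_m (ptQ y) = 1 & cubic_y (ptQ y) = y].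
Proof. by move=> /curveQ /cubic_ptP. Qed.

Lemma uniq5 (X : eqType) (x1 x2 x3 x4 x5 : X) :
  x1 != x2 -> x1 != x3 -> x1 != x4 -> x1 != x5 -> x2 != x3 -> x2 != x4 ->
  x2 != x5 -> x3 != x4 -> x3 != x5 -> x4 != x5 ->
  uniq [:: x1; x2; x3; x4; x5].
Proof. by rewrite /= !inE; do ![move/negbTE ->]. Qed.

Lemma critical_points_uniq : uniq critical_points.
Proof.
have [q1 q2 q3] := finQ sqrtN11K.
have [r1 r2 r3] := @finQ (- sqrtN11) ltac:(by rewrite sqrrN sqrtN11K).
have [c1 c2 c3] := cubic_ptP curveC; have [l1 l2 l3] := cubic_ptP curveL.
have neq_cm (P P' : T) : cubic_m P != cubic_m P' -> P != P' by apply: contraNneq => ->.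
have hA (P : T) : finite_pt P -> ptA R != P by rewrite eq_sym; exact: finite_pt_neq_ptA.
have e1 : cubic_m ptC != cubic_m ptL by rewrite c2 l2; apply: (@neqC _ _ 3); right; ring.
have e2 (P : T) : cubic_m P = 1 -> P != ptC.
  by move=> P1; apply: neq_cm; rewrite P1 c2; apply: (@neqC _ _ 2); left; ring.
have e3 (P : T) : cubic_m P = 1 -> P != ptL.
  by move=> P1; apply: neq_cm; rewrite P1 l2; apply: (@neqC _ _ 0); right; ring.
apply: uniq5.
- exact: (hA _ q1).
- exact: (hA _ r1).
- exact: (hA _ c1).
- exact: (hA _ l1).
- apply/eqP => h; have := congr1 (@cubic_y R) h; rewrite q3 r3 => /eqP.
  by rewrite -addr_eq0 -mulr2n mulrn_eq0 /= (negbTE sqrtN11_neq0).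
- exact: (e2 _ q2).
- exact: (e3 _ q2).
- exact: (e2 _ r2).
- exact: (e3 _ r2).
- exact: neq_cm e1.
Qed.

End CriticalPoints.

(** * The real structure *)

Section RealPart.
Variable R : realType.
Local Notation C := (cplx R).
Local Notation c := (@cplx_of_real R).
Local Notation T := (torus R).
Local Notation r := (c (rho R)).
Local Notation trigonal_map := (@trigonal_map R).

Lemma finite_pt_sig (P : T) : finite_pt (torus_conj P) = finite_pt P.
Proof.
rewrite /finite_pt affine_sig /yj torus_inv_sig yT_sig; congr (_ || ~~ _).
by rewrite -[X in _ == X](rmorph1 Num.conj) (inj_eq (can_inj conjCK)).
Qed.

Lemma cubic_mA_sig (P : T) : cubic_mA (torus_conj P) = (cubic_mA P)^*.
Proof.
rewrite /cubic_mA /mT xT_sig yT_sig sqrrN; move: (xT P) (yT P) => x y.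
rewrite -[x^* ^+ 2](rmorphXn Num.conj) -rmorphD /=; move: (y + x ^+ 2) => w.
have -> : 3 * r ^+ 2 = c (3 * rho R ^+ 2) by rewrite cRM cRX cRn.
rewrite -[in LHS](conj_cR (3 * rho R ^+ 2)) -rmorphM /=; move: (_ * w) => v.
by rewrite rmorphM rmorphB fmorphV !rmorph_nat.
Qed.

Lemma cubic_m_sig (P : T) : cubic_m (torus_conj P) = (cubic_m P)^*.
Proof.
rewrite /cubic_m affine_sig; case: ifP => _; first exact: cubic_mA_sig.
by rewrite rmorphM fmorphV !rmorph_nat.
Qed.

Lemma cubic_y_sig (P : T) : cubic_y (torus_conj P) = - (cubic_y P)^*.
Proof.
rewrite /cubic_y affine_sig; case: ifP => _; last by rewrite rmorph0 oppr0.
rewrite /cubic_yA cubic_mA_sig xT_sig mulrN mulNr; congr (- _).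
move: (xT P) (cubic_mA P) => x m.
by rewrite !rmorphM rmorphB rmorphM !rmorph_nat /= conj_cR.
Qed.

(** A is the only point that is not finite, and the involution preserves finiteness. *)
Lemma ptA_sig : torus_conj (ptA R) = ptA R.
Proof. by apply: nfin_ptA; rewrite finite_pt_sig ptA_nfin. Qed.

Lemma conj_sqrtN11 : (sqrtN11 R)^* = - sqrtN11 R.
Proof. by rewrite /sqrtN11 rmorphM /= conj_cR conj_ii mulNr. Qed.

Lemma ptQ_sig (y : C) : y ^+ 2 = - 11 -> y^* = - y -> torus_conj (ptQ y) = ptQ y.
Proof.
move=> y2 yc; have [h1 h2 h3] := finQ y2.
apply: cubic_m_inj; rewrite ?finite_pt_sig // ?cubic_m_sig ?cubic_y_sig ?h2 ?h3 ?rmorph1 //.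
by rewrite yc opprK.
Qed.

Lemma finite_pt_sig_real (P : T) : torus_conj P = P -> (cubic_y P)^* = - cubic_y P.
Proof. by move=> h; rewrite -{2}h cubic_y_sig opprK. Qed.

Lemma ptC_not_real : torus_conj (ptC R) <> ptC R.
Proof.
have [h1 h2 h3] := cubic_ptP (curveC R).
move=> /finite_pt_sig_real; rewrite h3 rmorph_nat => /eqP; apply/negP.
by apply: (@neqC _ _ _ 15); left; ring.
Qed.

Lemma ptL_not_real : torus_conj (ptL R) <> ptL R.
Proof.
have [h1 h2 h3] := cubic_ptP (curveL R).
move=> /finite_pt_sig_real; rewrite h3 rmorphN rmorph_nat => /eqP; apply/negP.
by apply: (@neqC _ _ _ 7); right; ring.
Qed.

Lemma critical_count_all : @critical_points_count R (torus_surface R) (riemann_sphere R)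
  trigonal_map setT = 6%N.
Proof.
rewrite /critical_points_count (fsbigE (critical_points R)) //.
- rewrite /critical_points !big_cons big_nil !in_setT.
  rewrite mult_ptA !mult_ptQ ?mult_ptC ?mult_ptL ?sqrrN ?sqrtN11K //.
- exact: critical_points_uniq.
- by move=> P _; exact: mult_fin_ptP.
Qed.

Lemma real_critical_uniq :
  uniq [:: ptA R; ptQ (sqrtN11 R); ptQ (- sqrtN11 R)].
Proof.
have := critical_points_uniq R.
rewrite -[critical_points R]/([:: ptA R; ptQ (sqrtN11 R); ptQ (- sqrtN11 R)] ++
  [:: ptC R; ptL R]).
by rewrite cat_uniq => /and3P[].
Qed.

Lemma critical_count_real : @critical_points_count R (torus_surface R) (riemann_sphere R)
  trigonal_map (@real_part R (torus_curve R)) = 3%N.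
Proof.
have rA : @real_part R (torus_curve R) (ptA R) := ptA_sig.
have rQ : @real_part R (torus_curve R) (ptQ (sqrtN11 R)).
  exact: ptQ_sig (sqrtN11K R) conj_sqrtN11.
have N2 : (- sqrtN11 R) ^+ 2 = - 11 by rewrite sqrrN sqrtN11K.
have rQ' : @real_part R (torus_curve R) (ptQ (- sqrtN11 R)).
  by apply: ptQ_sig N2 _; rewrite rmorphN /= conj_sqrtN11.
rewrite /critical_points_count (fsbigE [:: ptA R; ptQ (sqrtN11 R); ptQ (- sqrtN11 R)]).
- rewrite !big_cons big_nil (mem_set rA) (mem_set rQ) (mem_set rQ').
  by rewrite mult_ptA !mult_ptQ ?sqrtN11K.
- exact: real_critical_uniq.
- by move=> P /=; rewrite !inE => /or3P[] /eqP ->.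
- move=> P rP nP; apply: mult_fin_ptP.
  rewrite /critical_points -[_ :: _]/([:: ptA R; ptQ (sqrtN11 R); ptQ (- sqrtN11 R)] ++
    [:: ptC R; ptL R]) mem_cat negb_or nP /=.
  rewrite !inE negb_or; apply/andP; split; apply/eqP => PE; move: rP; rewrite PE.
    exact: ptC_not_real.
  exact: ptL_not_real.
Qed.

(** Equality of the two values would force a d - b e = 0. The case e = 0 is separate, as infinity is
    then fixed. *)
Lemma moebius_infty_neq (a b e d q : C) : a * d - b * e != 0 ->
  moebius a b e d (Some q) <> moebius a b e d None.
Proof.
move=> det; rewrite /moebius; have [e0|e0] := eqVneq e 0.
  case: eqP => // h; move: det; rewrite e0 mul0r add0r in h.
  by rewrite h e0 !mulr0 subrr eqxx.
case: eqP => // /eqP n0 [] /eqP; rewrite eqr_div // => /eqP h.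
move/eqP: det; apply.
transitivity (a * (e * q + d) - (a * q + b) * e); first by ring.
by rewrite h subrr.
Qed.

Lemma trigonal_map_not_real : ~ @can_be_made_real R (torus_curve R) trigonal_map.
Proof.
move=> [phi [a [b [e [d [det ->]]]]] h].
have hA := congr1 (fun F => F (ptA R : torus_curve R)) h.
have hB := congr1 (fun F => F (ptB R : torus_curve R)) h.
rewrite /= ptA_sig /trigonal_map trigonal_ptA in hA.
have [b1 b2 b3] := cubic_ptP (cubic0 R).
have fB : trigonal (torus_conj (ptB R)) = Some 5.
  rewrite /trigonal finite_pt_sig b1 cubic_m_sig cubic_y_sig b2 b3 rmorph0 eqxx /= rmorph_nat.
  by rewrite eqxx.
(* Reality at A says that phi(infinity) is its own conjugate; reality at B says that conj(phi(5)) =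
   phi(infinity). Together they give conj(phi(5)) = conj(phi(infinity)). *)
rewrite /= /trigonal_map trigonal_ptB fB -hA in hB.
apply: (@moebius_infty_neq a b e d 5 det).
have conjI : injective (@sphere_conj R).
  move=> [z|] [w|] //= [] hz; congr Some.
  by rewrite -[z]conjCK hz conjCK.
exact: conjI hB.
Qed.

End RealPart.

Local Close Scope ring_scope.

Theorem proposition1 (R : realType) :
  exists (E : real_elliptic_curve R) (f : E -> riemann_sphere R),
    [/\ real_part E !=set0,
        holomorphic_map f,
        has_degree f 3,
        critical_points_count f setT = 6 /\
        critical_points_count f (real_part E) = 3 &
        ~ can_be_made_real f].
Proof.
exists (torus_curve R), (@trigonal_map R); split.
- exists (ptA R); exact: ptA_sig.
- exact: trigonal_holomorphic.
- exact: trigonal_has_degree.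
- split; [exact: critical_count_all|exact: critical_count_real].
- exact: trigonal_map_not_real.
Qed.
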